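(* Let $\mu<1/2$, $\delta\in[0,\pi/2)$, $x_0>0$, and let $f\in L_1\left(\mathbb{R}_+;\,e^{(\pi-2\delta)\tau}(\tau+1)^{2\mu}\,d\tau\right)$. Then the index transform $$(F_\mu f)(x)=\frac{e^x}{x}\int_0^\infty W_{\mu,i\tau}^2(x)\,f(\tau)\,d\tau,\qquad x>0,$$ is a bounded map $$F_\mu:\ L_1\left(\mathbb{R}_+;\,e^{(\pi-2\delta)\tau}(\tau+1)^{2\mu}\,d\tau\right)\to C\left([x_0,\infty)\right),$$ and it can be represented as a composition of the Laplace and Olevskii transforms, namely, for $x>0$, $$(F_\mu f)(x)=\int_0^\infty t^{-2\mu}e^{-xt}\,G(t)\,dt,$$ where $$G(t)=\frac{1}{\Gamma(1-2\mu)}\int_0^\infty {}_2F_1\left(\tfrac12-\mu-i\tau,\ \tfrac12-\mu+i\tau;\ 1-2\mu;\ -t^2-2t\right)f(\tau)\,d\tau,\qquad t>0.$$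
   Context: Here $\mu$ is real, $\mathbb{R}_+=(0,\infty)$, $\Gamma$ is Euler's gamma function, $W_{\mu,\nu}(x)$ is the Whittaker function (the solution of Whittaker's equation decaying at $+\infty$), and ${}_2F_1$ is the Gauss hypergeometric function (analytically continued to the negative real axis in its argument). For a positive weight $\omega$, $L_p(\mathbb{R}_+;\omega(\tau)\,d\tau)$ is the weighted Lebesgue space with norm $\left(\int_0^\infty|f(\tau)|^p\,\omega(\tau)\,d\tau\right)^{1/p}$. The space $C([x_0,\infty))$ carries the norm $\sup_{x\ge x_0}|\cdot|$. *)

(* Defs.v *)
From HB Require Import structures.
From mathcomp Require Import all_boot all_order all_algebra.
From mathcomp Require Import all_classical all_reals all_analysis.
From mathcomp.real_closed Require Import complex.

Set Implicit Arguments.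
Unset Strict Implicit.
Unset Printing Implicit Defensive.

Import Order.TTheory GRing.Theory Num.Theory.
Import numFieldNormedType.Exports.

Local Open Scope classical_set_scope.
Local Open Scope ring_scope.
Local Open Scope complex_scope.

Section ComplexValued.
Context {R : realType}.

(* No normed-space structure of R[i] over R is available, so limits,
   derivatives, continuity and Lebesgue integrals of R[i]-valued functions
   are taken componentwise. *)
Definition cRe (T : Type) (f : T -> R[i]) (x : T) : R := complex.Re (f x).
Definition cIm (T : Type) (f : T -> R[i]) (x : T) : R := complex.Im (f x).

Definition cvgC (T : Type) (F : set_system T) (f : T -> R[i]) (l : R[i]) :=
  (cRe f @ F --> complex.Re l) /\ (cIm f @ F --> complex.Im l).

Definition is_deriveC (f : R -> R[i]) (x : R) (df : R[i]) :=
  is_derive x 1 (cRe f) (complex.Re df) /\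
  is_derive x 1 (cIm f) (complex.Im df).

Definition continuousC_on (A : set R) (f : R -> R[i]) :=
  {within A, continuous (cRe f)} /\ {within A, continuous (cIm f)}.

Definition integrableC (A : set R) (f : R -> R[i]) :=
  lebesgue_measure.-integrable A (EFin \o cRe f) /\
  lebesgue_measure.-integrable A (EFin \o cIm f).

Definition integralC (A : set R) (f : R -> R[i]) : R[i] :=
  Rintegral lebesgue_measure A (cRe f) +i*
  Rintegral lebesgue_measure A (cIm f).

Definition has_sumC (u : nat -> R[i]) (s : R[i]) :=
  cvgC \oo (fun n => \sum_(k < n) u k) s.

End ComplexValued.

Section SpecialFunctions.
Context {R : realType}.

(* Euler's integral; only meaningful for x > 0. *)
Definition Gamma (x : R) : R :=
  Rintegral lebesgue_measure `]0, +oo[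
    (fun t => t `^ (x - 1) * expR (- t)).

(* W'' + (-1/4 + mu/x + (1/4 - nu^2)/x^2) W = 0 on (0, +oo). *)
Definition whittaker_equation (mu : R) (nu : R[i]) (w : R -> R[i]) :=
  exists w1 w2 : R -> R[i], forall x : R, 0 < x ->
    [/\ is_deriveC w x (w1 x), is_deriveC w1 x (w2 x) &
        w2 x + (- 4^-1 + (mu / x)%:C
                + (4^-1 - nu ^+ 2) / (x ^+ 2)%:C) * w x = 0].

(* Decay at infinity fixes a solution up to a scalar factor; the factor is the
   standard one, W_{mu,nu}(x) ~ x^mu e^{-x/2} as x -> +oo. *)
Definition is_whittakerW (mu : R) (nu : R[i]) (w : R -> R[i]) :=
  whittaker_equation mu nu w /\
  cvgC +oo%R (fun x : R => (x `^ (- mu) * expR (x / 2))%:C * w x) 1.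

(* Determined on (0, +oo) only. *)
Definition whittakerW (mu : R) (nu : R[i]) : R -> R[i] :=
  xget (fun=> 0) [set w | is_whittakerW mu nu w].

Definition pochhammer (a : R[i]) (n : nat) : R[i] :=
  \prod_(k < n) (a + k%:R).

Definition gauss_coef (a b c : R[i]) (n : nat) : R[i] :=
  pochhammer a n * pochhammer b n / (pochhammer c n * (n`!)%:R).

Definition analytic_at (g : R -> R[i]) (x : R) :=
  exists (r : R) (u : nat -> R[i]), 0 < r /\
    forall h : R, `|h| < r -> has_sumC (fun n => u n * h%:C ^+ n) (g (x + h)).

(* g is the sum of Gauss's series on (-1, 1) and its analytic continuation
   along the real axis to (-oo, 1). *)
Definition is_hyp2F1 (a b c : R[i]) (g : R -> R[i]) :=
  (forall x : R, `|x| < 1 ->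
     has_sumC (fun n => gauss_coef a b c n * x%:C ^+ n) (g x)) /\
  (forall x : R, x < 1 -> analytic_at g x).

(* Determined on (-oo, 1) only, for c not a nonpositive integer. *)
Definition hyp2F1 (a b c : R[i]) : R -> R[i] :=
  xget (fun=> 0) [set g | is_hyp2F1 a b c g].

End SpecialFunctions.

Section Transforms.
Context {R : realType}.

(* Membership in L_1((0, +oo); w(tau) dtau), for a positive weight w. *)
Definition in_L1w (w : R -> R) (f : R -> R[i]) :=
  integrableC `]0, +oo[ (fun tau => (w tau)%:C * f tau).

Definition L1w_norm (w : R -> R) (f : R -> R[i]) : R :=
  Rintegral lebesgue_measure `]0, +oo[
    (fun tau => ComplexField.Normc.normc (f tau) * w tau).

Definition index_weight (mu delta tau : R) : R :=
  expR ((pi - 2 * delta) * tau) * (tau + 1) `^ (2 * mu).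

Definition index_integrand (mu : R) (f : R -> R[i]) (x tau : R) : R[i] :=
  whittakerW mu (0 +i* tau) x ^+ 2 * f tau.

Definition index_transform (mu : R) (f : R -> R[i]) (x : R) : R[i] :=
  (expR x / x)%:C * integralC `]0, +oo[ (index_integrand mu f x).

Definition olevskii_integrand (mu : R) (f : R -> R[i]) (t tau : R) : R[i] :=
  hyp2F1 ((2^-1 - mu) -i* tau) ((2^-1 - mu) +i* tau) (1 - 2 * mu)%:C
         (- t ^+ 2 - 2 * t) * f tau.

Definition olevskii_transform (mu : R) (f : R -> R[i]) (t : R) : R[i] :=
  ((Gamma (1 - 2 * mu))^-1)%:C *
  integralC `]0, +oo[ (olevskii_integrand mu f t).

Definition laplace_integrand (h : R -> R[i]) (x t : R) : R[i] :=
  (expR (- (x * t)))%:C * h t.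

Definition laplace_transform (h : R -> R[i]) (x : R) : R[i] :=
  integralC `]0, +oo[ (laplace_integrand h x).

(* T is a bounded linear operator from L_1((0, +oo); w(tau) dtau) to
   C([x0, +oo)) with the supremum norm. *)
Definition bounded_L1w_to_C (w : R -> R) (x0 : R)
    (T : (R -> R[i]) -> R -> R[i]) :=
  [/\ forall (a : R[i]) (f g : R -> R[i]), in_L1w w f -> in_L1w w g ->
        forall x, x0 <= x ->
          T (fun tau => a * f tau + g tau) x = a * T f x + T g x,
      forall f, in_L1w w f -> continuousC_on `[x0, +oo[ (T f) &
      exists C : R, forall f, in_L1w w f ->
        forall x, x0 <= x ->
          ComplexField.Normc.normc (T f x) <= C * L1w_norm w f].

End Transforms.

(* Main.v *)
Require Import Defs.
From mathcomp Require Import all_boot all_order all_algebra.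
From mathcomp Require Import all_classical all_reals all_analysis.
From mathcomp Require Import measurable_realfun lebesgue_integral_under.
From mathcomp.real_closed Require Import complex.
From mathcomp Require Import ring lra.

Import Order.TTheory GRing.Theory Num.Theory.
Import numFieldNormedType.Exports.

Local Open Scope classical_set_scope.
Local Open Scope ring_scope.
Local Open Scope complex_scope.

Set Implicit Arguments.
Unset Strict Implicit.
Unset Printing Implicit Defensive.

(** Put [c = 1 - 2 mu > 0] and [kappa = c ^ 2 / 4 + tau ^ 2], which is the
    product of the two upper parameters of the hypergeometric function. All the
    special functions of the statement are then real: with
    [phi z = 2F1 (c/2 - i tau, c/2 + i tau; c; - z)] and
    [psi t = phi (t ^ 2 + 2 t)], the theorem follows from the product formula

      W_{mu, i tau} (x) ^ 2
        = x e ^ (-x) / Gamma c * int_0^oo e ^ (- x t) t ^ (c - 1) psi t dt,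

    from a bound of [phi] on the half-line that is linear in [tau], and from
    Fubini's theorem: multiplying by [f tau e ^ x / x] and integrating in [tau],
    the order of the two integrations may be exchanged because the weight
    [e ^ ((pi - 2 delta) tau) (tau + 1) ^ (2 mu)] dominates [1 + tau].

    The product formula is proved with differential equations. The
    hypergeometric equation for [phi], integrated by parts against
    [e ^ (- x t)], shows that

      W0 (x) = e ^ (- x / 2) x ^ (1 - mu) / Gamma c
               * int_0^oo e ^ (- x t) t ^ (c - 1) phi t dt

    solves Whittaker's equation [w'' = q w] ([uW_ode], [W1_derive]), and that
    the right-hand side [V] of the product formula solves
    [V''' = 4 q V' + 2 q' V] ([uV_ode], [V2_derive]), which is the equation of
    the squares of solutions of [w'' = q w]. The behaviour of both at infinity
    is read off from [phi 0 = 1] ([laplaceR_asymptotic]). The combination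
    [V' W0 - 2 V W0'] is again a solution of [w'' = q w], and it is of smaller
    order than [W0] at infinity, so that it vanishes ([decaying_zero]). Hence
    [V / W0 ^ 2] is constant, equal to [1], near infinity, and uniqueness for
    the equation of order three extends the equality to the half-line
    ([V0_sqr]). The same lemma [decaying_zero] shows that [W0] is the only
    solution with the prescribed asymptotics, that is, the Whittaker function
    ([whittakerWE]).

    The analytic continuation of Gauss's series to the negative axis is obtained
    from one power series in [z / (1 + z)], which converges for all [z >= 0]
    ([phi_sol]). It agrees with Gauss's series where both are defined because
    the hypergeometric equation has only one solution regular at [0] with a
    given value there ([hyp_sol_unique0]). Solutions of the equation are
    real-analytic at ordinary points ([ode_real_analytic]), and the identity
    theorem ([real_analytic_unique]) then shows that this is the continuation
    meant in the statement ([hyp2F1_neg]).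

    The bound on [phi] comes from two estimates: a maximum principle for
    [(1 + z) phi'], which controls [phi] up to [z = c / (2 kappa)], and a weighted
    energy, nonincreasing in [z], which controls it from there on
    ([phi_bound]). *)

(** * Differential calculus on the line *)

Section Derivatives.
Context {R : realType}.
Implicit Types (f g : R -> R) (x a b : R).

Lemma derive_val_eq f x a b : is_derive x 1 f a -> a = b -> is_derive x 1 f b.
Proof. by move=> + <-. Qed.

Lemma derive_ext f g x a : f =1 g -> is_derive x 1 f a -> is_derive x 1 g a.
Proof. by move=> /funext ->. Qed.

Lemma der_cst x a : is_derive x 1 (fun _ => a) 0.
Proof. exact: is_derive_cst. Qed.

Lemma der_id x : is_derive x 1 (fun t : R => t) 1.
Proof. exact: is_derive_id. Qed.

Lemma der_add f g x a b : is_derive x 1 f a -> is_derive x 1 g b ->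
  is_derive x 1 (fun t => f t + g t) (a + b).
Proof. by move=> df dg; exact: is_deriveD. Qed.

Lemma der_opp f x a : is_derive x 1 f a -> is_derive x 1 (fun t => - f t) (- a).
Proof. by move=> df; exact: is_deriveN. Qed.

Lemma der_mul f g x a b : is_derive x 1 f a -> is_derive x 1 g b ->
  is_derive x 1 (fun t => f t * g t) (f x * b + g x * a).
Proof. by move=> df dg; exact: is_deriveM. Qed.

Lemma der_inv f x a : f x != 0 -> is_derive x 1 f a ->
  is_derive x 1 (fun t => (f t)^-1) (- (f x) ^- 2 * a).
Proof. by move=> f0 df; exact: is_deriveV. Qed.

Lemma der_exp f x a n : is_derive x 1 f a ->
  is_derive x 1 (fun t => f t ^+ n) (n%:R * f x ^+ n.-1 * a).
Proof.
move=> df; elim: n => [|n ih].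
  by apply: derive_val_eq (der_cst x 1) _; rewrite !mul0r.
apply: derive_ext (derive_val_eq (der_mul df ih) _).
  by move=> t; rewrite exprS.
case: n {ih} => [|n] /=; first by rewrite expr0 !mul0r mulr0 add0r !mul1r.
by rewrite exprS -[n.+2%:R]natr1 ; ring.
Qed.

Lemma der_comp f g x a b : is_derive (g x) 1 f a -> is_derive x 1 g b ->
  is_derive x 1 (fun t => f (g t)) (a * b).
Proof. by move=> df dg; exact: is_derive1_comp. Qed.

Lemma der_expR f x a : is_derive x 1 f a ->
  is_derive x 1 (fun t => expR (f t)) (expR (f x) * a).
Proof. by move=> df; apply: der_comp df; exact: is_derive_expR. Qed.

Lemma der_powR f x a (p : R) : 0 < f x -> is_derive x 1 f a ->
  is_derive x 1 (fun t => f t `^ p) (p * f x `^ (p - 1) * a).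
Proof. by move=> f0 df; apply: (der_comp (f := fun t => t `^ p)) df; exact: is_derive1_powR. Qed.

Lemma derive_continuous f x a : is_derive x 1 f a -> {for x, continuous f}.
Proof. by move=> df; apply: differentiable_continuous; apply/derivable1_diffP. Qed.

(** Derivatives and continuity on a segment are those of the ambient line, so
    that the mean value theorem needs no separate continuity hypothesis. *)
Lemma derive_within f f' a b :
  (forall x, a <= x <= b -> is_derive x 1 f (f' x)) ->
  {within `[a, b], continuous f}.
Proof.
move=> df; apply: derivable_within_continuous => x; rewrite in_itv /= => h.
by have := df x h.
Qed.

Lemma derive_near f g x a r : 0 < r ->
  (forall t, `|t - x| < r -> f t = g t) ->
  is_derive x 1 f a -> is_derive x 1 g a.
Proof.
move=> r0 fg; apply: near_eq_is_derive.
by exists r => //= t /=; rewrite distrC; exact: fg.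
Qed.

Lemma derive_unique f x a b : is_derive x 1 f a -> is_derive x 1 f b -> a = b.
Proof. by move=> [_ <-] [_ <-]. Qed.

End Derivatives.

(** Computes a derivative along the syntax of the function. Type class search is
    kept out, because it would find derivatives expressed with scaling instead
    of multiplication, and eta-contracted products have cases of their own. *)
Ltac der_tac := repeat first
  [ eassumption
  | match goal with
    | |- is_derive _ _ (fun _ => ?a) _ => notypeclasses refine (der_cst _ _)
    | |- is_derive _ _ (@GRing.mul _ ?a) _ =>
        notypeclasses refine (der_mul (f := fun _ => a) (g := fun t => t) _ _)
    | |- is_derive _ _ (@GRing.add _ ?a) _ =>
        notypeclasses refine (der_add (f := fun _ => a) (g := fun t => t) _ _)
    | |- is_derive _ _ (@GRing.opp _) _ =>
        notypeclasses refine (der_opp (f := fun t => t) _)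
    | |- is_derive _ _ (@GRing.inv _) _ =>
        notypeclasses refine (der_inv (f := fun t => t) _ _)
    | |- is_derive _ _ expR _ =>
        notypeclasses refine (der_expR (f := fun t => t) _)
    | |- is_derive _ _ (fun t => t) _ => notypeclasses refine (der_id _)
    | |- is_derive _ _ (fun t => t `^ ?p) _ =>
        notypeclasses refine (der_powR (f := fun t => t) p _ _)
    | |- is_derive _ _ (fun t => expR (@?f t)) _ => notypeclasses refine (der_expR _)
    | |- is_derive _ _ (fun t => (@?f t) `^ _) _ => notypeclasses refine (der_powR _ _ _)
    | |- is_derive _ _ (fun t => (@?f t)^-1) _ => notypeclasses refine (der_inv _ _)
    | |- is_derive _ _ (fun t => - (@?f t)) _ => notypeclasses refine (der_opp _)
    | |- is_derive _ _ (fun t => (@?f t) + (@?g t)) _ => notypeclasses refine (der_add _ _)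
    | |- is_derive _ _ (fun t => (@?f t) * (@?g t)) _ => notypeclasses refine (der_mul _ _)
    | |- is_derive _ _ (fun t => (@?f t) ^+ _) _ => notypeclasses refine (der_exp _ _)
    end ].
Ltac der := notypeclasses refine (derive_val_eq _ _); [der_tac | cbv beta ].

Section MeanValue.
Context {R : realType}.
Implicit Types (f g : R -> R) (x a b : R).

Lemma derive_ge0_le f f' a b : a <= b ->
  (forall x, a <= x <= b -> is_derive x 1 f (f' x)) ->
  (forall x, a < x < b -> 0 <= f' x) -> f a <= f b.
Proof.
rewrite le_eqVlt => /predU1P[->//|ab] df f0.
have [x|x|x xab /eqP] := @MVT R f f' a b ab.
- by rewrite in_itv /= => /andP[h1 h2]; apply: df; rewrite !ltW.
- exact: (derive_within df).
rewrite subr_eq => /eqP ->; rewrite lerDr mulr_ge0 ?subr_ge0 ?(ltW ab)//.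
by apply: f0; move: xab; rewrite in_itv.
Qed.

Lemma derive_le0_ge f f' a b : a <= b ->
  (forall x, a <= x <= b -> is_derive x 1 f (f' x)) ->
  (forall x, a < x < b -> f' x <= 0) -> f b <= f a.
Proof.
move=> ab df f0; rewrite -lerN2.
apply: (@derive_ge0_le (fun t => - f t) (fun t => - f' t)) => // x h.
  by apply: der_opp; exact: df.
by rewrite oppr_ge0 f0.
Qed.

Lemma derive0_cst f a b : a <= b ->
  (forall x, a <= x <= b -> is_derive x 1 f 0) -> f a = f b.
Proof.
move=> ab df; apply: le_anti; apply/andP; split.
  exact: (derive_ge0_le ab df).
exact: (derive_le0_ge ab df).
Qed.

Lemma derive_bound f f' a b (K : R) : a <= b ->
  (forall x, a <= x <= b -> is_derive x 1 f (f' x)) ->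
  (forall x, a < x < b -> `|f' x| <= K) -> `|f b - f a| <= K * (b - a).
Proof.
move=> ab df fK.
have dl s : forall x, a <= x <= b -> is_derive x 1 (fun t => f t - s * t) (f' x - s).
  move=> x /df dx; der.
  by rewrite mulr0 addr0 mulr1.
have := derive_ge0_le ab (dl (- K)).
have := derive_le0_ge ab (dl K) => /=.
move=> h2 h3; rewrite ler_norml; apply/andP; split.
  suff: f a - - K * a <= f b - - K * b by lra.
  by apply: h3 => x /fK; rewrite ler_norml => /andP[]; lra.
suff: f b - K * b <= f a - K * a by lra.
by apply: h2 => x /fK; rewrite ler_norml => /andP[]; lra.
Qed.

(** One-sided form of Fermat's criterion: [z] may be the right end of the
    segment on which [f] is maximised. *)
Lemma derive_at_max f z d : 0 < z ->
  (forall x, 0 <= x <= z -> f x <= f z) -> is_derive z 1 f d -> 0 <= d.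
Proof.
move=> z0 fmax [dfz <-]; rewrite leNgt; apply/negP => dneg.
move/cvg_ex : (dfz) => [l]/=.
under eq_fun do rewrite scaler1.
move=> hl; have ld : 'D_1 f z = l.
  rewrite /derive; apply/cvg_lim => //.
  by under eq_fun do rewrite scaler1.
rewrite ld in dneg.
move/cvgrPdist_lt : hl => /(_ (- l)); rewrite oppr_gt0 => /(_ dneg) [e /= e0 he].
pose h : R := - (Num.min e z / 2).
have m0 : 0 < Num.min e z by rewrite lt_min e0 z0.
have me : Num.min e z <= e by rewrite ge_min lexx.
have mz : Num.min e z <= z by rewrite ge_min lexx orbT.
have hneg : h < 0 by rewrite /h; lra.
have := he h; rewrite /= sub0r normrN ltr0_norm// => {}he.
have {}he := he ltac:(rewrite /h; lra) (ltr0_neq0 hneg).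
have fh : f (h + z) <= f z by apply: fmax; rewrite /h; apply/andP; split; lra.
have q : 0 <= h^-1 *: (f (h + z) - f z).
  by rewrite /GRing.scale /= mulr_le0 // ?invr_le0 ?subr_le0 // ltW.
move: he; rewrite ltr_norml => /andP[]; lra.
Qed.

End MeanValue.

(** * Uniqueness for linear differential equations *)

Section Gronwall.
Context {R : realType}.
Implicit Types (y E : R -> R) (x a b K : R).

(** Both [E t * expR (- K t)] and [E t * expR (K t)] are monotone, so a zero
    of [E] propagates to the right and to the left. *)
Lemma gronwall_zero E E' a b K x0 :
  (forall x, a < x < b -> is_derive x 1 E (E' x)) ->
  (forall x, a < x < b -> 0 <= E x) ->
  (forall x, a < x < b -> `|E' x| <= K * E x) ->
  a < x0 < b -> E x0 = 0 -> forall x, a < x < b -> E x = 0.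
Proof.
move=> dE E0 E'K /andP[ax0 x0b] Ex0 x /andP[ax xb].
apply: le_anti; rewrite E0 ?ax ?xb // andbT.
have dk k t : a < t < b ->
    is_derive t 1 (fun t => E t * expR (k * t)) ((E' t + k * E t) * expR (k * t)).
  by move=> /dE dt; der; ring.
have [xx0|/ltW x0x] := leP x x0.
  have := @derive_ge0_le R (fun t => E t * expR (K * t))
    (fun t => (E' t + K * E t) * expR (K * t)) x x0 xx0.
  rewrite Ex0 mul0r pmulr_lle0 ?expR_gt0 //; apply=> t /andP[h1 h2].
    by apply: dk; lra.
  have ht : a < t < b by lra.
  rewrite mulr_ge0 ?expR_ge0 //.
  by have := E'K _ ht; rewrite ler_norml => /andP[]; lra.
have := @derive_le0_ge R (fun t => E t * expR (- K * t))
  (fun t => (E' t + - K * E t) * expR (- K * t)) x0 x x0x.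
rewrite Ex0 mul0r pmulr_lle0 ?expR_gt0 //; apply=> t /andP[h1 h2].
  by apply: dk; lra.
have ht : a < t < b by lra.
rewrite mulr_le0_ge0 ?expR_ge0 //.
by have := E'K _ ht; rewrite ler_norml => /andP[]; lra.
Qed.

Lemma ode2_zero y y1 y2 a b K x0 :
  (forall x, a < x < b -> is_derive x 1 y (y1 x)) ->
  (forall x, a < x < b -> is_derive x 1 y1 (y2 x)) ->
  (forall x, a < x < b -> `|y2 x| <= K * (`|y x| + `|y1 x|)) ->
  a < x0 < b -> y x0 = 0 -> y1 x0 = 0 -> forall x, a < x < b -> y x = 0.
Proof.
move=> dy dy1 yK hx0 yx0 y1x0 x hx.
suff : y x ^+ 2 + y1 x ^+ 2 = 0.
  by move=> /eqP; rewrite paddr_eq0 ?sqr_ge0 // sqrf_eq0 => /andP[/eqP].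
have K0 : 0 <= `|K| by [].
apply: (@gronwall_zero (fun t => y t ^+ 2 + y1 t ^+ 2)
  (fun t => 2 * y t * y1 t + 2 * y1 t * y2 t) a b (1 + 3 * `|K|) x0) => //.
- move=> t ht; have := dy t ht; have := dy1 t ht => ? ?.
  by der; rewrite /=; ring.
- by move=> t _; rewrite addr_ge0 ?sqr_ge0.
- move=> t ht; have {}yK : `|y2 t| <= `|K| * (`|y t| + `|y1 t|).
    by rewrite (le_trans (yK t ht)) // ler_wpM2r ?addr_ge0 // ler_norm.
  rewrite (le_trans (ler_normD _ _)) // !normrM ger0_norm //.
  rewrite -(real_normK (num_real (y t))) -(real_normK (num_real (y1 t))).
  move: (normr_ge0 (y t)) (normr_ge0 (y1 t)) (normr_ge0 (y2 t)) yK K0.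
  move: `|y t| `|y1 t| `|y2 t| `|K| => A B C k A0 B0 C0 Ck k0.
  have : B * C <= B * (k * (A + B)) by rewrite ler_wpM2l.
  have : 0 <= k * (A - B) ^+ 2 by rewrite mulr_ge0 ?sqr_ge0.
  have : 0 <= k * A ^+ 2 by rewrite mulr_ge0 ?sqr_ge0.
  have : 0 <= (A - B) ^+ 2 by rewrite sqr_ge0.
  by rewrite !sqrrB; nra.
- by rewrite yx0 y1x0 expr0n addr0.
Qed.

Lemma ode3_zero y y1 y2 y3 a b K x0 :
  (forall x, a < x < b -> is_derive x 1 y (y1 x)) ->
  (forall x, a < x < b -> is_derive x 1 y1 (y2 x)) ->
  (forall x, a < x < b -> is_derive x 1 y2 (y3 x)) ->
  (forall x, a < x < b -> `|y3 x| <= K * (`|y x| + `|y1 x| + `|y2 x|)) ->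
  a < x0 < b -> y x0 = 0 -> y1 x0 = 0 -> y2 x0 = 0 ->
  forall x, a < x < b -> y x = 0.
Proof.
move=> dy dy1 dy2 yK hx0 yx0 y1x0 y2x0 x hx.
suff : y x ^+ 2 + (y1 x ^+ 2 + y2 x ^+ 2) = 0.
  by move=> /eqP; rewrite paddr_eq0 ?addr_ge0 ?sqr_ge0 // sqrf_eq0 => /andP[/eqP].
have K0 : 0 <= `|K| by [].
apply: (@gronwall_zero (fun t => y t ^+ 2 + (y1 t ^+ 2 + y2 t ^+ 2))
  (fun t => 2 * y t * y1 t + 2 * y1 t * y2 t + 2 * y2 t * y3 t) a b
  (2 + 4 * `|K|) x0) => //.
- move=> t ht; have := dy t ht; have := dy1 t ht; have := dy2 t ht => ? ? ?.
  by der; rewrite /=; ring.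
- by move=> t _; rewrite !addr_ge0 ?sqr_ge0.
- move=> t ht; have {}yK : `|y3 t| <= `|K| * (`|y t| + `|y1 t| + `|y2 t|).
    by rewrite (le_trans (yK t ht)) // ler_wpM2r ?addr_ge0 // ler_norm.
  rewrite (le_trans (ler_normD _ _)) //.
  rewrite (le_trans (lerD (ler_normD _ _) (lexx _))) // !normrM ger0_norm //.
  rewrite -(real_normK (num_real (y t))) -(real_normK (num_real (y1 t))).
  rewrite -(real_normK (num_real (y2 t))).
  move: (normr_ge0 (y t)) (normr_ge0 (y1 t)) (normr_ge0 (y2 t)) yK K0.
  move: `|y t| `|y1 t| `|y2 t| `|y3 t| `|K| => A B C D k A0 B0 C0 Ck k0.
  have : C * D <= C * (k * (A + B + C)) by rewrite ler_wpM2l.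
  have : 0 <= k * (A - C) ^+ 2 by rewrite mulr_ge0 ?sqr_ge0.
  have : 0 <= k * (B - C) ^+ 2 by rewrite mulr_ge0 ?sqr_ge0.
  have : 0 <= k * A ^+ 2 by rewrite mulr_ge0 ?sqr_ge0.
  have : 0 <= k * B ^+ 2 by rewrite mulr_ge0 ?sqr_ge0.
  have : 0 <= (A - B) ^+ 2 by rewrite sqr_ge0.
  have : 0 <= (C - B) ^+ 2 by rewrite sqr_ge0.
  have : 0 <= C ^+ 2 by rewrite sqr_ge0.
  have : 0 <= A ^+ 2 by rewrite sqr_ge0.
  by rewrite !sqrrB; nra.
- by rewrite yx0 y1x0 y2x0 expr0n !addr0.
Qed.

End Gronwall.

(** * Power series *)

Section PowerSeries.
Context {R : realType}.
Implicit Types (u v : nat -> R) (x r s : R).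

Definition psum u x : R := limn (pseries u x).

(** Abel's form of a lower bound on the radius of convergence: it is stable
    under differentiation and easy to check on coefficients. *)
Definition radius_ge u r :=
  forall s, 0 < s < r -> exists B, forall n, `|u n| * s ^+ n <= B.

Lemma radius_cvg u r x : radius_ge u r -> `|x| < r -> cvgn (pseries u x).
Proof.
move=> ur xr; have x0 := normr_ge0 x.
pose s : R := (`|x| + r) / 2; have xs : `|x| < s by rewrite /s; lra.
have s0 : 0 < s by lra.
have [|B hB] := ur s; first by rewrite s0 /s; lra.
have B0 : 0 <= B by apply: le_trans (hB 0%N); rewrite mulr_ge0.
apply: normed_cvg.
apply: (@series_le_cvg _ _ (geometric B (`|x| / s))) => //.
- by move=> n; exact: normr_ge0.
- by move=> n; rewrite /geometric /= mulr_ge0 // exprn_ge0 // divr_ge0 // ltW.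
- move=> n; rewrite /= normrM normrX exprMn exprVn.

  rewrite -[leLHS]mulr1 -(@divff _ (s ^+ n)) ?expf_neq0 ?gt_eqF //.
  have -> : B * (`|x| ^+ n / s ^+ n) = `|x| ^+ n / s ^+ n * B by rewrite mulrC.
  have -> : `|u n| * `|x| ^+ n * (s ^+ n / s ^+ n) =
    `|x| ^+ n / s ^+ n * (`|u n| * s ^+ n) by ring.
  by rewrite ler_wpM2l ?divr_ge0 ?exprn_ge0 // ltW.
- apply: is_cvg_geometric_series.
  by rewrite normrM normfV normr_id (gtr0_norm s0) ltr_pdivrMr // mul1r.
Qed.

Lemma linear_geometric_le1 (q : R) n : 0 <= q < 1 -> n%:R * q ^+ n * (1 - q) <= 1.
Proof.
move=> /andP[q0 q1].
suff : n%:R * q ^+ n * (1 - q) <= 1 - q ^+ n.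
  by move=> h; rewrite (le_trans h) // gerBl exprn_ge0.
elim: n => [|n ih]; first by rewrite !mul0r expr0 subrr.
have qn : 0 <= q ^+ n by rewrite exprn_ge0.
have q1n : q ^+ n <= 1 by rewrite exprn_ile1 // ltW.
rewrite exprS -natr1; move: ih qn q1n; move: (n%:R : R) (q ^+ n) => N Q ih Q0 Q1.
have h1 : q * (N * Q * (1 - q)) <= q * (1 - Q) by rewrite ler_wpM2l.
have h2 : q * Q <= 1 by rewrite mulr_ile1 // ltW.
have h3 : 0 <= (1 - q) * (1 - q * Q) by rewrite mulr_ge0 // subr_ge0 // ltW.
by nra.
Qed.

Lemma radius_diffs u r : radius_ge u r -> radius_ge (pseries_diffs u) r.
Proof.
move=> ur s /andP[s0 sr].
pose s' : R := (s + r) / 2; have ss' : s < s' by rewrite /s'; lra.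
have s'0 : 0 < s' by lra.
have [|B hB] := ur s'; first by rewrite s'0 /s'; lra.
pose q : R := s / s'.
have q01 : 0 <= q < 1.
  by rewrite /q divr_ge0 ?(ltW s0) ?(ltW s'0) //= ltr_pdivrMr // mul1r.
have q1 : 0 < 1 - q by lra.
have sE : s = q * s' by rewrite /q divfK // gt_eqF.
exists (B / s / (1 - q)) => n.
rewrite /pseries_diffs normrM (ger0_norm (ler0n _ _)).
rewrite ler_pdivlMr // ler_pdivlMr //.
have -> : n.+1%:R * `|u n.+1| * s ^+ n * (1 - q) * s =
  (n.+1%:R * q ^+ n.+1 * (1 - q)) * (`|u n.+1| * s' ^+ n.+1).
  have -> : s ^+ n = q ^+ n * s' ^+ n by rewrite sE exprMn.
  by rewrite !exprS [in LHS]sE; ring.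
have h := linear_geometric_le1 n.+1 q01.
apply: le_trans (hB n.+1); rewrite -[leRHS]mul1r ler_wpM2r //.
by rewrite mulr_ge0 ?exprn_ge0 // ltW.
Qed.

Lemma psum_derive u r x : radius_ge u r -> `|x| < r ->
  is_derive x 1 (psum u) (psum (pseries_diffs u) x).
Proof.
move=> ur xr; have x0 := normr_ge0 x.
pose s : R := (`|x| + r) / 2.
have sE : `|s| = s by rewrite ger0_norm // /s; lra.
have sr : `|s| < r by rewrite sE /s; lra.
apply: (@pseries_snd_diffs R u s x).
- exact: radius_cvg sr.
- by apply: radius_cvg sr; exact: radius_diffs.
- by apply: radius_cvg sr; do 2 apply: radius_diffs.
- by rewrite sE /s; lra.
Qed.

Lemma psum0 u : psum u 0 = u 0%N.
Proof.
apply/cvg_lim => //; rewrite -(cvg_shiftn 1).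
apply: cvg_near_cst; apply: nearW => n.
rewrite /pseries /series /= addn1 big_nat_recl // big1 ?addr0 ?expr0 ?mulr1 //.
by move=> i _; rewrite exprS mul0r mulr0.
Qed.

Lemma psum_add u v r x : radius_ge u r -> radius_ge v r -> `|x| < r ->
  psum (fun n => u n + v n) x = psum u x + psum v x.
Proof.
move=> ur vr xr; apply/cvg_lim => //.
have -> : pseries (fun n => u n + v n) x = pseries u x + pseries v x.
  apply/funext => n; rewrite /pseries /series /= fctE -big_split /=.
  by apply: eq_bigr => i _; rewrite mulrDl.
by apply: cvgD; [exact: (radius_cvg ur)|exact: (radius_cvg vr)].
Qed.

Lemma psum_scale u r x k : radius_ge u r -> `|x| < r ->
  psum (fun n => k * u n) x = k * psum u x.
Proof.
move=> ur xr; apply/cvg_lim => //.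
have -> : pseries (fun n => k * u n) x = (fun n => k * pseries u x n).
  apply/funext => n; rewrite /pseries /series /= mulr_sumr.
  by apply: eq_bigr => i _; rewrite mulrA.
by apply: cvgMr; exact: (radius_cvg ur).
Qed.

Definition mulX u n := if n is n'.+1 then u n' else 0.

Lemma psum_mulX u r x : radius_ge u r -> `|x| < r ->
  psum (mulX u) x = x * psum u x.
Proof.
move=> ur xr; apply/cvg_lim => //; rewrite -(cvg_shiftn 1).
rewrite [X in X @ _ --> _](_ : _ = (fun n => x * pseries u x n)).
  by apply: cvgMr; exact: (radius_cvg ur).
apply/funext => n; rewrite /pseries /series /= addn1 big_nat_recl //= mul0r add0r.
by rewrite mulr_sumr; apply: eq_bigr => i _; rewrite exprS; ring.
Qed.

Lemma radius_add u v r : radius_ge u r -> radius_ge v r ->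
  radius_ge (fun n => u n + v n) r.
Proof.
move=> ur vr s sr; have [B hB] := ur s sr; have [C hC] := vr s sr.
exists (B + C) => n; apply: le_trans (lerD (hB n) (hC n)).
rewrite -mulrDl ler_wpM2r ?ler_normD // exprn_ge0 //.
by case/andP: sr => /ltW.
Qed.

Lemma radius_scale u r k : radius_ge u r -> radius_ge (fun n => k * u n) r.
Proof.
move=> ur s sr; have [B hB] := ur s sr.
by exists (`|k| * B) => n; rewrite normrM -mulrA ler_wpM2l.
Qed.

Lemma radius_mulX u r : radius_ge u r -> radius_ge (mulX u) r.
Proof.
move=> ur s sr; have [B hB] := ur s sr; case/andP: (sr) => s0 _.
exists (s * B) => -[|n] /=.
  rewrite normr0 mul0r mulr_ge0 ?(ltW s0) //.
  by apply: le_trans (hB 0%N); rewrite mulr_ge0.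
by rewrite exprS mulrCA ler_wpM2l // ltW.
Qed.

Lemma radius_le u r s : s <= r -> radius_ge u r -> radius_ge u s.
Proof. by move=> sr ur t /andP[t0 ts]; apply: ur; rewrite t0 (lt_le_trans ts). Qed.

(** The ratio test is applied to a majorant, because some of the recurrences
    below control only a combination of consecutive coefficients. *)
Lemma radius_ratio u (M : nat -> R) r :
  (forall n, `|u n| <= M n) ->
  (forall s, 0 < s < r -> exists N, forall n, (N <= n)%N -> M n.+1 * s <= M n) ->
  radius_ge u r.
Proof.
move=> uM hM s sr; have [N hN] := hM s sr; case/andP: sr => s0 _.
have M0 n : 0 <= M n by exact: le_trans (uM n).
have t0 n : 0 <= M n * s ^+ n by rewrite mulr_ge0 ?exprn_ge0 // ltW.
exists (\sum_(i < N.+1) M i * s ^+ i) => n.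
suff H : M n * s ^+ n <= \sum_(i < N.+1) M i * s ^+ i.
  by apply: le_trans H; rewrite ler_wpM2r ?exprn_ge0 // ltW.
have small k : (k <= N)%N -> M k * s ^+ k <= \sum_(i < N.+1) M i * s ^+ i.
  move=> kN; have kN' : (k < N.+1)%N by [].
  rewrite (bigD1 (Ordinal kN')) //= lerDl sumr_ge0 // => i _.
elim: n => [|n ih]; first exact: small.
have [nN|Nn] := leqP n.+1 N; first exact: small.
apply: le_trans ih; rewrite exprS mulrA ler_wpM2r ?exprn_ge0 //; first exact: ltW.
exact: hN.
Qed.

(** Differentiating termwise and evaluating at [0] reads off all coefficients. *)
Lemma psum_eq0_coef u r : 0 < r -> radius_ge u r ->
  (forall x, 0 < x < r -> psum u x = 0) -> forall n, u n = 0.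
Proof.
move=> r0 + + n; elim: n u => [|n ih] u ur uz; last first.
  have duz : forall x, 0 < x < r -> psum (pseries_diffs u) x = 0.
    move=> x /andP[x0 xr].
    have d : is_derive x 1 (psum u) (psum (pseries_diffs u) x).
      by apply: (psum_derive ur); rewrite gtr0_norm.
    apply: (derive_unique d); apply: (@derive_near R (fun _ => 0) _ _ _ (Num.min x (r - x))).
    - by rewrite lt_min x0 subr_gt0.
    - move=> t; rewrite lt_min !ltr_norml => /andP[/andP[h1 _] /andP[_ h2]].
      by rewrite uz //; lra.
  have /eqP := ih _ (radius_diffs ur) duz.
  by rewrite /pseries_diffs mulf_eq0 pnatr_eq0 /= => /eqP.
have d0 : is_derive (0 : R) 1 (psum u) (psum (pseries_diffs u) 0).
  by apply: (psum_derive ur); rewrite normr0.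
have cont := derive_continuous d0.
have := cvg_at_right_filter cont; rewrite psum0 => h.
have h0 : psum u x @[x --> 0^'+] --> (0 : R).
  apply: cvg_near_cst; near=> x; apply: uz; apply/andP; split.
    by near: x; exact: nbhs_right_gt.
  by near: x; exact: nbhs_right_lt.
exact: (cvg_unique _ h h0).
Unshelve. all: by end_near. Qed.

End PowerSeries.

Section PowerSeriesODE.
Context {R : realType}.
Implicit Types (u : nat -> R) (r x : R) (n : nat).

(** Ratios [1 + O(1 / n)] are those of polynomially growing sequences. *)
Lemma radius_poly u (M : nat -> R) (K : R) : 0 <= K ->
  (forall n, `|u n| <= M n) ->
  (forall n, (0 < n)%N -> M n.+1 <= (1 + K / n%:R) * M n) -> radius_ge u 1.
Proof.
move=> K0 uM hM; apply: (radius_ratio uM) => s /andP[s0 s1].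
have M0 n : 0 <= M n by exact: le_trans (uM n).
have t0 : 0 <= K * s / (1 - s) by rewrite divr_ge0 ?mulr_ge0 ?(ltW s0) // subr_ge0 ltW.
exists (Num.bound (K * s / (1 - s))).+1 => n Nn.
have n0 : (0 < n)%N by apply: leq_trans Nn.
have n0' : 0 < n%:R :> R by rewrite ltr0n.
have : K * s / (1 - s) < n%:R.
  apply: lt_le_trans (archi_boundP t0) _; rewrite ler_nat.
  by apply: leq_trans Nn.
rewrite ltr_pdivrMr ?subr_gt0 // => Ks.
apply: le_trans (ler_wpM2r (ltW s0) (hM n n0)) _.
rewrite mulrAC ler_piMl //.
rewrite mulrDl mul1r mulrAC.
have -> : K * s / n%:R <= 1 - s -> s + K * s / n%:R <= 1 by lra.
  by [].
by rewrite ler_pdivrMr //; lra.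
Qed.

Fixpoint all_radius r (l : seq (R * (nat -> R))) : Prop :=
  if l is p :: l' then radius_ge p.2 r /\ all_radius r l' else True.

(** Verifies a differential equation on the coefficients: the list holds the
    terms of the equation, each multiplied by its power of the variable. *)
Lemma psum_comb r x l : all_radius r l -> `|x| < r ->
  (forall n, \sum_(p <- l) p.1 * p.2 n = 0) ->
  \sum_(p <- l) p.1 * psum p.2 x = 0.
Proof.
move=> rl xr l0.
suff [rs <-] : radius_ge (fun n => \sum_(p <- l) p.1 * p.2 n) r /\
    psum (fun n => \sum_(p <- l) p.1 * p.2 n) x = \sum_(p <- l) p.1 * psum p.2 x.
  have -> : (fun n => \sum_(p <- l) p.1 * p.2 n) = (fun _ => 0).
    by apply/funext => n; exact: l0.
  apply/cvg_lim => //; apply: cvg_near_cst; apply: nearW => n.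
  by rewrite /pseries /series /= big1 // => i _; rewrite mul0r.
elim: l rl {l0} => [_|[k u] l ih /= [ru rl]].
  split.
    by move=> s _; exists 0 => n; rewrite big_nil normr0 mul0r.
  rewrite big_nil; apply/cvg_lim => //; apply: cvg_near_cst; apply: nearW => n.
  by rewrite /pseries /series /= big1 // => i _; rewrite big_nil mul0r.
have [rs es] := ih rl.
have -> : (fun n => \sum_(p <- (k, u) :: l) p.1 * p.2 n) =
          (fun n => k * u n + \sum_(p <- l) p.1 * p.2 n).
  by apply/funext => n; rewrite big_cons.
have rk := radius_scale k ru.
split; first exact: radius_add.
by rewrite (psum_add rk rs xr) big_cons /= es (psum_scale _ ru xr).
Qed.

Notation d u := (pseries_diffs u).

Lemma mulX_d u n : mulX (d u) n = n%:R * u n.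
Proof. by case: n => [|n] /=; rewrite ?mul0r. Qed.

Lemma mulX_dd u n : mulX (d (d u)) n = n%:R * n.+1%:R * u n.+1.
Proof. by case: n => [|n] /=; rewrite ?mul0r // /pseries_diffs mulrA. Qed.

Lemma mulX2_d u n : mulX (mulX (d u)) n = (n%:R - 1) * mulX u n.
Proof. by case: n => [|n] /=; rewrite ?mulr0 // mulX_d -natr1 addrK. Qed.

Lemma mulX2_dd u n : mulX (mulX (d (d u))) n = n%:R * (n%:R - 1) * u n.
Proof.
by case: n => [|n] /=; rewrite ?mul0r // mulX_dd -natr1 addrK; ring.
Qed.

Lemma mulX3_dd u n :
  mulX (mulX (mulX (d (d u)))) n = (n%:R - 1) * (n%:R - 2) * mulX u n.
Proof.
by case: n => [|n] /=; rewrite ?mulr0 // mulX2_dd -natr1; ring.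
Qed.

End PowerSeriesODE.

Notation "u ^'d" := (pseries_diffs u) (at level 2, format "u ^'d").

(** * Series solutions of the hypergeometric equation *)

Section HypergeometricODE.
Context {R : realType}.
Variables (c k : R).
Hypotheses (c0 : 0 < c) (k0 : 0 < k).

Fixpoint gauss n : R :=
  if n is n'.+1 then
    gauss n' * ((n'%:R ^+ 2 + c * n'%:R + k) / ((c + n'%:R) * n'.+1%:R))
  else 1.

Let cn (n : nat) : 0 < c + n%:R.
Proof. by rewrite ltr_wpDr. Qed.

Let n1 (n : nat) : 0 < n.+1%:R :> R.
Proof. by rewrite ltr0n. Qed.

Let nc (n : nat) : 0 < n%:R + c.
Proof. by rewrite addrC. Qed.

Lemma gauss_rec n :
  (c + n%:R) * n.+1%:R * gauss n.+1 = (n%:R ^+ 2 + c * n%:R + k) * gauss n.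
Proof. by rewrite /=; field; rewrite !gt_eqF. Qed.

Lemma gauss_radius : radius_ge gauss 1.
Proof.
apply: (@radius_poly _ _ (fun n => `|gauss n|) k) => // [|n n0]; first exact: ltW.
have n0' : 0 < n%:R :> R by rewrite ltr0n.
rewrite normrM mulrC ler_wpM2r //.
rewrite ger0_norm; last first.
  by rewrite divr_ge0 ?mulr_ge0 ?addr_ge0 ?sqr_ge0 ?mulr_ge0 // ltW.
rewrite ler_pdivrMr ?mulr_gt0 // -natr1.
have := ltW c0; have := ltW k0; move: (n%:R : R) n0' => N N0 hk hc.
have -> : (1 + k / N) * ((c + N) * (N + 1)) =
   (c + N) * (N + 1) + k * (c + c / N + N + 1).
  by field; rewrite gt_eqF.
have : 0 <= c / N by rewrite divr_ge0 ?ltW.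
move: (c / N) => q q0.
have : 0 <= k * (c + q + N) by rewrite mulr_ge0 //; lra.
by lra.
Qed.

Lemma gauss_ode x : `|x| < 1 ->
  x * (1 - x) * psum gauss^'d^'d x + (c - (c + 1) * x) * psum gauss^'d x
  - k * psum gauss x = 0.
Proof.
move=> x1; have r0 := gauss_radius; have r1 := radius_diffs r0.
have r2 := radius_diffs r1.
have := @psum_comb _ 1 x [:: (1, mulX gauss^'d^'d); (-1, mulX (mulX gauss^'d^'d));
  (c, gauss^'d); (- (c + 1), mulX gauss^'d); (- k, gauss)].
rewrite !big_cons big_nil /=.
rewrite (psum_mulX (radius_mulX r2) x1) (psum_mulX r2 x1) (psum_mulX r1 x1).
move=> H; apply: etrans (H _ x1 _); first by ring.
  by do ?split => //; do ?apply: radius_mulX.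
move=> n; rewrite !big_cons big_nil /= mulX2_dd mulX_dd mulX_d /pseries_diffs.
have := gauss_rec n; rewrite -natr1; move: (gauss n.+1) (gauss n) (n%:R : R) => A B N.
by lra.
Qed.

(** Coefficients of the solution in the variable [z / (1 + z)], stored together
    with their first differences. The characteristic polynomial of the
    three-term recurrence has the double root [1]: a direct estimate of the
    coefficients would give exponential growth, and only the recurrence for the
    differences shows that the growth is polynomial. The difference at index [0]
    is the first coefficient itself. *)
Fixpoint pfaff2 n : R * R :=
  if n is n'.+1 then
    let: (u, e) := pfaff2 n' in
    let e' := ((n'%:R - 1) ^+ 2 * e - (1 + c + k) * u) / (n'.+1%:R * (n'%:R + c)) in
    (u + e', e')
  else (1, 1).

Definition pfaff n := (pfaff2 n).1.

Lemma pfaff_diff n : (pfaff2 n).2 = pfaff n - mulX pfaff n.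
Proof.
case: n => [|n] /=; first by rewrite subr0.
by rewrite /pfaff /=; case: (pfaff2 n) => u e /=; ring.
Qed.

Lemma pfaff_rec n : n.+1%:R * (n%:R + c) * pfaff n.+1 =
  (2 * n%:R ^+ 2 - n%:R + c * n%:R - k) * pfaff n - (n%:R - 1) ^+ 2 * mulX pfaff n.
Proof.
have := pfaff_diff n; rewrite /pfaff /=; case: (pfaff2 n) => u e /= /eqP.
rewrite eq_sym subr_eq => /eqP ->.
have := n1 n; rewrite -natr1 => h; field.
by rewrite !gt_eqF.
Qed.

Lemma pfaff_radius : radius_ge pfaff 1.
Proof.
pose A := 1 + c + k; have A0 : 0 <= A by rewrite /A !addr_ge0 // ltW.
apply: (@radius_poly _ _ (fun n => `|pfaff n| + n%:R * `|(pfaff2 n).2|) (2 * A + 1)).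
- by lra.
- by move=> n; rewrite lerDl mulr_ge0.
move=> n n0; have N0 : 0 < n%:R :> R by rewrite ltr0n.
rewrite /pfaff /=; case: (pfaff2 n) => u e /=.
set e' := (_ / _ : R).
have N1 : 1 <= n%:R :> R by rewrite ler1n.
have he : (n%:R + 1) * `|e'| <= n%:R * `|e| + A / n%:R * `|u|.
  rewrite /e' normrM normfV normrM -natr1.
  rewrite (gtr0_norm (_ : 0 < n%:R + 1)); last by rewrite natr1.
  rewrite (gtr0_norm (_ : 0 < n%:R + c)); last by rewrite addrC.
  have -> : (n%:R + 1) * (`|(n%:R - 1) ^+ 2 * e - (1 + c + k) * u| / ((n%:R + 1) * (n%:R + c)))
    = `|(n%:R - 1) ^+ 2 * e - (1 + c + k) * u| / (n%:R + c).
    by field; rewrite natr1 !gt_eqF.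
  rewrite ler_pdivrMr; last by rewrite addrC.
  apply: le_trans (ler_normB _ _) _.
  rewrite [`|_ ^+ 2 * e|]normrM ger0_norm ?sqr_ge0 // normrM (ger0_norm A0).
  have h1 : A * `|u| <= A / n%:R * `|u| * (n%:R + c).
    have -> : A / n%:R * `|u| * (n%:R + c) = A * `|u| + A * `|u| * c / n%:R.
      by field; rewrite gt_eqF.
    by rewrite lerDl divr_ge0 ?(ltW N0) // !mulr_ge0 // ltW.
  have h2 : (n%:R - 1) ^+ 2 * `|e| <= n%:R * `|e| * (n%:R + c).
    rewrite [leRHS]mulrAC ler_wpM2r //.
    have := ltW c0; move: (n%:R : R) N1 => N N1 hc.
    have : 0 <= N * c by rewrite mulr_ge0 //; lra.
    by rewrite sqrrB; lra.
  by rewrite [leRHS]mulrDl; exact: lerD.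
have hu : `|u + e'| <= `|u| + `|e'| by exact: ler_normD.
rewrite -natr1.
have iN : 0 < (n%:R : R)^-1 by rewrite invr_gt0.
have he2 : `|e'| <= (n%:R * `|e| + A / n%:R * `|u|) / n%:R.
  rewrite ler_pdivlMr // mulrC (le_trans _ he) // ler_wpM2r //; lra.
have hN : n%:R * (n%:R : R)^-1 = 1 by rewrite divff // gt_eqF.
have iN1 : (n%:R : R)^-1 <= 1 by rewrite invf_le1.
have U0 := normr_ge0 u; have E0 := normr_ge0 e.
apply: le_trans (lerD hu he) _; apply: le_trans (lerD (lerD (lexx _) he2) (lexx _)) _.
move: (n%:R : R) (n%:R : R)^-1 `|u| `|e| N0 N1 iN hN iN1 U0 E0 {he he2 hu} => N I U E.
move=> N0 N1 I0 NI I1 U0 E0.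
have -> : (N * E + A * I * U) * I = N * I * E + A * I * U * I by ring.
rewrite NI mul1r.
have h3 : A * I * U * I <= A * I * U.
  by rewrite -[leRHS]mulr1 ler_wpM2l // !mulr_ge0 // ltW.
have h4 : 0 <= A * E by rewrite mulr_ge0.
have -> : (1 + (2 * A + 1) * I) * (U + N * E) =
  U + N * E + (2 * A + 1) * I * U + (2 * A + 1) * E * (N * I) by ring.
rewrite NI mulr1.
have h5 : 0 <= I * U by rewrite mulr_ge0 // ltW.
lra.
Qed.

Lemma pfaff_ode y : `|y| < 1 ->
  y * (1 - y) ^+ 2 * psum pfaff^'d^'d y
  + (c * (1 - y) ^+ 2 - (1 - c) * y * (1 - y)) * psum pfaff^'d y
  + k * psum pfaff y = 0.
Proof.
move=> y1; have r0 := pfaff_radius; have r1 := radius_diffs r0.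
have r2 := radius_diffs r1.
have := @psum_comb _ 1 y [:: (1, mulX pfaff^'d^'d); (-2, mulX (mulX pfaff^'d^'d));
  (1, mulX (mulX (mulX pfaff^'d^'d)));
  (c, pfaff^'d); (- (c + 1), mulX pfaff^'d); (1, mulX (mulX pfaff^'d)); (k, pfaff)].
rewrite !big_cons big_nil /=.
rewrite (psum_mulX (radius_mulX (radius_mulX r2)) y1).
rewrite (psum_mulX (radius_mulX r2) y1) (psum_mulX r2 y1) (psum_mulX r1 y1).
rewrite (psum_mulX (radius_mulX r1) y1) (psum_mulX r1 y1).
move=> H; apply: etrans (H _ y1 _); first by ring.
  by do ?split => //; do ?apply: radius_mulX.
move=> n; rewrite !big_cons big_nil /= mulX3_dd mulX2_dd mulX2_d mulX_dd mulX_d.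
rewrite /pseries_diffs; have := pfaff_rec n; rewrite -natr1.
move: (pfaff n.+1) (pfaff n) (mulX pfaff n) (n%:R : R) => A B C N.
by lra.
Qed.

Lemma pfaff_var (z : R) : - 2^-1 < z -> `|z / (1 + z)| < 1.
Proof.
move=> hz; have z1 : 0 < 1 + z by lra.
rewrite normrM normfV (gtr0_norm z1) ltr_pdivrMr // mul1r ltr_norml; lra.
Qed.

(** Gauss's function [2F1 (a, b; c; - z)] with [a + b = c] and [a b = k], as a
    function of [z / (1 + z)]: the half-line [z >= 0] corresponds to the interval
    [0, 1) of the new variable, inside the disc of convergence. *)
Definition phi z : R := psum pfaff (z / (1 + z)).
Definition phi1 z : R := psum pfaff^'d (z / (1 + z)) * (1 + z) ^- 2.
Definition phi2 z : R := psum pfaff^'d^'d (z / (1 + z)) * (1 + z) ^- 4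
  - 2 * psum pfaff^'d (z / (1 + z)) * (1 + z) ^- 3.

(** The hypergeometric equation with [a + b = c] and [a b = k] at the argument
    [- z]. *)
Definition hyp_sol (y y1 y2 : R -> R) (a b : R) := forall z, a < z < b ->
  [/\ is_derive z 1 y (y1 z), is_derive z 1 y1 (y2 z) &
      z * (1 + z) * y2 z + (c + (c + 1) * z) * y1 z + k * y z = 0].

Lemma phi_sol b : hyp_sol phi phi1 phi2 (- 2^-1) b.
Proof.
move=> z /andP[hz _]; have z1 : 0 < 1 + z by lra.
have z1' : 1 + z != 0 by rewrite gt_eqF.
have y1 := pfaff_var hz.
have r0 := pfaff_radius; have r1 := radius_diffs r0.
have dv : is_derive z 1 (fun z => z / (1 + z)) ((1 + z) ^- 2).
  by der => //; field.
have d0 := psum_derive r0 y1; have d1 := psum_derive r1 y1.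
have e0 := der_comp (g := fun z => z / (1 + z)) d0 dv.
have e1 := der_comp (g := fun z => z / (1 + z)) d1 dv.
split=> //.
- rewrite /phi1 /phi2; der; first by rewrite expf_neq0.
  by rewrite /=; field.
- have := pfaff_ode y1; rewrite /phi2 /phi1 /phi.
  move: (psum pfaff^'d^'d (z / (1 + z))) (psum pfaff^'d (z / (1 + z)))
    (psum pfaff (z / (1 + z))) => A B C H.
  apply: etrans H; field => //.
Qed.

Lemma phi0 : phi 0 = 1.
Proof. by rewrite /phi mul0r psum0. Qed.

End HypergeometricODE.

(** * Uniqueness and growth of the regular solution *)

Section HypergeometricBounds.
Context {R : realType}.
Variables (c k : R).
Hypotheses (c0 : 0 < c) (k0 : 0 < k).
Implicit Types (y : R -> R) (z M a b : R).

Notation hyp_sol := (hyp_sol c k).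

Lemma hyp_solN y y1 y2 a b : hyp_sol y y1 y2 a b ->
  hyp_sol (fun z => - y z) (fun z => - y1 z) (fun z => - y2 z) a b.
Proof.
move=> H z hz; have [d0 d1 e] := H z hz; split; [by der|by der|].
by move: e; lra.
Qed.

Lemma hyp_solB y y1 y2 u u1 u2 a b : hyp_sol y y1 y2 a b -> hyp_sol u u1 u2 a b ->
  hyp_sol (fun z => y z - u z) (fun z => y1 z - u1 z) (fun z => y2 z - u2 z) a b.
Proof.
move=> H H' z hz; have [d0 d1 e] := H z hz; have [d0' d1' e'] := H' z hz.
split; [by der|by der|].
by move: e e'; lra.
Qed.

Let solve_linear (A B Y : R) : 0 < A -> A * Y = B -> Y = B / A.
Proof. by move=> A0 <-; rewrite mulrC mulKf // gt_eqF. Qed.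

Let dY y1 y2 z : is_derive z 1 y1 (y2 z) ->
  is_derive z 1 (fun z => (1 + z) * y1 z) (y1 z + (1 + z) * y2 z).
Proof. by move=> d; der; ring. Qed.

Lemma hyp_flux_max y y1 y2 a b M z1 : a < 0 -> 0 <= z1 < b -> hyp_sol y y1 y2 a b ->
  (forall z, 0 <= z <= z1 -> - y z <= M) ->
  forall z, 0 <= z <= z1 -> (1 + z) * y1 z <= k * M / c.
Proof.
have c0' := c0; have k0' := k0.
move=> a0 /andP[z10 z1b] H yM z hz.
have dd t : 0 <= t <= z1 ->
    is_derive t 1 (fun t => (1 + t) * y1 t) (y1 t + (1 + t) * y2 t).
  by move=> ht; apply: dY; have [|] := H t; first lra.
have [s sz1 smax] := @EVT_max R _ 0 z1 z10 (derive_within dd).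
apply: le_trans (smax z _) _; first by rewrite in_itv.
move: sz1; rewrite in_itv /= => hs.
have [|d0 d1 e] := H s; first lra.
have yMs : k * - y s <= k * M by rewrite ler_wpM2l ?yM // ltW.
rewrite ler_pdivlMr //; have [s0|s0] := eqVneq s 0.
  by move: e yMs; rewrite s0; nra.
have sgt : 0 < s by rewrite lt_neqAle eq_sym s0; case/andP: hs.
have D : 0 <= y1 s + (1 + s) * y2 s.
  apply: (derive_at_max sgt) (dd s hs) => t ht; apply: smax; rewrite in_itv /=; lra.
have : 0 <= s * (y1 s + (1 + s) * y2 s) by rewrite mulr_ge0 // ltW.
by lra.
Qed.

(** The maximum principle for [Y = (1 + z) y']: it satisfies
    [z Y' = - k y - c Y], so [c |Y|] cannot exceed [k] times the largest value
    of [|y|]. *)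
Lemma hyp_flux_bound y y1 y2 a b M z1 : a < 0 -> 0 <= z1 < b -> hyp_sol y y1 y2 a b ->
  (forall z, 0 <= z <= z1 -> `|y z| <= M) ->
  forall z, 0 <= z <= z1 -> (1 + z) * `|y1 z| <= k * M / c.
Proof.
have c0' := c0; have k0' := k0.
move=> a0 z1b H yM z hz.
have h1 := hyp_flux_max a0 z1b H.
have h2 := hyp_flux_max a0 z1b (hyp_solN H).
have z0 : 0 <= 1 + z by lra.
rewrite -[1 + z]ger0_norm // -normrM ler_norml; apply/andP; split.
  rewrite lerNl -mulrN; apply: h2 => // t ht; rewrite opprK.
  by rewrite (le_trans _ (yM t ht)) // ler_norm.
by apply: h1 => // t ht; rewrite (le_trans _ (yM t ht)) // -normrN ler_norm.
Qed.

(** Up to [z = c / (2 k)] the flux bound makes the variation of the solution at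
    most half of its maximum. *)
Lemma hyp_near0 y y1 y2 a b z : a < 0 -> hyp_sol y y1 y2 a b ->
  0 <= z < b -> z <= c / (2 * k) -> `|y z| <= 2 * `|y 0|.
Proof.
have c0' := c0; have k0' := k0.
move=> a0 H /andP[z0 zb] zk.
have dd t : 0 <= t <= z -> is_derive t 1 (fun t => y t ^+ 2) (2 * y t * y1 t).
  by move=> ht; have [|d0 _ _] := H t; [lra|der; rewrite /=; ring].
have [s hs smax] := @EVT_max R _ 0 z z0 (derive_within dd).
move: hs; rewrite in_itv /= => hs.
have yM t : 0 <= t <= z -> `|y t| <= `|y s|.
  by move=> ht; rewrite -ler_sqr ?nnegrE // !real_normK ?num_real // smax // in_itv.
apply: le_trans (yM z _) _; first lra.
have h1 : forall t, 0 <= t <= z -> (1 + t) * `|y1 t| <= k * `|y s| / c.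
  by apply: (@hyp_flux_bound y y1 y2 a b) => //; lra.
have : `|y s - y 0| <= (k * `|y s| / c) * (s - 0).
  case/andP: (hs) => s0 sz.
  apply: (@derive_bound R y y1 0 s) => // t ht.
    by have [|] := H t; first lra.
  apply: le_trans (h1 t _); last lra.
  by rewrite ler_peMl // lerDl; lra.
rewrite subr0 => h2; have := ler_dist_dist (y s) (y 0) => h3.
have h4 : k * `|y s| / c * s <= `|y s| / 2.
  have -> : `|y s| / 2 = k * `|y s| / c * (c / (2 * k)) by field; rewrite !gt_eqF.
  by rewrite ler_wpM2l; [|rewrite divr_ge0 ?mulr_ge0 // ltW|lra].
have := ler_norm (`|y s| - `|y 0|); lra.
Qed.

(** [0] is a singular point of the equation, and the uniqueness theorem for
    regular equations only applies once the difference of two solutions is known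
    to vanish near [0]; this is the case of zero initial value of the estimate
    near [0]. *)
Lemma hyp_sol_unique0 y y1 y2 a b z : a < 0 -> hyp_sol y y1 y2 a b -> y 0 = 0 ->
  0 <= z < b -> y z = 0.
Proof.
have c0' := c0; have k0' := k0.
move=> a0 H y00 hz.
have b0 : 0 < b by lra.
pose s := Num.min (b / 2) (c / (2 * k)).
have ck : 0 < c / (2 * k) by rewrite divr_gt0 // mulr_gt0.
have s0 : 0 < s by rewrite lt_min ck divr_gt0.
have sb : s <= b / 2 by rewrite ge_min lexx.
have sc : s <= c / (2 * k) by rewrite ge_min lexx orbT.
have near t : 0 <= t <= s -> y t = 0.
  move=> ht; apply/eqP; rewrite -normr_le0.
  have := @hyp_near0 y y1 y2 a b t a0 H; rewrite y00 normr0 mulr0; apply; lra.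
have [zs|sz] := leP z s; first by apply: near; lra.
pose e := s / 4.
have e0 : 0 < e by rewrite /e; lra.
apply: (@ode2_zero R y y1 y2 e b ((c + 1 + k) / e) (s / 2)); last 3 first.
- by apply: near; lra.
- have [|d0 _ _] := H (s / 2); first lra.
  apply: (derive_unique d0).
  apply: (@derive_near R (fun _ => 0) _ _ _ (s / 2)) => //; first lra.
  by move=> t; rewrite ltr_norml => ht; rewrite near //; lra.
- by rewrite /e; lra.
- by move=> t ht; have [|] := H t; first lra.
- by move=> t ht; have [|] := H t; first lra.
- move=> t /andP[et tb]; have [|_ _ eq] := H t; first lra.
  have t0 : 0 < t by lra.
  have tt : 0 < t * (1 + t) by rewrite mulr_gt0 //; lra.
  have -> : y2 t = - ((c + (c + 1) * t) * y1 t + k * y t) / (t * (1 + t)).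
    by apply: solve_linear => //; lra.
  rewrite normrM normfV (gtr0_norm tt) normrN ler_pdivrMr //.
  rewrite (le_trans (ler_normD _ _)) // !normrM.
  have c1 : 0 < c + 1 by rewrite addr_gt0.
  have ct : 0 < (c + 1) * t by rewrite mulr_gt0.
  rewrite (ger0_norm (_ : 0 <= c + (c + 1) * t)); last by rewrite addr_ge0 // ltW.
  rewrite (gtr0_norm k0).
  have Q1 : 1 <= (1 + t) / e * t.
    have t2 : 0 <= t * t by rewrite mulr_ge0 // ltW.
    by rewrite mulrAC ler_pdivlMr //; lra.
  have Q2 : c + (c + 1) * t <= (c + 1 + k) / e * (t * (1 + t)).
    have -> : (c + 1 + k) / e * (t * (1 + t)) = (c + 1) * (1 + t) * (t / e)
      + k * ((1 + t) / e * t) by field; rewrite gt_eqF.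
    have te : 1 <= t / e by rewrite ler_pdivlMr // mul1r ltW.
    have : (c + 1) * (1 + t) <= (c + 1) * (1 + t) * (t / e).
      by rewrite ler_peMr // mulr_ge0; lra.
    have : 0 <= k * ((1 + t) / e * t) by rewrite mulr_ge0 //; lra.
    by lra.
  have Q3 : k <= (c + 1 + k) / e * (t * (1 + t)).
    have -> : (c + 1 + k) / e * (t * (1 + t)) = (c + 1 + k) * ((1 + t) / e * t).
      by field; rewrite gt_eqF.
    have : c + 1 + k <= (c + 1 + k) * ((1 + t) / e * t) by rewrite ler_peMr //; lra.
    lra.
  have := lerD (ler_wpM2r (normr_ge0 (y1 t)) Q2) (ler_wpM2r (normr_ge0 (y t)) Q3).
  by move/le_trans; apply; rewrite le_eqVlt; apply/orP; left; apply/eqP; ring.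
- by rewrite /e; lra.
Qed.

(** The energy [y ^ 2 + z (1 + z) y' ^ 2 / k] weighted by [(1 + z) / z] is
    nonincreasing for every [c > 0]; started at [z = c / (2 k)], where the
    solution is still at most [2], it bounds the solution on the half-line by a
    power of [k]. *)
Lemma hyp_energy y y1 y2 a b s z : a < 0 -> hyp_sol y y1 y2 a b -> 0 < s <= z -> z < b ->
  y z ^+ 2 <= (y s ^+ 2 + s * (1 + s) * y1 s ^+ 2 / k) * ((1 + s) / s).
Proof.
have c0' := c0; have k0' := k0.
move=> a0 H /andP[s0 sz] zb.
pose h t := (y t ^+ 2 + t * (1 + t) * y1 t ^+ 2 / k) * ((1 + t) / t).
pose h1 t := - (y t ^+ 2 / t ^+ 2) - (2 * c + 2 * c * t) * (1 + t) / t * y1 t ^+ 2 / k.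
have z0 : 0 < z by lra.
suff : h z <= h s.
  apply: le_trans; rewrite /h.
  have : 0 <= z * (1 + z) * y1 z ^+ 2 / k.
    by rewrite divr_ge0 ?(ltW k0) // mulr_ge0 ?sqr_ge0 // mulr_ge0 //; lra.
  have z1 : 1 <= (1 + z) / z by rewrite ler_pdivlMr //; lra.
  move=> q; apply: le_trans (_ : (y z ^+ 2 + z * (1 + z) * y1 z ^+ 2 / k) * 1 <= _).
    by rewrite mulr1 lerDl.
  by rewrite ler_wpM2l // addr_ge0 ?sqr_ge0.
apply: (@derive_le0_ge R h h1) => // t ht; last first.
  have t0 : 0 < t by lra.
  rewrite /h1 -opprD oppr_le0 addr_ge0 ?divr_ge0 ?sqr_ge0 ?(ltW k0) //.
  rewrite mulr_ge0 ?sqr_ge0 // divr_ge0 ?(ltW t0) // mulr_ge0 //; last lra.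
  by rewrite addr_ge0 // ?mulr_ge0 ?(ltW c0) ?(ltW t0).
have t0 : 0 < t by lra.
have [|d0 d1 eq] := H t; first lra.
have tt : 0 < t * (1 + t) by rewrite mulr_gt0 //; lra.
have y2E : y2 t = - ((c + (c + 1) * t) * y1 t + k * y t) / (t * (1 + t)).
  by apply: solve_linear => //; lra.
rewrite /h /h1; der; first by rewrite gt_eqF.
rewrite y2E /=; field; rewrite !gt_eqF //; lra.
Qed.

Definition hyp_const : R := (4 + 2 / c) * (1 + 2 / c) * (2 / c).

(** The energy estimate starts at [s = c / (2 k)], where the flux bound controls
    the derivative. The hypothesis on [k] serves for [z <= s], where [phi] is
    only known to be at most [2]. *)
Lemma phi_bound z : c ^+ 2 / 4 <= k -> 0 <= z -> phi c k z ^+ 2 <= hyp_const * k.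
Proof.
have c0' := c0; have k0' := k0.
move=> kc z0.
have ic : 0 < c^-1 by rewrite invr_gt0.
have c1 : c * c^-1 = 1 by rewrite divff // gt_eqF.
have H b : hyp_sol (phi c k) (phi1 c k) (phi2 c k) (- 2^-1) b by exact: phi_sol.
pose s := c / (2 * k).
have s0 : 0 < s by rewrite divr_gt0 // mulr_gt0.
have sE : s * k = c / 2 by rewrite /s; field; rewrite gt_eqF.
have s2 : s <= 2 / c.
  rewrite ler_pdivlMr // -(ler_pM2r k0) mulrAC sE; lra.
have small t : 0 <= t <= s -> `|phi c k t| <= 2.
  move=> /andP[t0 ts]; have := @hyp_near0 _ _ _ _ (t + 1) t _ (H _); rewrite phi0 normr1 mulr1.
  by apply=> //; lra.
have kck : 2 <= hyp_const * k.
  have : 2 * (2 / c) * (c ^+ 2 / 4) <= 2 * (2 / c) * k.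
    by rewrite ler_wpM2l // mulr_ge0 // divr_ge0 // ltW.
  have -> : 2 * (2 / c) * (c ^+ 2 / 4) = c by field; rewrite gt_eqF.
  move=> h.
  have h2 : c^-1 * c <= c^-1 * (2 * (2 / c) * k) by rewrite ler_wpM2l // ltW.
  have : 0 <= c^-1 * k by rewrite mulr_ge0 // ltW.
  have : 0 <= c^-1 * c^-1 * k by rewrite !mulr_ge0 // ltW.
  have : 0 <= c^-1 * c^-1 * c^-1 * k by rewrite !mulr_ge0 // ltW.
  rewrite /hyp_const; nra.
have kck4 : 4 <= hyp_const * k.
  have h : c ^+ 2 / 4 * hyp_const <= hyp_const * k.
    rewrite [leRHS]mulrC ler_wpM2r // /hyp_const !mulr_ge0 ?addr_ge0 ?mulr_ge0 //; lra.
  apply: le_trans h; rewrite /hyp_const.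
  have -> : c ^+ 2 / 4 * ((4 + 2 / c) * (1 + 2 / c) * (2 / c)) =
    (4 * c + 2) * (c + 2) / (2 * c) by field; rewrite gt_eqF.
  rewrite ler_pdivlMr ?mulr_gt0 //; have := sqr_ge0 c; nra.
have [zs|sz] := leP z s.
  have : `|phi c k z| <= 2 by apply: small; lra.
  move=> h; apply: le_trans kck4.
  by rewrite -(real_normK (num_real _)); have := normr_ge0 (phi c k z); nra.
have hneg : - 2^-1 < 0 :> R by lra.
have hss : 0 < s <= z by lra.
have hz : z < z + 1 by lra.
apply: le_trans (hyp_energy hneg (H (z + 1)) hss hz) _.
have fl : (1 + s) * `|phi1 c k s| <= k * 2 / c.
  apply: (@hyp_flux_bound _ _ _ _ (s + 1) 2 s _ _ (H _)) => //; lra.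
have f2 : (1 + s) ^+ 2 * phi1 c k s ^+ 2 <= (k * 2 / c) ^+ 2.
  rewrite -exprMn -(real_normK (num_real (_ * _))) normrM ger0_norm; last lra.
  by rewrite ler_sqr ?nnegrE // ?mulr_ge0 //; lra.
have g : s * (1 + s) * phi1 c k s ^+ 2 / k <= 2 / c.
  have -> : 2 / c = s / k * (k * 2 / c) ^+ 2 by rewrite /s; field; rewrite !gt_eqF.
  have -> : s * (1 + s) * phi1 c k s ^+ 2 / k = s / k * ((1 + s) * phi1 c k s ^+ 2) by ring.
  apply: ler_wpM2l; first by rewrite divr_ge0 // ltW.
  apply: le_trans f2; rewrite ler_wpM2r ?sqr_ge0 //; nra.
have p2 : phi c k s ^+ 2 <= 4.
  have : `|phi c k s| <= 2 by apply: small; lra.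
  by rewrite -(real_normK (num_real _)); have := normr_ge0 (phi c k s); nra.
have -> : hyp_const * k = (4 + 2 / c) * ((1 + 2 / c) * (2 / c * k)) by rewrite /hyp_const; ring.
apply: ler_pM.
- by rewrite addr_ge0 ?sqr_ge0 // divr_ge0 ?(ltW k0) // mulr_ge0 ?sqr_ge0 // mulr_ge0; lra.
- by rewrite divr_ge0; lra.
- exact: lerD.
- have -> : 2 / c * k = s^-1 by rewrite /s; field; rewrite !gt_eqF.
  by rewrite ler_wpM2r ?invr_ge0; lra.
Qed.

End HypergeometricBounds.

(** * Real analytic functions *)

Section ComplexParts.
Context {R : realType}.
Implicit Types (z w : R[i]) (r : R).

Lemma ReD z w : complex.Re (z + w) = complex.Re z + complex.Re w.
Proof. by case: z w => [a b] [c d]. Qed.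

Lemma ImD z w : complex.Im (z + w) = complex.Im z + complex.Im w.
Proof. by case: z w => [a b] [c d]. Qed.

Lemma Re_sum n (u : nat -> R[i]) :
  complex.Re (\sum_(i < n) u i) = \sum_(i < n) complex.Re (u i).
Proof. by elim: n => [|n ih]; rewrite ?big_ord0 // !big_ord_recr /= ReD ih. Qed.

Lemma Im_sum n (u : nat -> R[i]) :
  complex.Im (\sum_(i < n) u i) = \sum_(i < n) complex.Im (u i).
Proof. by elim: n => [|n ih]; rewrite ?big_ord0 // !big_ord_recr /= ImD ih. Qed.

Lemma Re_mulC z r : complex.Re (z * r%:C) = complex.Re z * r.
Proof. by case: z => [a b]; rewrite /= mulr0 subr0. Qed.

Lemma Im_mulC z r : complex.Im (z * r%:C) = complex.Im z * r.
Proof. by case: z => [a b]; rewrite /= mulr0 add0r. Qed.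

Lemma Re_Cmul z r : complex.Re (r%:C * z) = r * complex.Re z.
Proof. by rewrite mulrC Re_mulC mulrC. Qed.

Lemma Im_Cmul z r : complex.Im (r%:C * z) = r * complex.Im z.
Proof. by rewrite mulrC Im_mulC mulrC. Qed.

Lemma complexP z w : complex.Re z = complex.Re w -> complex.Im z = complex.Im w -> z = w.
Proof. by case: z w => [a b] [c d] /= -> ->. Qed.

Lemma CX r n : (r ^+ n)%:C = r%:C ^+ n :> R[i].
Proof. exact: (rmorphXn (real_complex R)). Qed.

Lemma CM r s : (r * s)%:C = r%:C * s%:C :> R[i].
Proof. exact: (rmorphM (real_complex R)). Qed.

Lemma CD r s : (r + s)%:C = r%:C + s%:C :> R[i].
Proof. exact: (rmorphD (real_complex R)). Qed.

Lemma CV r : (r^-1)%:C = r%:C^-1 :> R[i].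
Proof. exact: (fmorphV (real_complex R)). Qed.

Lemma Cnat n : (n%:R)%:C = n%:R :> R[i].
Proof. exact: (rmorph_nat (real_complex R)). Qed.

End ComplexParts.

Section RealAnalytic.
Context {R : realType}.
Implicit Types (f g : R -> R) (u v : nat -> R) (x r : R).

Definition real_analytic f x := exists r u,
  [/\ 0 < r, radius_ge u r & forall h, `|h| < r -> f (x + h) = psum u h].

(** The terms of a convergent series are bounded. *)
Lemma cvg_radius u r : (forall x, `|x| < r -> cvgn (pseries u x)) -> radius_ge u r.
Proof.
move=> cv s /andP[s0 sr]; have [|K [Kreal Kf]] := cvg_series_bounded (cv s _).
  by rewrite gtr0_norm.
exists (K + 1) => n; have := Kf (K + 1); rewrite ltrDl ltr01 => /(_ isT n Logic.I) /=.
by rewrite normrM normrX (gtr0_norm s0).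
Qed.

Lemma psum_cvg u x l : pseries u x @ \oo --> l -> psum u x = l.
Proof. by move=> h; exact/cvg_lim. Qed.

Lemma psum_unique u v r : 0 < r -> radius_ge u r -> radius_ge v r ->
  (forall x, 0 < x < r -> psum u x = psum v x) -> forall n, u n = v n.
Proof.
move=> r0 ur vr uv n; apply/eqP; rewrite -subr_eq0; apply/eqP.
have vr' := radius_scale (-1) vr.
rewrite -mulN1r; apply: (@psum_eq0_coef _ (fun n => u n + -1 * v n) r) => //.
  exact: radius_add.
move=> x /[dup] hx /uv e; case/andP: hx => x0 xr; have x1 : `|x| < r by rewrite gtr0_norm.
by rewrite (psum_add ur vr' x1) (psum_scale _ vr x1) e mulN1r subrr.
Qed.

(** Identity theorem: the left end of the largest interval [(s, b)] on which
    the functions agree is interior to a disc of convergence of both. *)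
Lemma real_analytic_unique f g a b : a < b ->
  (forall x, x < b -> real_analytic f x) -> (forall x, x < b -> real_analytic g x) ->
  (forall x, a < x < b -> f x = g x) -> forall x, x < b -> f x = g x.
Proof.
move=> ab fa ga fg x1 x1b; apply: contrapT => nfg.
pose S := [set s | forall x, s < x < b -> f x = g x].
have Sa : S a by [].
have lbS : lbound S x1.
  by move=> s Ss; rewrite leNgt; apply/negP => h; apply: nfg; apply: Ss; rewrite h.
have infS : has_inf S by split; [exists a|exists x1].
pose s := inf S.
have sa : s <= a by apply: ge_inf => //; exists x1.
have fgs x : s < x < b -> f x = g x.
  move=> /andP[sx xb]; have [|t St] := @inf_adherent _ S (x - s) _ infS.
    by rewrite subr_gt0.
  by rewrite addrC subrK => tx; apply: St; rewrite tx.
have sb : s < b by lra.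
have [r [u [r0 ur fu]]] := fa s sb; have [r' [v [r0' vr gv]]] := ga s sb.
pose q := Num.min (Num.min r r') (b - s).
have q0 : 0 < q by rewrite !lt_min r0 r0' subr_gt0.
have [qr qr' qb] : [/\ q <= r, q <= r' & q <= b - s].
  by rewrite !ge_min !lexx !orbT.
have uv := psum_unique q0 (radius_le qr ur) (radius_le qr' vr).
have {}uv : forall n, u n = v n.
  apply: uv => x /andP[x0 xq]; rewrite -fu ?gtr0_norm -?gv ?gtr0_norm //; try lra.
  by apply: fgs; lra.
have : S (s - q / 2).
  move=> x hx; have [sx|xs] := ltP s x; first by apply: fgs; lra.
  have -> : x = s + (x - s) by ring.
  have hn : `|x - s| < q by rewrite ler0_norm; lra.
  rewrite fu ?gv; [|lra|lra].
  by congr (psum _ _); apply/funext.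
move=> /(ge_inf (ex_intro _ x1 lbS)); rewrite -/s; lra.
Qed.

Lemma analytic_parts (F : R -> R[i]) x : analytic_at F x ->
  real_analytic (cRe F) x /\ real_analytic (cIm F) x.
Proof.
move=> [r [u [r0 H]]].
have HR h : `|h| < r -> pseries (fun n => complex.Re (u n)) h @ \oo --> cRe F (x + h).
  move=> /H[+ _]; apply: cvg_trans; apply: near_eq_cvg; apply: nearW => n.
  rewrite /cRe (Re_sum _ (fun k => u k * h%:C ^+ k)) /pseries /series /= big_mkord.
  by apply: eq_bigr => i _; rewrite -CX Re_mulC.
have HI h : `|h| < r -> pseries (fun n => complex.Im (u n)) h @ \oo --> cIm F (x + h).
  move=> /H[_ +]; apply: cvg_trans; apply: near_eq_cvg; apply: nearW => n.
  rewrite /cIm (Im_sum _ (fun k => u k * h%:C ^+ k)) /pseries /series /= big_mkord.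
  by apply: eq_bigr => i _; rewrite -CX Im_mulC.
split; [exists r, (fun n => complex.Re (u n))|exists r, (fun n => complex.Im (u n))].
  split=> // [|h hr]; first by apply: cvg_radius => y /HR/cvgP.
  by apply/esym/psum_cvg; exact: HR.
split=> // [|h hr]; first by apply: cvg_radius => y /HI/cvgP.
by apply/esym/psum_cvg; exact: HI.
Qed.

(** Series with real coefficients and a real variable have zero imaginary part
    term by term. *)
Lemma has_sumC_real u (F : R -> R) r : radius_ge u r -> (forall h, `|h| < r -> F h = psum u h) ->
  forall h, `|h| < r -> has_sumC (fun n => (u n)%:C * h%:C ^+ n) (F h)%:C.
Proof.
move=> ur Fu h hr; split.
  rewrite /= Fu //.
  have : pseries u h @ \oo --> psum u h by exact: radius_cvg ur hr.
  apply: cvg_trans; apply: near_eq_cvg; apply: nearW => n.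
  rewrite /cRe (Re_sum _ (fun k => (u k)%:C * h%:C ^+ k)) /pseries /series /= big_mkord.
  by apply: eq_bigr => i _; rewrite -CX -CM.
apply: cvg_near_cst; apply: nearW => n.
rewrite /cIm (Im_sum _ (fun k => (u k)%:C * h%:C ^+ k)) big1 // => i _.
by rewrite -CX -CM.
Qed.

End RealAnalytic.

(** * Identification of the hypergeometric function *)

Section LocalSeries.
Context {R : realType}.
Variables (c k : R).

(** Taylor coefficients, in pairs of consecutive ones, at an ordinary point [x0]
    of the solution with value [a0] and slope [a1]: the hypergeometric equation
    in [x], whose coefficients are quadratic at most, gives a three-term
    recurrence there. *)
Fixpoint taylor2 (x0 a0 a1 : R) n : R * R :=
  if n is n'.+1 then
    let: (u, v) := taylor2 x0 a0 a1 n' in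
    (v, (- (n'.+1%:R * ((1 - 2 * x0) * n'%:R + (c - (c + 1) * x0)) * v)
         + (n'%:R ^+ 2 + c * n'%:R + k) * u) / (x0 * (1 - x0) * (n'.+2%:R * n'.+1%:R)))
  else (a0, a1).

Definition taylor x0 a0 a1 n := (taylor2 x0 a0 a1 n).1.

Lemma taylor2E x0 a0 a1 n : taylor2 x0 a0 a1 n = (taylor x0 a0 a1 n, taylor x0 a0 a1 n.+1).
Proof. by rewrite /taylor /=; case: (taylor2 x0 a0 a1 n). Qed.

Lemma taylor_rec (x0 a0 a1 : R) n : x0 * (1 - x0) != 0 ->
  x0 * (1 - x0) * (n.+2%:R * n.+1%:R) * taylor x0 a0 a1 n.+2 =
  - (n.+1%:R * ((1 - 2 * x0) * n%:R + (c - (c + 1) * x0)) * taylor x0 a0 a1 n.+1)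
  + (n%:R ^+ 2 + c * n%:R + k) * taylor x0 a0 a1 n.
Proof.
move=> p0; rewrite [taylor x0 a0 a1 n.+2]/taylor /= !taylor2E.
have h : (n.+2%:R * n.+1%:R : R) != 0 by rewrite mulf_neq0 // pnatr_eq0.
move: (_.+2%:R * _ : R) h => N h; set T := taylor; move: p0 => /=.
move: (x0 * (1 - x0)) => p p0; field.
by rewrite p0 h.
Qed.

Lemma taylor_radius (x0 a0 a1 : R) : x0 * (1 - x0) != 0 ->
  exists r, 0 < r /\ radius_ge (taylor x0 a0 a1) r.
Proof.
move=> p0; set u := taylor x0 a0 a1.
pose P : R := `|x0 * (1 - x0)|; have P0 : 0 < P by rewrite normr_gt0.
pose B : R := (`|1 - 2 * x0| + `|c - (c + 1) * x0| + (1 + `|c| + `|k|)) / P.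
have B0 : 0 <= B by rewrite divr_ge0 ?addr_ge0 // ltW.
have step n : `|u n.+2| <= B * (`|u n| + `|u n.+1|).
  have N0 : 0 <= n%:R :> R by [].
  have E := taylor_rec a0 a1 n p0; rewrite -/u in E.
  have N1 : 0 < n.+2%:R * n.+1%:R :> R by rewrite mulr_gt0 ?ltr0n.
  have : P * (n.+2%:R * n.+1%:R) * `|u n.+2| <=
     (n.+2%:R * n.+1%:R) * ((P * B) * (`|u n| + `|u n.+1|)).
    have -> : P * (n.+2%:R * n.+1%:R) * `|u n.+2| =
      `|x0 * (1 - x0) * (n.+2%:R * n.+1%:R) * u n.+2|.
      by rewrite [RHS]normrM [in RHS]normrM (gtr0_norm N1).
    rewrite E; apply: le_trans (ler_normD _ _) _.
    rewrite normrN !normrM.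
    have -> : P * B = `|1 - 2 * x0| + `|c - (c + 1) * x0| + (1 + `|c| + `|k|).
      by rewrite /B mulrC divfK // gt_eqF.
    have q1 : `|(1 - 2 * x0) * n%:R + (c - (c + 1) * x0)| <=
        (`|1 - 2 * x0| + `|c - (c + 1) * x0|) * n.+2%:R.
      apply: le_trans (ler_normD _ _) _; rewrite normrM (ger0_norm N0).
      rewrite [leRHS]mulrDl lerD //; first by rewrite ler_wpM2l // ler_nat -addn2 leq_addr.
      by rewrite ler_peMr // ler1n.
    have q2 : `|n%:R ^+ 2 + c * n%:R + k| <= (1 + `|c| + `|k|) * (n.+2%:R * n.+1%:R).
      apply: le_trans (ler_normD _ _) _.
      apply: le_trans (lerD (ler_normD _ _) (lexx _)) _.
      rewrite normrX normrM (ger0_norm N0).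
      have -> : n.+2%:R = n%:R + 2 :> R by rewrite -addn2 natrD.
      have -> : n.+1%:R = n%:R + 1 :> R by rewrite natr1.
      move: (normr_ge0 c) (normr_ge0 k) N0; move: (n%:R : R) `|c| `|k| => N C K C0 K0 N0.
      have : 0 <= C * N ^+ 2 by rewrite mulr_ge0 ?sqr_ge0.
      have : 0 <= K * N ^+ 2 by rewrite mulr_ge0 ?sqr_ge0.
      have : 0 <= C * N by rewrite mulr_ge0.
      have : 0 <= K * N by rewrite mulr_ge0.
      by lra.
    rewrite (ger0_norm (ler0n _ _)).
    have v0 := normr_ge0 (u n); have v1 := normr_ge0 (u n.+1).
    have e1 : n.+1%:R * `|(1 - 2 * x0) * n%:R + (c - (c + 1) * x0)| * `|u n.+1| <=
       n.+1%:R * ((`|1 - 2 * x0| + `|c - (c + 1) * x0|) * n.+2%:R) * `|u n.+1|.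
      by rewrite ler_wpM2r // ler_wpM2l.
    have e2 := ler_wpM2r v0 q2.
    apply: le_trans (lerD e1 e2) _.
    have s1 : 0 <= (`|1 - 2 * x0| + `|c - (c + 1) * x0|) * (n.+2%:R * n.+1%:R) * `|u n|.
      by rewrite !mulr_ge0 ?addr_ge0 // ltW.
    have s2 : 0 <= (1 + `|c| + `|k|) * (n.+2%:R * n.+1%:R) * `|u n.+1|.
      by rewrite !mulr_ge0 ?addr_ge0 // ltW.
    by move: s1 s2; lra.
  have -> : P * (n.+2%:R * n.+1%:R) * `|u n.+2| = (n.+2%:R * n.+1%:R) * (P * `|u n.+2|) by ring.
  by rewrite ler_pM2l // -mulrA ler_pM2l.
exists (B + 1)^-1; have b1 : 0 < B + 1 by lra.
split; first by rewrite invr_gt0.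
apply: (@radius_ratio _ _ (fun n => `|u n| + `|u n.+1|)) => [n|s /andP[s0 s1]].
  by rewrite lerDl.
exists 0%N => n _; have h := step n.
have v0 := normr_ge0 (u n); have v1 := normr_ge0 (u n.+1).
have {}h : `|u n.+1| + `|u n.+2| <= (B + 1) * (`|u n| + `|u n.+1|) by lra.
apply: le_trans (ler_wpM2r (ltW s0) h) _.
rewrite mulrAC ler_piMl ?addr_ge0 //.
by move: s1; rewrite -(ltr_pM2l b1) divff ?gt_eqF // => /ltW.
Qed.

Lemma taylor_ode (x0 a0 a1 r h : R) : x0 * (1 - x0) != 0 ->
  let u := taylor x0 a0 a1 in radius_ge u r -> `|h| < r ->
  (x0 + h) * (1 - (x0 + h)) * psum u^'d^'d h
  + (c - (c + 1) * (x0 + h)) * psum u^'d h - k * psum u h = 0.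
Proof.
move=> p0 u r0 hr; have r1 := radius_diffs r0; have r2 := radius_diffs r1.
have := @psum_comb _ r h [:: (x0 * (1 - x0), u^'d^'d); (1 - 2 * x0, mulX u^'d^'d);
  (-1, mulX (mulX u^'d^'d)); (c - (c + 1) * x0, u^'d); (- (c + 1), mulX u^'d); (- k, u)].
rewrite !big_cons big_nil /=.
rewrite (psum_mulX (radius_mulX r2) hr) (psum_mulX r2 hr) (psum_mulX r1 hr).
move=> H; apply: etrans (H _ hr _); first by ring.
  by do ?split => //; do ?apply: radius_mulX.
move=> n; rewrite !big_cons big_nil /= mulX2_dd mulX_dd mulX_d /pseries_diffs.
have := taylor_rec a0 a1 n p0; rewrite -/u.
have -> : n.+2%:R = n%:R + 2 :> R by rewrite -addn2 natrD.
have -> : n.+1%:R = n%:R + 1 :> R by rewrite natr1.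
by move: (u n.+2) (u n.+1) (u n) (n%:R : R) => A B C N; lra.
Qed.

(** Both the solution and the sum of the local power series with the same
    initial data solve a regular equation of order two, so that they coincide. *)
Lemma ode_real_analytic (g g1 g2 : R -> R) (x0 e : R) : x0 != 0 -> x0 < 1 -> 0 < e ->
  (forall x, `|x - x0| < e -> [/\ is_derive x 1 g (g1 x), is_derive x 1 g1 (g2 x) &
     x * (1 - x) * g2 x + (c - (c + 1) * x) * g1 x - k * g x = 0]) ->
  real_analytic g x0.
Proof.
move=> x00 x01 e0 H.
have p0 : x0 * (1 - x0) != 0 by rewrite mulf_neq0 // subr_eq0 eq_sym lt_eqF.
have [r' [r0' ur']] := taylor_radius (g x0) (g1 x0) p0.
set u := taylor _ _ _ in ur'.
have nx0 : 0 < `|x0| by rewrite normr_gt0.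
pose r : R := Num.min (Num.min r' e) (Num.min (`|x0| / 2) (Num.min ((1 - x0) / 2) 1)).
have r0 : 0 < r by rewrite !lt_min r0' e0 ltr01 !divr_gt0 // subr_gt0.
have [rr' re rx ry] : [/\ r <= r', r <= e, r <= `|x0| / 2 & r <= (1 - x0) / 2].
  by rewrite !ge_min !lexx !orbT.
have rl1 : r <= 1 by rewrite !ge_min !lexx !orbT.
have ur := radius_le rr' ur'.
exists r, u; split=> // h hr.
pose m : R := `|x0| / 2 * ((1 - x0) / 2).
have m0 : 0 < m by rewrite mulr_gt0 // divr_gt0 // subr_gt0.
pose C : R := `|c| + `|c + 1| * (`|x0| + 1) + `|k|.
have der1 (t : R) : is_derive t 1 (fun t => x0 + t) 1 by der; rewrite add0r.
have dg (t : R) : - r < t < r ->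
  [/\ is_derive t 1 (fun t => g (x0 + t)) (g1 (x0 + t)),
      is_derive t 1 (fun t => g1 (x0 + t)) (g2 (x0 + t)) &
      (x0 + t) * (1 - (x0 + t)) * g2 (x0 + t)
      + (c - (c + 1) * (x0 + t)) * g1 (x0 + t) - k * g (x0 + t) = 0].
  move=> ht; have [|d0 d1 eq] := H (x0 + t).
    by rewrite addrC addKr; rewrite ltr_norml; lra.
  split=> //; rewrite -[X in is_derive _ _ _ X]mulr1.
    exact: (der_comp (g := fun t => x0 + t)).
  exact: (der_comp (g := fun t => x0 + t)).
have nr (t : R) : - r < t < r -> `|t| < r by rewrite ltr_norml.
apply/eqP; rewrite -subr_eq0; apply/eqP.
apply: (@ode2_zero _ (fun h => g (x0 + h) - psum u h)
  (fun h => g1 (x0 + h) - psum u^'d h) (fun h => g2 (x0 + h) - psum u^'d^'d h)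
  (- r) r (C / m) 0) => //.
- move=> t ht; have [d0 _ _] := dg t ht; have ? := psum_derive ur (nr t ht).
  by der.
- move=> t ht; have [_ d0 _] := dg t ht.
  by have ? := psum_derive (radius_diffs ur) (nr t ht); der.
- move=> t ht; have [_ _ e1] := dg t ht.
  have e2 := @taylor_ode x0 (g x0) (g1 x0) r t p0 ur (nr t ht).
  have tr := nr t ht.
  have mb : m <= `|(x0 + t) * (1 - (x0 + t))|.
    rewrite normrM /m ler_pM ?divr_ge0 //; try lra.
      have := ler_dist_dist x0 (- t); rewrite opprK normrN.
      have := ler_norm (`|x0| - `|t|); lra.
    rewrite ger0_norm; lra.
  rewrite mulrAC ler_pdivlMr //.
  apply: le_trans (_ : `|g2 (x0 + t) - psum u^'d^'d t| * `|(x0 + t) * (1 - (x0 + t))| <= _).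
    by rewrite ler_wpM2l.
  rewrite -normrM.
  have -> : (g2 (x0 + t) - psum u^'d^'d t) * ((x0 + t) * (1 - (x0 + t))) =
    - (c - (c + 1) * (x0 + t)) * (g1 (x0 + t) - psum u^'d t)
    + k * (g (x0 + t) - psum u t) by move: e1 e2; rewrite -/u; lra.
  apply: le_trans (ler_normD _ _) _; rewrite !normrM normrN.
  have q : `|c - (c + 1) * (x0 + t)| <= C.
    apply: le_trans (ler_normB _ _) _; rewrite normrM /C -addrA lerD //.
    have h2 : `|x0 + t| <= `|x0| + 1 by apply: le_trans (ler_normD _ _) _; lra.
    by apply: le_trans (ler_wpM2l _ h2) _; rewrite ?lerDl.
  have kC : `|k| <= C by rewrite /C lerDr addr_ge0 // mulr_ge0 // addr_ge0.
  by rewrite [leRHS]mulrDr [leRHS]addrC lerD // ler_wpM2r.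
- by rewrite oppr_lt0 r0.
- by rewrite addr0 psum0 /u /taylor /= subrr.
- by rewrite addr0 psum0 /u /pseries_diffs /taylor /= mul1r subrr.
- by move: hr; rewrite ltr_norml.
Qed.

End LocalSeries.

Section Hyp2F1.
Context {R : realType}.
Variables (c k : R).
Hypotheses (c0 : 0 < c) (k0 : 0 < k).

Let r0 := gauss_radius c0 k0.
Let r1 := radius_diffs r0.
Let r2 := radius_diffs r1.

(** The two branches overlap on [-1 < x < 0], where they agree by uniqueness of
    the solution that is regular at [0]. *)
Definition hyp2F1_real (x : R) : R := if x < 0 then phi c k (- x) else psum (gauss c k) x.

Lemma gauss_sol : hyp_sol c k (fun z => psum (gauss c k) (- z))
  (fun z => - psum (gauss c k)^'d (- z)) (fun z => psum (gauss c k)^'d^'d (- z)) (- 2^-1) 1.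
Proof.
move=> z hz; have zn : `|- z| < 1 by rewrite normrN ltr_norml; lra.
have dN : is_derive z 1 (fun z : R => - z) (-1) by der.
split.
- rewrite -[X in is_derive _ _ _ X]mulrN1.
  by apply: (der_comp (g := fun z => - z)) dN; exact: psum_derive r0 _.
- have h := der_comp (g := fun z => - z) (psum_derive r1 zn) dN.
  by der; rewrite mulrN1 opprK.
- by have := gauss_ode c0 k0 zn; lra.
Qed.

Lemma hyp2F1_real_gauss (x : R) : `|x| < 1 -> hyp2F1_real x = psum (gauss c k) x.
Proof.
rewrite ltr_norml /hyp2F1_real; case: (ltP x 0) => // x0 hx.
have H := hyp_solB (@phi_sol _ c k c0 k0 1) gauss_sol.
have n0 : - 2^-1 < 0 :> R by lra.
have y0 : phi c k 0 - psum (gauss c k) (- 0) = 0 by rewrite phi0 oppr0 psum0 subrr.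
have xx : 0 <= - x < 1 by lra.
by have := hyp_sol_unique0 c0 k0 n0 H y0 xx; rewrite opprK => /eqP; rewrite subr_eq0 => /eqP.
Qed.

Lemma hyp2F1_real_neg (z : R) : 0 < z -> hyp2F1_real (- z) = phi c k z.
Proof. by move=> z0; rewrite /hyp2F1_real oppr_lt0 z0 opprK. Qed.

Lemma hyp2F1_real_analytic (x : R) : x < 1 -> real_analytic hyp2F1_real x.
Proof.
move=> x1; have [x0|x0|->] := ltgtP x 0.
- apply: (@ode_real_analytic _ c k hyp2F1_real (fun x => - phi1 c k (- x)) (fun x => phi2 c k (- x)) x (- x)); rewrite ?lt_eqF //; first lra.
  move=> t ht; have t0 : t < 0 by move: ht; rewrite ltr_norml; lra.
  have [|d0 d1 e] := @phi_sol _ c k c0 k0 (- t + 1) (- t); first lra.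
  have dN : is_derive t 1 (fun z : R => - z) (-1) by der.
  split.
  + apply: (@derive_near _ (fun t => phi c k (- t)) _ _ _ (- t)); first lra.
      by move=> s; rewrite ltr_norml /hyp2F1_real => hs; rewrite ifT //; lra.
    rewrite -[X in is_derive _ _ _ X]mulrN1.
    exact: (der_comp (g := fun z => - z)) dN.
  + have h := der_comp (g := fun z => - z) d1 dN.
    by der; rewrite mulrN1 opprK.
  + rewrite /hyp2F1_real t0; lra.
- apply: (@ode_real_analytic _ c k hyp2F1_real (psum (gauss c k)^'d) (psum (gauss c k)^'d^'d) x (Num.min x (1 - x))); rewrite ?gt_eqF //.
    by rewrite lt_min x0 subr_gt0.
  move=> t; rewrite lt_min !ltr_norml => ht.
  have tn : `|t| < 1 by rewrite ltr_norml; lra.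
  split.
  + apply: (@derive_near _ (psum (gauss c k)) _ _ _ t); first lra.
      by move=> s; rewrite ltr_norml /hyp2F1_real => hs; rewrite ifF //; apply/negbTE; rewrite -leNgt; lra.
    exact: psum_derive r0 _.
  + exact: psum_derive r1 _.
  + by rewrite hyp2F1_real_gauss // gauss_ode.
- exists 1, (gauss c k); split=> // h hr; rewrite add0r; exact: hyp2F1_real_gauss.
Qed.

End Hyp2F1.

Section Hyp2F1Identification.
Context {R : realType}.
Variables (c tau : R).
Hypothesis c0 : 0 < c.

Definition kappa : R := c ^+ 2 / 4 + tau ^+ 2.

Lemma kappa_gt0 : 0 < kappa.
Proof. by rewrite ltr_wpDr ?sqr_ge0 // divr_gt0 // exprn_gt0. Qed.

Notation a := ((c / 2) -i* tau).
Notation b := ((c / 2) +i* tau).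

Lemma gauss_coefE n : gauss_coef a b c%:C n = (gauss c kappa n)%:C.
Proof.
rewrite /gauss_coef; elim: n => [|n ih].
  by rewrite /pochhammer !big_ord0 fact0 !mul1r invr1.
have pS (z : R[i]) : pochhammer z n.+1 = pochhammer z n * (z + n%:R) by rewrite /pochhammer big_ord_recr.
rewrite !pS factS natrM /= CM -ih.
have -> : ((n%:R ^+ 2 + c * n%:R + kappa) / ((c + n%:R) * n.+1%:R))%:C =
   (a + n%:R) * (b + n%:R) / ((c%:C + n%:R) * n.+1%:R).
  rewrite CM CV CM CD !Cnat; congr (_ / _).
  by rewrite -!Cnat /kappa; apply: complexP => /=; field.
by rewrite !invfM; ring.
Qed.

Lemma hyp2F1_real_is_hyp2F1 : is_hyp2F1 a b c%:C (fun x => (hyp2F1_real c kappa x)%:C).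
Proof.
have k0 := kappa_gt0; have r0 := gauss_radius c0 k0.
split=> [x x1|x x1].
  rewrite (_ : (fun n => _) = (fun n => (gauss c kappa n)%:C * x%:C ^+ n)).
    by apply: (has_sumC_real r0) x1 => h hr; rewrite hyp2F1_real_gauss.
  by apply/funext => n; rewrite gauss_coefE.
have [r [u [rp ur fu]]] := hyp2F1_real_analytic c0 k0 x1.
exists r, (fun n => (u n)%:C); split=> // h hr.
exact: (has_sumC_real ur (F := fun h => hyp2F1_real c kappa (x + h))).
Qed.

Lemma hyp2F1E (x : R) : x < 1 -> hyp2F1 a b c%:C x = (hyp2F1_real c kappa x)%:C.
Proof.
have G := hyp2F1_real_is_hyp2F1.
have /= := @xgetPex (R -> R[i]) (fun=> 0) [set g | is_hyp2F1 a b c%:C g] (ex_intro _ _ G).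
rewrite -/(hyp2F1 a b c%:C); move: (hyp2F1 a b c%:C) => g [g1 g2] x1.
have [G1 G2] := G.
have gG y : - 1 < y < 1 -> cRe g y = hyp2F1_real c kappa y /\ cIm g y = 0.
  rewrite -ltr_norml => y1; have [h1 h2] := g1 y y1; have [h3 h4] := G1 y y1.
  by split; [exact: (cvg_unique _ h1 h3)|exact: (cvg_unique _ h2 h4)].
have n11 : -1 < 1 :> R by lra.
apply: complexP => /=.
  have := @real_analytic_unique _ (cRe g) (hyp2F1_real c kappa) (-1) 1 n11; apply => //.
  - by move=> y /g2/analytic_parts[].
  - by move=> y y1; exact: (hyp2F1_real_analytic c0 kappa_gt0).
  - by move=> y /gG[].
have := @real_analytic_unique _ (cIm g) (cIm (fun x => (hyp2F1_real c kappa x)%:C)) (-1) 1 n11; apply => //.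
- by move=> y /g2/analytic_parts[].
- by move=> y /G2/analytic_parts[].
- by move=> y /gG[].
Qed.

Lemma hyp2F1_neg (z : R) : 0 < z -> hyp2F1 a b c%:C (- z) = (phi c kappa z)%:C.
Proof. by move=> z0; rewrite hyp2F1E ?hyp2F1_real_neg //; lra. Qed.

End Hyp2F1Identification.

(** * Integrals of derivatives over the half-line *)

Section HalfLine.
Context {R : realType}.
Implicit Types (f F g : R -> R) (a b t x B : R).
Notation mu := (@lebesgue_measure R).
Notation half := (`]0, +oo[%classic : set R).

Lemma in_half t : half t = (0 < t) :> Prop.
Proof. by rewrite /= in_itv /= andbT. Qed.

Lemma measurable_half f : (forall t, 0 < t -> {for t, continuous f}) ->
  measurable_fun half f.
Proof.
move=> cf; apply: open_continuous_measurable_fun => //.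
by move=> t; rewrite inE in_half; exact: cf.
Qed.

Lemma segment_FTC F f a b : 0 < a -> a < b ->
  (forall t, 0 < t -> is_derive t 1 F (f t)) ->
  (forall t, 0 < t -> {for t, continuous f}) ->
  (\int[mu]_(t in `[a, b]) (f t)%:E = (F b - F a)%:E)%E.
Proof.
move=> a0 ab dF cf.
have pos t : t \in `[a, b] -> 0 < t by rewrite in_itv /= => /andP[at_ _]; apply: lt_le_trans at_.
have b0 : 0 < b by lra.
rewrite (@continuous_FTC2 _ f F) ?EFinB //.
- by apply: continuous_in_subspaceT => t /[!inE] tab; apply: cf; exact: pos.
- split.
  + move=> t tab; have [//] := dF t (pos _ (subset_itv_oo_cc tab)).
  + by apply: cvg_at_right_filter; exact: derive_continuous (dF a a0).
  + by apply: cvg_at_left_filter; exact: derive_continuous (dF b b0).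
- move=> t tab; rewrite derive1E.
  by have [_ ->] := dF t (pos _ (subset_itv_oo_cc tab)).
Qed.

Let lo n : R := n.+2%:R^-1.
Let hi n : R := n.+2%:R.

Let lo_gt0 n : 0 < lo n. Proof. by rewrite invr_gt0 ltr0n. Qed.

Let lo_hi n : lo n < hi n.
Proof.
have h : 1 < hi n by rewrite /hi ltr1n.
by apply: lt_trans h; rewrite /lo invf_lt1 ?ltr1n ?ltr0n.
Qed.

Let hi_cvg : hi n @[n --> \oo] --> +oo%R.
Proof.
apply/cvgryPge => A; near=> n; rewrite /hi.
apply: (@le_trans _ _ n%:R); last by rewrite ler_nat -addn2 leq_addr.
by near: n; exact: nbhs_infty_ger.
Unshelve. all: by end_near. Qed.

Let lo_cvg : lo n @[n --> \oo] --> (0 : R).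
Proof.
have h := @cvg_harmonic R.
by rewrite -(cvg_shiftn 1) in h; move: h; rewrite /harmonic /=; under eq_fun do rewrite addn1.
Qed.

Let seg n : set R := `[lo n, hi n].

Let seg_homo : {homo seg : n m / (n <= m)%N >-> (n <= m)%O}.
Proof.
move=> n m nm; rewrite subsetEset; apply: subset_itv; rewrite bnd_simp /lo /hi.
  by rewrite lef_pV2 ?posrE ?ltr0n // ler_nat.
by rewrite ler_nat.
Qed.

Let seg_bigcup : \bigcup_n seg n = half.
Proof.
apply/seteqP; split => t.
  move=> [n _]; rewrite in_half /seg /= in_itv /= => /andP[+ _].
  exact: lt_le_trans.
rewrite in_half => t0.
have [n [n1 n2]] : exists n, lo n < t /\ t < hi n.
  have h1 : \forall n \near \oo, lo n < t by exact: (cvgr_lt 0).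
  have h2 : \forall n \near \oo, t < hi n by exact: cvgry_gt.
  by have [n []] := filter_ex (filterI h1 h2); exists n.
by exists n => //; rewrite /seg /= in_itv /= !ltW.
Qed.

(** Monotone convergence along an exhaustion by compact intervals. *)
Lemma integrable_derivative F f B :
  (forall t, 0 < t -> is_derive t 1 F (f t)) ->
  (forall t, 0 < t -> {for t, continuous f}) ->
  (forall t, 0 < t -> 0 <= f t) -> (forall t, 0 < t -> 0 <= F t <= B) ->
  mu.-integrable half (EFin \o f).
Proof.
move=> dF cf f0 FB; have mf := measurable_half cf.
apply/integrableP; split; first exact/measurable_EFinP.
have pos n t : seg n t -> 0 < t.
  by rewrite /seg /= in_itv /= => /andP[+ _]; exact: lt_le_trans.
have := @ge0_nondecreasing_set_cvg_integral _ (measurableTypeR R) R seg (fun t => (f t)%:E) mu seg_homo.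
rewrite seg_bigcup => H.
have {}H : (\int[mu]_(t in seg n) (f t)%:E)%E @[n --> \oo] --> (\int[mu]_(t in half) (f t)%:E)%E.
  apply: H => [n|n|n t /pos tp]; last by rewrite lee_fin f0.
    exact: measurable_itv.
  apply/measurable_EFinP; apply: measurable_funS mf => // t /pos; by rewrite in_half.
have le : (\int[mu]_(t in half) (f t)%:E <= B%:E)%E.
  rewrite -(cvg_lim _ H) //; apply: lime_le; first by apply/cvg_ex; eexists; exact: H.
  apply: nearW => n; rewrite (segment_FTC (lo_gt0 n) (lo_hi n) dF cf) lee_fin.
  have h0 : 0 < hi n := lt_trans (lo_gt0 n) (lo_hi n).
  by have := FB _ h0; have := FB _ (lo_gt0 n); lra.
apply: le_lt_trans (ltry B); apply: le_trans le.
rewrite le_eqVlt; apply/orP; left; apply/eqP; apply: eq_integral => t.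
by rewrite inE in_half => t0; rewrite /= ger0_norm // f0.
Qed.

Lemma Rintegral_derivative F f (l0 l1 : R) :
  (forall t, 0 < t -> is_derive t 1 F (f t)) ->
  (forall t, 0 < t -> {for t, continuous f}) ->
  mu.-integrable half (EFin \o f) ->
  F t @[t --> 0^'+] --> l0 -> F t @[t --> +oo%R] --> l1 ->
  Rintegral mu half f = l1 - l0.
Proof.
move=> dF cf intf F0 F1.
have mf := measurable_half cf.
have mh : measurable half by exact: measurable_itv.
have mseg n : measurable (seg n) by exact: measurable_itv.
pose u n : R := F (hi n) - F (lo n).
have uE n : (\int[mu]_(t in half) ((f \_ (seg n)) t)%:E)%E = (u n)%:E.
  rewrite /u -(segment_FTC (lo_gt0 n) (lo_hi n) dF cf) -/(seg n).
  have segE : seg n = half `&` seg n.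
    apply/seteqP; split => t; last by case.
    by move=> h; split => //; rewrite -seg_bigcup; exists n.
  rewrite [in RHS]segE integral_mkcondr; apply: eq_integral => t _.
  by rewrite !patchE; case: ifP.
have c1 : (u n)%:E @[n --> \oo] --> (\int[mu]_(t in half) (f t)%:E)%E.
  under eq_fun do rewrite -uE.
  apply: (@dominated_cvg _ (measurableTypeR R) _ mu half mh _ _ (fun t => `|f t|%:E)) => //.
  - move=> n; apply/measurable_EFinP.
    apply/(measurable_restrict _ (mseg n) mh).
    by apply: measurable_funS mf => // t [].
  - move=> t th; apply: cvg_near_cst.
    have : (\bigcup_n seg n) t by rewrite seg_bigcup.
    move=> [m _ mt]; near=> n.
    have mn : (m <= n)%N by near: n; exact: (nbhs_infty_ge m).
    rewrite patchE ifT // inE.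
    by have := seg_homo mn; rewrite subsetEset; apply.
  - exact: integrable_abse intf.
  - move=> n t _; rewrite lee_fin patchE; case: ifP => // _.
    by rewrite normr0.
have c2 : u n @[n --> \oo] --> l1 - l0.
  apply: cvgB; first exact: cvg_comp hi_cvg F1.
  move/cvg_at_rightP : F0; apply; split=> // n; exact: lo_gt0.
rewrite /Rintegral; have := cvg_unique _ c1 (cvg_EFin (nearW _ _) c2).
by move=> -> //=.
Unshelve. all: by end_near. Qed.

End HalfLine.

Ltac cont := notypeclasses refine (derive_continuous _); der_tac.

(** * Laplace transforms *)

Section Laplace.
Context {R : realType}.
Implicit Types (f F g : R -> R) (a b c t x : R).
Notation mu := (@lebesgue_measure R).
Notation half := (`]0, +oo[%classic : set R).

(** Exponentials beat polynomials. *)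
Lemma poly_le_expR x m : 0 < x -> exists C : R, forall t, 0 <= t -> (1 + t) ^+ m <= C * expR (x * t).
Proof.
move=> x0; pose y : R := x / m.+1%:R.
have y0 : 0 < y by rewrite divr_gt0 // ltr0n.
have iy : 0 < y^-1 by rewrite invr_gt0.
exists ((1 + y^-1) ^+ m) => t t0.
have ymx : y * m%:R <= x.
  by rewrite /y mulrAC ler_pdivrMr ?ltr0n // ler_wpM2l ?ler_nat // ltW.
have s : 1 + t <= (1 + y^-1) * expR (y * t).
  apply: (@le_trans _ _ ((1 + y^-1) * (1 + y * t))).
    have -> : (1 + y^-1) * (1 + y * t) = 1 + t + (y^-1 + y * t) by field; rewrite gt_eqF.
    by rewrite lerDl addr_ge0 ?(ltW iy) // mulr_ge0 // ltW.
  by rewrite ler_wpM2l ?expR_ge1Dx // addr_ge0 // ltW.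
apply: (@le_trans _ _ (((1 + y^-1) * expR (y * t)) ^+ m)).
  by rewrite lerXn2r // ?nnegrE ?addr_ge0 // mulr_ge0 ?expR_ge0 // addr_ge0 // ltW.
rewrite exprMn ler_wpM2l ?exprn_ge0 ?addr_ge0 //; first exact: ltW.
rewrite -expRM_natl ler_expR.
by have := ler_wpM2r t0 ymx; lra.
Qed.


(** Functions with at most an integrable power singularity at the origin and
    polynomial growth: the class on which the Laplace transform and its
    derivatives converge absolutely. *)
Definition tame c g := measurable_fun half g /\
  exists N C, forall t, 0 < t -> `|g t| <= C * (t `^ (c - 1) * (1 + t) ^+ N).

Lemma powR_succ c t : 0 < t -> t `^ c = t `^ (c - 1) * t.
Proof.
move=> t0; have t1 := powRr1 (ltW t0).
have := @powRD _ t (c - 1) 1; rewrite subrK t1 => -> //.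
by rewrite (gt_eqF t0) implybT.
Qed.

(** Powers with a real exponent only ever have to be compared with integral
    powers, for which exponentials are known to win. *)
Lemma powR_le_exprn c t : 0 < c -> 0 < t -> t `^ c <= (1 + t) ^+ (Num.bound c).
Proof.
move=> c0 t0.
apply: (@le_trans _ _ ((1 + t) `^ c)).
  by rewrite ge0_ler_powR // ?nnegrE ?(ltW c0) ?(ltW t0) // ?addr_ge0 ?lerDr // ltW.
rewrite -powR_mulrn ?addr_ge0 // ?(ltW t0) // ler_powR ?lerDl ?(ltW t0) //.
by apply: ltW; apply: archi_boundP; exact: ltW.
Qed.

Lemma continuous_weight c t : 0 < t -> {for t, continuous (fun t : R => t `^ c)}.
Proof. by move=> t0; apply: derive_continuous (is_derive1_powR _ t0). Qed.

(** The integrand is dominated by the derivative of the bounded increasing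
    function [t ^ c / (1 + t ^ c)]. *)
Lemma integrable_weight c x N : 0 < c -> 0 < x ->
  mu.-integrable half (EFin \o (fun t => expR (- (x * t)) * (t `^ (c - 1) * (1 + t) ^+ N))).
Proof.
move=> c0 x0.
pose h (t : R) : R := c * t `^ (c - 1) / (1 + t `^ c) ^+ 2.
have p1 t : 0 < 1 + t `^ c by rewrite ltr_wpDr ?powR_ge0.
have ih : mu.-integrable half (EFin \o h).
  apply: (@integrable_derivative _ (fun t => t `^ c / (1 + t `^ c)) h 1).
  - move=> t t0; have d := is_derive1_powR c t0.
    by rewrite /h; der; [rewrite gt_eqF|field; rewrite gt_eqF].
  - move=> t t0; have d := is_derive1_powR c t0; have d1 := is_derive1_powR (c - 1) t0.
    rewrite /h; cont.
    by rewrite expf_neq0 // gt_eqF.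
  - by move=> t t0; rewrite /h divr_ge0 ?sqr_ge0 // mulr_ge0 ?powR_ge0 // ltW.
  - move=> t t0; rewrite divr_ge0 ?powR_ge0 ?(ltW (p1 t)) //=.
    by rewrite ler_pdivrMr // mul1r lerDr.
pose k := Num.bound c.
have [C hC] := poly_le_expR (N + (k + k)) x0.
have C0 : 0 <= C.
  have := hC 0 (lexx _); rewrite mulr0 expR0 mulr1 addr0 expr1n => C1.
  exact: le_trans C1.
have mh : measurable half by exact: measurable_itv.
apply: (@le_integrable _ (measurableTypeR R) _ mu half mh _ (EFin \o (fun t => (C * 4 / c) * h t))) => //.
- apply/measurable_EFinP; apply: measurable_half => t t0.
  by cont.
- move=> t; rewrite in_half => t0; rewrite /= lee_fin.
  have t1 : 0 < 1 + t by lra.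
  rewrite !ger0_norm; last 2 first.
  + apply: mulr_ge0; first by rewrite divr_ge0 ?(ltW c0) // mulr_ge0.
    by rewrite /h divr_ge0 ?sqr_ge0 // mulr_ge0 ?powR_ge0 // ltW.
  + by rewrite mulr_ge0 ?expR_ge0 // mulr_ge0 ?powR_ge0 // exprn_ge0 // ltW.
  have -> : C * 4 / c * h t = t `^ (c - 1) * (C * 4 / (1 + t `^ c) ^+ 2).
    by rewrite /h; field; rewrite !gt_eqF.
  rewrite mulrCA ler_wpM2l ?powR_ge0 //.
  rewrite ler_pdivlMr ?exprn_gt0 // expRN -mulrA mulrC ler_pdivrMr ?expR_gt0 //.
  have q : (1 + t `^ c) ^+ 2 <= 4 * (1 + t) ^+ (k + k).
    have -> : 4 * (1 + t) ^+ (k + k) = (2 * (1 + t) ^+ k) ^+ 2 by rewrite exprD; ring.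
    rewrite ler_sqr ?nnegrE ?(ltW (p1 t)) ?mulr_ge0 ?exprn_ge0 ?(ltW t1) //.
    have := powR_le_exprn c0 t0; have : 1 <= (1 + t) ^+ k by rewrite exprn_ege1 // lerDl ltW.
    by rewrite -/k; lra.
  apply: (@le_trans _ _ ((1 + t) ^+ N * (4 * (1 + t) ^+ (k + k)))).
    by rewrite ler_wpM2l // exprn_ge0 // ltW.
  rewrite mulrCA -exprD.
  by have := hC t (ltW t0); lra.
- have := @integrableZl _ (measurableTypeR R) _ mu half mh (C * 4 / c) _ ih; exact.
Qed.

Definition laplaceR g x : R := Rintegral mu half (fun t => expR (- (x * t)) * g t).

Lemma tame_integrable c g x : 0 < c -> 0 < x -> tame c g ->
  mu.-integrable half (EFin \o (fun t => expR (- (x * t)) * g t)).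
Proof.
move=> c0 x0 [mg [N [C hC]]].
have mh : measurable half by exact: measurable_itv.
apply: (@le_integrable _ (measurableTypeR R) _ mu half mh _ (EFin \o (fun t => C * (expR (- (x * t)) * (t `^ (c - 1) * (1 + t) ^+ N))))) => //.
- apply/measurable_EFinP; apply: measurable_funM => //.
  apply: measurable_half => t t0; by cont.
- move=> t; rewrite in_half => t0; rewrite /= lee_fin normrM (ger0_norm (expR_ge0 _)).
  apply: le_trans (ler_norm _); rewrite mulrCA ler_wpM2l ?expR_ge0 //; exact: hC.
- have := @integrableZl _ (measurableTypeR R) _ mu half mh C _ (integrable_weight N c0 x0); exact.
Qed.

Lemma tame_mul c g k : tame c g -> tame c (fun t => t ^+ k * g t).
Proof.
move=> [mg [N [C hC]]]; split.
  by apply: measurable_funM => //; apply: measurable_half => t t0;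
    cont.
exists (N + k)%N, C => t t0; rewrite normrM normrX (gtr0_norm t0).
have C0 : 0 <= C * (t `^ (c - 1) * (1 + t) ^+ N) by exact: le_trans (hC t t0).
have -> : C * (t `^ (c - 1) * (1 + t) ^+ (N + k)) =
  (1 + t) ^+ k * (C * (t `^ (c - 1) * (1 + t) ^+ N)) by rewrite exprD; ring.
rewrite ler_pM ?hC ?exprn_ge0 //; first exact: ltW.
by rewrite lerXn2r // ?nnegrE ?addr_ge0 ?lerDr // ltW.
Qed.

Lemma tameD c g g' : tame c g -> tame c g' -> tame c (fun t => g t + g' t).
Proof.
move=> [mg [N [C hC]]] [mg' [N' [C' hC']]]; split; first exact: measurable_funD.
exists (N + N')%N, (`|C| + `|C'|) => t t0.
have t1 : 1 <= 1 + t by rewrite lerDl ltW.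
have w0 : 0 <= t `^ (c - 1) by exact: powR_ge0.
have le1 (M M' : nat) (K : R) : K * (t `^ (c - 1) * (1 + t) ^+ M) <= `|K| * (t `^ (c - 1) * (1 + t) ^+ (M + M')).
  have e0 : 0 <= t `^ (c - 1) * (1 + t) ^+ M by rewrite mulr_ge0 ?exprn_ge0 //; lra.
  apply: le_trans (ler_wpM2r e0 (ler_norm K)) _.
  by rewrite ler_wpM2l // ler_wpM2l // ler_weXn2l // leq_addr.
apply: le_trans (ler_normD _ _) _; rewrite mulrDl lerD //.
  exact: le_trans (hC t t0) (le1 _ _ _).
by rewrite addnC; exact: le_trans (hC' t t0) (le1 _ _ _).
Qed.

Lemma tameZ c g (k : R) : tame c g -> tame c (fun t => k * g t).
Proof.
move=> [mg [N [C hC]]]; split; first exact: measurable_funM.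
by exists N, (`|k| * C) => t t0; rewrite normrM -mulrA ler_wpM2l ?hC.
Qed.

Lemma tame_ext c g g' : (forall t, 0 < t -> g t = g' t) -> tame c g -> tame c g'.
Proof.
move=> gg' [mg [N [C hC]]]; split; last by exists N, C => t t0; rewrite -gg' // hC.
by apply: eq_measurable_fun mg => t; rewrite inE in_half; exact: gg'.
Qed.

Lemma laplaceR_eq g g' x : (forall t, 0 < t -> g t = g' t) -> laplaceR g x = laplaceR g' x.
Proof.
by move=> gg'; apply: eq_Rintegral => t; rewrite inE in_half => /gg' ->.
Qed.

Lemma laplaceRD c g g' x : 0 < c -> 0 < x -> tame c g -> tame c g' ->
  laplaceR (fun t => g t + g' t) x = laplaceR g x + laplaceR g' x.
Proof.
move=> c0 x0 tg tg'; rewrite /laplaceR -RintegralD //; last 2 first.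
- exact: (tame_integrable c0 x0).
- exact: (tame_integrable c0 x0).
by apply: eq_Rintegral => t _; rewrite mulrDr.
Qed.

Lemma laplaceRZ c g k x : 0 < c -> 0 < x -> tame c g -> laplaceR (fun t => k * g t) x = k * laplaceR g x.
Proof.
move=> c0 x0 tg; rewrite /laplaceR -RintegralZl //; last exact: (tame_integrable c0 x0).
by apply: eq_Rintegral => t _; rewrite mulrCA.
Qed.

Lemma laplaceR_le c g g' x : 0 < c -> 0 < x -> tame c g -> tame c g' ->
  (forall t, 0 < t -> `|g t| <= g' t) -> `|laplaceR g x| <= laplaceR g' x.
Proof.
move=> c0 x0 tg tg' gg'; have ig := tame_integrable c0 x0 tg.
apply: le_trans (le_normr_Rintegral _ ig) _ => //.
apply: le_Rintegral => //; [exact: integrable_abse ig|exact: (tame_integrable c0 x0)|].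
move=> t; rewrite in_half => t0; rewrite normrM (ger0_norm (expR_ge0 _)).
by rewrite ler_wpM2l ?expR_ge0 // gg'.
Qed.

(** Differentiation under the integral sign, with the exponential at [x / 2] as
    a uniform bound near [x]. *)
Lemma laplaceR_derive c g x : 0 < c -> 0 < x -> tame c g ->
  is_derive x 1 (laplaceR g) (- laplaceR (fun t => t * g t) x).
Proof.
move=> c0 x0 tg; have tg1 := tame_mul 1 tg.
have mh : measurable half by exact: measurable_itv.
pose f (y t : R) : R := expR (- (y * t)) * g t.
have df (y t : R) : is_derive y 1 (f ^~ t) (- t * expR (- (y * t)) * g t).
  by rewrite /f; der; ring.
pose G (t : R) : R := `|expR (- (x / 2 * t)) * (t ^+ 1 * g t)|.
have x2 : 0 < x / 2 by lra.
have Ix : `]x / 2, 2 * x[%classic x by rewrite /= in_itv /=; lra.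
have intf (y : R) : `]x / 2, 2 * x[%classic y -> mu.-integrable half (EFin \o f y).
  rewrite /= in_itv /= => hy; apply: (tame_integrable c0 _ tg); lra.
have d1 (y t : R) : `]x / 2, 2 * x[%classic y -> half t -> derivable (f ^~ t) y 1.
  by move=> _ _; have [] := df y t.
have G0 (t : R) : 0 <= G t by exact: normr_ge0.
have iG : mu.-integrable half (EFin \o G).
  exact: (integrable_abse (tame_integrable c0 x2 tg1)).
have d1E (y t : R) : partial1of2 f y t = - t * expR (- (y * t)) * g t.
  by rewrite partial1of2E; have [_ ->] := df y t.
have Gub (y t : R) : `]x / 2, 2 * x[%classic y -> half t -> `|partial1of2 f y t| <= G t.
  rewrite in_half /= in_itv /= => /andP[yx _] t0; rewrite d1E /G expr1.
  have -> : - t * expR (- (y * t)) * g t = expR (- (y * t)) * - (t * g t) by ring.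
  rewrite [leLHS]normrM [leRHS]normrM normrN ler_wpM2r //.
  by rewrite !ger0_norm ?expR_ge0 // ler_expR lerN2 ler_wpM2r // ltW.
have D := @derivable_under_integral R _ (measurableTypeR R) mu f half mh x (x / 2) (2 * x) Ix intf d1 G G0 iG Gub.
have E := @differentiation_under_integral R _ (measurableTypeR R) mu f half mh x (x / 2) (2 * x) Ix intf d1 G G0 iG Gub.

apply: DeriveDef; first exact: D.
rewrite -derive1E; apply: etrans E _.
rewrite /laplaceR -mulN1r -RintegralZl //.
  by apply: eq_Rintegral => t _; rewrite d1E; ring.
exact: (tame_integrable c0 x0 tg1).
Qed.

(** Integrating an exact derivative whose primitive vanishes at both ends:
    every integration by parts used below is an instance. *)
Lemma Rintegral_derivative0 c x N C F f : 0 < c -> 0 < x ->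
  (forall t, 0 < t -> is_derive t 1 F (f t)) ->
  (forall t, 0 < t -> {for t, continuous f}) ->
  mu.-integrable half (EFin \o f) ->
  (forall t, 0 < t -> `|F t| <= C * (t `^ c * (1 + t) ^+ N * expR (- (x * t)))) ->
  Rintegral mu half f = 0.
Proof.
move=> c0 x0 dF cf intf FC.
have C0 : 0 <= C.
  have := FC 1 ltr01; rewrite powR1 mul1r => h.
  rewrite -(pmulr_lge0 C (_ : 0 < (1 + 1) ^+ N * expR (- (x * 1)))).
    exact: le_trans h.
  by rewrite mulr_gt0 ?exprn_gt0 ?expR_gt0.
have lim0 : F t @[t --> 0^'+] --> (0 : R).
  apply/norm_cvg0P; apply: (@squeeze_cvgr _ _ _ _ (cst 0) (fun t => C * 2 ^+ N * t `^ c)).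
  - near=> t; have t0 : 0 < t by near: t; exact: nbhs_right_gt.
    have t1 : t < 1 by near: t; exact: nbhs_right_lt.
    rewrite /= normr_ge0 /=; apply: le_trans (FC t t0) _.
    have -> : C * (t `^ c * (1 + t) ^+ N * expR (- (x * t))) =
      C * t `^ c * ((1 + t) ^+ N * expR (- (x * t))) by ring.
    have -> : C * 2 ^+ N * t `^ c = C * t `^ c * (2 ^+ N * 1) by ring.
    rewrite ler_wpM2l ?mulr_ge0 ?powR_ge0 // ler_pM ?exprn_ge0 ?expR_ge0 //; try lra.
      by rewrite lerXn2r // ?nnegrE; lra.
    by rewrite -expR0 ler_expR oppr_le0 mulr_ge0 // ltW.
  - exact: cvg_cst.
  - rewrite -[X in _ --> X](mulr0 (C * 2 ^+ N)); apply: cvgMr; exact: powR_cvg0.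
have lim1 : F t @[t --> +oo%R] --> (0 : R).
  have [K hK] := poly_le_expR (Num.bound c + N + 1) x0.
  apply/norm_cvg0P; apply: (@squeeze_cvgr _ _ _ _ (cst 0) (fun t => C * K * t^-1)).
  - near=> t; have t0 : 0 < t by near: t; exact: nbhs_pinfty_gt.
    rewrite /= normr_ge0 /=; apply: le_trans (FC t t0) _.
    rewrite -[leRHS]mulrA ler_wpM2l // ler_pdivlMr // expRN.
    rewrite mulrAC ler_pdivrMr ?expR_gt0 //; apply: le_trans (hK t (ltW t0)).
    rewrite !exprD expr1 ler_pM ?mulr_ge0 ?powR_ge0 ?exprn_ge0 //; try lra.
    by rewrite ler_wpM2r ?exprn_ge0 ?powR_le_exprn //; lra.
  - exact: cvg_cst.
  - rewrite -[X in _ --> X](mulr0 (C * K)); apply: cvgMr; apply/gtr0_cvgV0; [exact: nbhs_pinfty_gt|exact: cvg_id].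
by rewrite (Rintegral_derivative dF cf intf lim0 lim1) subrr.
Unshelve. all: by end_near. Qed.

End Laplace.

(** * The Gamma function and the leading term at infinity *)

Section GammaMoments.
Context {R : realType}.
Implicit Types (f F g : R -> R) (a b c t x B K : R).
Notation mu := (@lebesgue_measure R).
Notation half := (`]0, +oo[%classic : set R).

Lemma tame_weight c g N B : (forall t, 0 < t -> {for t, continuous g}) ->
  (forall t, 0 < t -> `|g t| <= B * (1 + t) ^+ N) -> tame c (fun t => t `^ (c - 1) * g t).
Proof.
move=> cg gB; split.
  apply: measurable_half => t t0.
  by apply: (@continuousM _ _ (fun t : R => t `^ (c - 1)) g); [exact: continuous_weight|exact: cg].
exists N, B => t t0; rewrite normrM ger0_norm ?powR_ge0 // mulrCA ler_wpM2l ?powR_ge0 //.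
exact: gB.
Qed.

Lemma tame_powR c : tame c (fun t : R => t `^ (c - 1)).
Proof.
apply: (@tame_ext _ _ (fun t => t `^ (c - 1) * 1)); first by move=> t _; rewrite mulr1.
apply: (@tame_weight c (fun=> 1) 0 1) => t t0; first exact: cvg_cst.
by rewrite normr1 expr0 mulr1.
Qed.

Definition laplace_powR c x : R := laplaceR (fun t => t `^ (c - 1)) x.

(** The functional equation of the Gamma function, scaled by [x]. *)
Lemma laplace_powR_succ c x : 0 < c -> 0 < x -> x * laplace_powR (c + 1) x = c * laplace_powR c x.
Proof.
move=> c0 x0; have c1 : 0 < c + 1 by lra.
have t1 := tame_powR c; have t2 := tame_powR (c + 1).
apply/esym/eqP; rewrite -subr_eq0; apply/eqP.
rewrite /laplace_powR -(laplaceRZ _ c0 x0 t1) -(laplaceRZ _ c1 x0 t2).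
have i1 := tame_integrable c0 x0 (tameZ c t1).
have i2 := tame_integrable c1 x0 (tameZ x t2).
rewrite /laplaceR -RintegralB //.
apply: (@Rintegral_derivative0 _ c x 0 1 (fun t => expR (- (x * t)) * t `^ c)) => //.
- move=> t t0; der.
  by rewrite addrK; ring.
- by move=> t t0; cont.
- have mh : measurable half by exact: measurable_itv.
  have := @integrableB _ (measurableTypeR R) _ mu half mh _ _ i1 i2.
  by apply: eq_integrable => // t _; rewrite /= EFinB.
- move=> t t0; rewrite mul1r expr0 mulr1 mulrC ger0_norm //.
  by rewrite mulr_ge0 ?expR_ge0 ?powR_ge0.
Qed.

Lemma laplace_powR_derive c x : 0 < c -> 0 < x -> is_derive x 1 (laplace_powR c) (- laplace_powR (c + 1) x).
Proof.
move=> c0 x0; apply: derive_val_eq (laplaceR_derive c0 x0 (tame_powR c)) _.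
congr (- _); apply: laplaceR_eq => t t0; rewrite addrK [RHS]powR_succ // mulrC //.
Qed.

Lemma laplace_powR_1 c : laplace_powR c 1 = Gamma c.
Proof.
by apply: eq_Rintegral => t _; rewrite mul1r mulrC.
Qed.

(** The left-hand side has derivative [0] in [x], by the functional equation, so
    that no change of variables is needed. *)
Lemma laplace_powRE c x : 0 < c -> 0 < x -> x `^ c * laplace_powR c x = Gamma c.
Proof.
move=> c0 x0; rewrite -laplace_powR_1.
rewrite (_ : laplace_powR c 1 = 1 `^ c * laplace_powR c 1); last by rewrite powR1 mul1r.
have H (y : R) : 0 < y -> is_derive y 1 (fun y => y `^ c * laplace_powR c y) 0.
  move=> y0; have d := laplace_powR_derive c0 y0; der.
  rewrite (powR_succ c y0) mulr1 -mulrA mulrN (laplace_powR_succ c0 y0); ring.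
have [x1|/ltW x1] := leP x 1.
  by apply: (@derive0_cst R (fun y => y `^ c * laplace_powR c y) x 1) => // y hy; apply: H; lra.
by apply/esym; apply: (@derive0_cst R (fun y => y `^ c * laplace_powR c y) 1 x) => // y hy; apply: H; lra.
Qed.

Lemma Gamma_gt0 c : 0 < c -> 0 < Gamma c :> R.
Proof.
move=> c0; rewrite lt_neqAle; apply/andP; split; last first.
  by apply: Rintegral_ge0 => t _; rewrite mulr_ge0 ?powR_ge0 ?expR_ge0.
apply/eqP => G0.
(* On the segment from 1 to 2 the integrand exceeds its minimum, which is
   positive. *)
have i0 := tame_integrable c0 ltr01 (tame_powR c).
have mh : measurable half by exact: measurable_itv.
pose s : set R := `[1, 2]%classic.
have ms : measurable s by exact: measurable_itv.
have sh : s `<=` half by move=> t; rewrite /s /= !in_itv /= => /andP[h _]; rewrite andbT; lra.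
have i1 := @integrableS _ (measurableTypeR R) _ mu half s _ mh ms sh i0.
have cs t : s t -> {for t, continuous (fun t : R => expR (- (1 * t)) * t `^ (c - 1))}.
  by move=> /sh; rewrite in_half => t0; cont.
have mus : mu s = 1%:E.
  by rewrite /s lebesgue_measure_itv /= lte_fin ltr1n /= -EFinB; congr (_%:E); lra.
have s12 : (1 : R) <= 2 by lra.
have [|y hy ymin] := @EVT_min R (fun t => expR (- (1 * t)) * t `^ (c - 1)) 1 2 s12.
  by apply: continuous_in_subspaceT => t; rewrite inE; exact: cs.
have y0 : 0 < y by move: hy; rewrite in_itv /=; lra.
have fy0 : 0 < expR (- (1 * y)) * y `^ (c - 1) by rewrite mulr_gt0 ?expR_gt0 ?powR_gt0.
suff : expR (- (1 * y)) * y `^ (c - 1) <= 0 by rewrite leNgt fy0.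
rewrite G0 -laplace_powR_1 /laplace_powR /laplaceR.
apply: (@le_trans _ _ (Rintegral mu s (fun t => expR (- (1 * t)) * t `^ (c - 1)))).
  apply: (@le_trans _ _ (Rintegral mu s (fun=> expR (- (1 * y)) * y `^ (c - 1)))).
    by rewrite Rintegral_cst // [X in _ * fine X](_ : _ = 1%:E) ?mulr1.
  apply: le_Rintegral => //.
    by apply/integrableP; split; [exact/measurable_EFinP/measurable_cst|];
      rewrite integral_cst //= [X in (_ * X)%E](_ : _ = 1%:E) // -EFinM ltry.
rewrite /Rintegral; apply: fine_le.
- exact: integrable_fin_num.
- exact: integrable_fin_num.
apply: ge0_subset_integral => //.
  by have /integrableP[] := i0.
by move=> t _; rewrite lee_fin mulr_ge0 ?expR_ge0 ?powR_ge0.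
Qed.

(** The leading term of Watson's lemma. *)
Lemma laplaceR_asymptotic c g N B K : 0 < c -> (forall t, 0 < t -> {for t, continuous g}) ->
  (forall t, 0 < t -> `|g t| <= B * (1 + t) ^+ N) ->
  (forall t, 0 < t -> `|g t - 1| <= K * (t + t ^+ 2)) ->
  x `^ c * laplaceR (fun t => t `^ (c - 1) * g t) x / Gamma c @[x --> +oo%R] --> (1 : R).
Proof.
move=> c0 cg gB gK; have G0 := Gamma_gt0 c0.
have tg := tame_weight c cg gB; have tp := tame_powR c.
have c1 : 0 < c + 1 by lra.
have K0 : 0 <= K.
  by have := gK 1 ltr01; rewrite expr1n => h; have := normr_ge0 (g 1 - 1); lra.
have est x : 0 < x ->
  `|x `^ c * laplaceR (fun t => t `^ (c - 1) * g t) x / Gamma c - 1| <= K * (c / x + c * (c + 1) / x ^+ 2).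
  move=> x0; have xc : 0 < x `^ c by rewrite powR_gt0.
  have E : laplaceR (fun t => t `^ (c - 1) * g t) x = laplace_powR c x + laplaceR (fun t => t `^ (c - 1) * (g t - 1)) x.
    have tm : tame c (fun t => t `^ (c - 1) * (g t - 1)).
      apply: tame_ext (tameD tg (tameZ (-1) tp)) => t _; ring.
    rewrite /laplace_powR -(laplaceRD c0 x0 tp tm); apply: laplaceR_eq => t _; ring.
  rewrite E mulrDr laplace_powRE // mulrDl divff ?gt_eqF // addrC addKr.
  rewrite normrM normfV (gtr0_norm G0) ler_pdivrMr // normrM (gtr0_norm xc).
  have tb : tame c (fun t => K * (t ^+ 1 * t `^ (c - 1)) + K * (t ^+ 2 * t `^ (c - 1))).
    by apply: tameD; apply: tameZ; apply: tame_mul.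
  have tm : tame c (fun t => t `^ (c - 1) * (g t - 1)).
    by apply: tame_ext (tameD tg (tameZ (-1) tp)) => t _; ring.
  have le := laplaceR_le c0 x0 tm tb.
  apply: (@le_trans _ _ (x `^ c * (K * laplace_powR (c + 1) x + K * laplace_powR (c + 1 + 1) x))).
    rewrite ler_wpM2l ?(ltW xc) //; apply: le_trans (le _) _.
      move=> t t0; rewrite normrM ger0_norm ?powR_ge0 //.
      have := ler_wpM2l (powR_ge0 t (c - 1)) (gK t t0); rewrite expr1; lra.
    rewrite (laplaceRD c0 x0) ?(laplaceRZ _ c0 x0); try by [do ?apply: tameZ; apply: tame_mul].
    rewrite le_eqVlt; apply/orP; left; apply/eqP; congr (_ * _ + _ * _); apply: laplaceR_eq => t t0.
      by rewrite expr1 addrK [RHS]powR_succ // mulrC.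
    by rewrite addrK [RHS]powR_succ // addrK [in RHS]powR_succ //; ring.
  have g1 : laplace_powR (c + 1) x = c * laplace_powR c x / x by rewrite -(laplace_powR_succ c0 x0) mulrAC divff ?mul1r // gt_eqF.
  have g2 : laplace_powR (c + 1 + 1) x = (c + 1) * laplace_powR (c + 1) x / x.
    by rewrite -(laplace_powR_succ c1 x0) mulrAC divff ?mul1r // gt_eqF.
  rewrite g2 g1 -(laplace_powRE c0 x0) le_eqVlt; apply/orP; left; apply/eqP; field.
  by rewrite gt_eqF.
have inv0 : x^-1 @[x --> +oo%R] --> (0 : R).
  by apply/gtr0_cvgV0; [exact: nbhs_pinfty_gt|exact: cvg_id].
apply/cvgrPdist_le => e e0.
have lim : K * (c * x^-1 + c * (c + 1) * (x^-1 * x^-1)) @[x --> +oo%R] --> (0 : R).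
  rewrite [X in _ --> X](_ : _ = K * (c * 0 + c * (c + 1) * (0 * 0))); last by ring.
  by apply: cvgMr; apply: cvgD; apply: cvgMr => //; exact: cvgM.
move/cvgr0_norm_le : lim => /(_ _ e0) lim.
near=> x; have x0 : 0 < x by near: x; exact: nbhs_pinfty_gt.
rewrite distrC; apply: le_trans (est x x0) _.
have h : `|K * (c * x^-1 + c * (c + 1) * (x^-1 * x^-1))| <= e by near: x.
apply: le_trans h; rewrite -invfM -expr2; exact: ler_norm.
Unshelve. all: by end_near. Qed.

End GammaMoments.

(** * A solution of Whittaker's equation *)

Section LaplaceRepresentations.
Context {R : realType}.
Variables (c tau : R).
Hypothesis c0 : 0 < c.
Implicit Types (t x z : R).
Notation mu := (@lebesgue_measure R).
Notation half := (`]0, +oo[%classic : set R).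
Notation k := (kappa c tau).
Notation phi := (phi c k).
Notation phi1 := (phi1 c k).
Notation phi2 := (phi2 c k).

Let k0 : 0 < k. Proof. exact: kappa_gt0. Qed.

Definition phi_max : R := Num.sqrt (hyp_const c * k).

Lemma phi_le z : 0 <= z -> `|phi z| <= phi_max.
Proof.
move=> z0; rewrite -sqrtr_sqr /phi_max ler_wsqrtr // phi_bound //.
by rewrite /kappa lerDl sqr_ge0.
Qed.

Lemma phi_max_ge0 : 0 <= phi_max. Proof. exact: sqrtr_ge0. Qed.

Lemma phi1_le z : 0 <= z -> `|phi1 z| <= k * phi_max / c.
Proof.
move=> z0; have n0 : - 2^-1 < 0 :> R by lra.
have hz : 0 <= z < z + 1 by lra.
have h := hyp_flux_bound c0 k0 n0 hz (@phi_sol _ c k c0 k0 (z + 1)) (M := phi_max).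
apply: le_trans (h _ z _); last lra.
  by rewrite ler_peMl // lerDl.
by move=> y /andP[y0 _]; exact: phi_le.
Qed.

Lemma phi_derive z : 0 <= z -> is_derive z 1 phi (phi1 z).
Proof. by move=> z0; have [|] := @phi_sol _ c k c0 k0 (z + 1) z; first lra. Qed.

Lemma phi1_derive z : 0 <= z -> is_derive z 1 phi1 (phi2 z).
Proof. by move=> z0; have [|] := @phi_sol _ c k c0 k0 (z + 1) z; first lra. Qed.

Lemma phi_eq z : 0 <= z -> z * (1 + z) * phi2 z + (c + (c + 1) * z) * phi1 z + k * phi z = 0.
Proof. by move=> z0; have [|] := @phi_sol _ c k c0 k0 (z + 1) z; first lra. Qed.

Lemma phi_sub1 z : 0 <= z -> `|phi z - 1| <= k * phi_max / c * z.
Proof.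
move=> z0; rewrite -(phi0 c k) -[in leRHS](subr0 z).
apply: (@derive_bound R phi phi1) => // y hy; first by apply: phi_derive; lra.
by apply: phi1_le; lra.
Qed.

Lemma laplaceR_comb4 (a0 a1 a2 a3 : R) (g0 g1 g2 g3 : R -> R) x : 0 < x ->
  tame c g0 -> tame c g1 -> tame c g2 -> tame c g3 ->
  tame c (fun t => a0 * g0 t + (a1 * g1 t + (a2 * g2 t + a3 * g3 t))) /\
  laplaceR (fun t => a0 * g0 t + (a1 * g1 t + (a2 * g2 t + a3 * g3 t))) x =
  a0 * laplaceR g0 x + (a1 * laplaceR g1 x + (a2 * laplaceR g2 x + a3 * laplaceR g3 x)).
Proof.
move=> x0 t0 t1 t2 t3.
have [s0 s1 s2 s3] := And4 (tameZ a0 t0) (tameZ a1 t1) (tameZ a2 t2) (tameZ a3 t3).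
have s23 := tameD s2 s3; have s123 := tameD s1 s23.
split; first exact: tameD.
by rewrite (laplaceRD c0 x0 s0 s123) (laplaceRD c0 x0 s1 s23) (laplaceRD c0 x0 s2 s3) !(laplaceRZ _ c0 x0).
Qed.

(** Each of these is minus the derivative of the preceding one. *)
Definition uW j x : R := laplaceR (fun t => t ^+ j * (t `^ (c - 1) * phi t)) x.

Lemma tame_phi : tame c (fun t => t `^ (c - 1) * phi t).
Proof.
apply: (@tame_weight _ c phi 0 phi_max) => t t0.
  exact: derive_continuous (phi_derive (ltW t0)).
by rewrite expr0 mulr1 phi_le // ltW.
Qed.

Lemma uW_derive j x : 0 < x -> is_derive x 1 (uW j) (- uW j.+1 x).
Proof.
move=> x0; apply: derive_val_eq (laplaceR_derive c0 x0 (tame_mul j tame_phi)) _.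
by congr (- _); apply: laplaceR_eq => t _; rewrite exprS mulrA.
Qed.

(** [t ^ c (1 + t) phi'] is the natural flux of the hypergeometric equation in
    self-adjoint form; integrating it by parts twice against [expR (- x t)]
    turns the equation for [phi] into an equation in [x]. *)
Lemma uW_ode x : 0 < x ->
  (c * x - k) * uW 0 x + ((c + 1) * x - x ^+ 2) * uW 1 x - x ^+ 2 * uW 2 x = 0.
Proof.
move=> x0.
have [tg E] := laplaceR_comb4 (c * x - k) ((c + 1) * x - x ^+ 2) (- x ^+ 2) 0 x0
  (tame_mul 0 tame_phi) (tame_mul 1 tame_phi) (tame_mul 2 tame_phi) (tame_mul 0 tame_phi).
have -> : (c * x - k) * uW 0 x + ((c + 1) * x - x ^+ 2) * uW 1 x - x ^+ 2 * uW 2 x =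
  (c * x - k) * uW 0 x + (((c + 1) * x - x ^+ 2) * uW 1 x + (- x ^+ 2 * uW 2 x + 0 * uW 0 x)) by ring.
rewrite -E /laplaceR.
apply: (@Rintegral_derivative0 _ c x 1 (k * phi_max / c + x * phi_max)
  (fun t => expR (- (x * t)) * (t `^ c * ((1 + t) * (phi1 t + x * phi t))))) => //.
- move=> t t0; have d0 := phi_derive (ltW t0); have d1 := phi1_derive (ltW t0).
  have e := phi_eq (ltW t0); der.
  have t2 : phi2 t = - ((c + (c + 1) * t) * phi1 t + k * phi t) / (t * (1 + t)).
    have tt : 0 < t * (1 + t) by rewrite mulr_gt0 //; lra.
    apply: (mulfI (_ : t * (1 + t) != 0)); first by rewrite gt_eqF.
    by rewrite mulrCA divff ?gt_eqF // mulr1; move: e; lra.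
  rewrite (powR_succ c t0) t2; field.
  by rewrite !gt_eqF //; lra.
- move=> t t0; have d0 := phi_derive (ltW t0).
  by cont.
- exact: (tame_integrable c0 x0 tg).
- move=> t t0; have t1 : 0 < 1 + t by lra.
  rewrite !normrM (ger0_norm (expR_ge0 _)) (ger0_norm (powR_ge0 _ _)) (gtr0_norm t1) expr1.
  have -> : expR (- (x * t)) * (t `^ c * ((1 + t) * `|phi1 t + x * phi t|)) =
    `|phi1 t + x * phi t| * (t `^ c * (1 + t) * expR (- (x * t))) by ring.
  rewrite ler_wpM2r ?mulr_ge0 ?powR_ge0 ?expR_ge0 ?(ltW t1) //.
  apply: le_trans (ler_normD _ _) _; rewrite [`|x * _|]normrM (gtr0_norm x0).
  by rewrite lerD ?phi1_le ?(ltW t0) // ler_wpM2l ?phi_le // ltW.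
Qed.

(** Whittaker's equation is [w'' = qW w], with [mu = (1 - c) / 2] and
    [nu = i tau]. *)
Definition qW x : R := 1 / 4 - (1 - c) / 2 / x - (1 / 4 + tau ^+ 2) / x ^+ 2.

Notation m := ((1 - c) / 2).

(** The factor in front of the Laplace transform in the formula for [W0]. *)
Definition eW x : R := expR (- x / 2) * x `^ (1 - m) / Gamma c.
Definition W0 x : R := eW x * uW 0 x.
Definition W1 x : R := eW x * ((- 1 / 2 + (1 - m) / x) * uW 0 x - uW 1 x).

Lemma eW_derive x : 0 < x -> is_derive x 1 eW (eW x * (- 1 / 2 + (1 - m) / x)).
Proof.
move=> x0; rewrite /eW; der; rewrite (powR_succ (1 - m) x0).
have G0 := Gamma_gt0 c0; move: (Gamma c) G0 => G G0; field.
by rewrite !gt_eqF.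
Qed.

Lemma W0_derive x : 0 < x -> is_derive x 1 W0 (W1 x).
Proof.
move=> x0; have d1 := eW_derive x0; have d2 := uW_derive 0 x0.
rewrite /W0 /W1; der; ring.
Qed.

Lemma W1_derive x : 0 < x -> is_derive x 1 W1 (qW x * W0 x).
Proof.
move=> x0; have d1 := eW_derive x0; have d2 := uW_derive 0 x0; have d3 := uW_derive 1 x0.
rewrite /W1; der; first by rewrite gt_eqF.
have e := uW_ode x0; rewrite /W0 /qW.
have xn : x != 0 by rewrite gt_eqF.
have u2 : uW 2 x = ((c * x - k) * uW 0 x + ((c + 1) * x - x ^+ 2) * uW 1 x) / x ^+ 2.
  by apply: (mulIf (expf_neq0 2 xn)); rewrite divfK ?expf_neq0 //; move: e; lra.
by rewrite u2 /kappa; field.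
Qed.

Lemma W0_asymptotic : x `^ (- m) * expR (x / 2) * W0 x @[x --> +oo%R] --> (1 : R).
Proof.
have kp : 0 <= k * phi_max / c by rewrite divr_ge0 ?(ltW c0) // mulr_ge0 ?(ltW k0) // phi_max_ge0.
have := @laplaceR_asymptotic R c phi 0 phi_max (k * phi_max / c) c0.
have h1 t : 0 < t -> {for t, continuous phi}.
  by move=> t0; exact: derive_continuous (phi_derive (ltW t0)).
have h2 t : 0 < t -> `|phi t| <= phi_max * (1 + t) ^+ 0.
  by move=> t0; rewrite expr0 mulr1 phi_le // ltW.
have h3 t : 0 < t -> `|phi t - 1| <= k * phi_max / c * (t + t ^+ 2).
  move=> t0; apply: le_trans (phi_sub1 (ltW t0)) _.
  by rewrite ler_wpM2l // lerDl sqr_ge0.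
move=> /(_ h1 h2 h3); apply: cvg_trans; apply: near_eq_cvg.
near=> x; have x0 : 0 < x by near: x; exact: nbhs_pinfty_gt.
have -> : laplaceR (fun t => t `^ (c - 1) * phi t) x = uW 0 x.
  by apply: laplaceR_eq => t _; rewrite expr0 mul1r.
rewrite /W0 /eW mulNr expRN.
have -> : x `^ c = x `^ (- m) * x `^ (1 - m).
  rewrite -powRD; last by rewrite (gt_eqF x0) implybT.
  by congr (_ `^ _); field.
have G0 := Gamma_gt0 c0; have E0 := expR_gt0 (x / 2).
move: (Gamma c) (expR (x / 2)) G0 E0 => G E G0 E0; field.
by rewrite !gt_eqF.
Unshelve. all: by end_near. Qed.

End LaplaceRepresentations.

(** * Uniqueness of the decaying solution *)

Section DecayingSolutions.
Context {R : realType}.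
Variables (c tau : R).
Hypothesis c0 : 0 < c.
Implicit Types (x y : R) (d : R -> R).
Notation q := (qW c tau).
Notation m := ((1 - c) / 2).
Notation W0 := (W0 c tau).
Notation W1 := (W1 c tau).

Lemma qW_bound x a : 0 < a -> a < x ->
  `|q x| <= 1 / 4 + `|m| / a + (1 / 4 + tau ^+ 2) / a ^+ 2.
Proof.
move=> a0 ax; have x0 : 0 < x by lra.
have s0 : 0 <= 1 / 4 + tau ^+ 2 by rewrite addr_ge0 ?sqr_ge0.
apply: le_trans (ler_normB _ _) _; apply: lerD.
  apply: le_trans (ler_normB _ _) _; rewrite ger0_norm // lerD2l normrM.
  by rewrite ler_wpM2l // normfV (gtr0_norm x0) lef_pV2 ?posrE // ltW.
rewrite normrM (ger0_norm s0) ler_wpM2l // ger0_norm ?invr_ge0 ?sqr_ge0 //.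
by rewrite lef_pV2 ?posrE ?exprn_gt0 // lerXn2r // ?nnegrE ltW.
Qed.

(** The normalised solution is positive and bounded near infinity. *)
Lemma W0_near_infty : exists X M : R, [/\ 0 < X, 0 < M & forall x, X <= x -> 0 < W0 x <= M].
Proof.
have [C hC] := @poly_le_expR R (1 / 2) (Num.bound `|m|) ltac:(lra).
have C0 : 0 < C.
  by have := hC 0 (lexx _); rewrite mulr0 expR0 addr0 expr1n mulr1; apply: lt_le_trans.
have lim := W0_asymptotic tau c0.
have : \forall x \near +oo%R, 1 <= x /\ 1 / 2 < x `^ (- m) * expR (x / 2) * W0 x < 2.
  near=> x; split; first by near: x; apply: nbhs_pinfty_ge; exact: num_real.
  apply/andP; split; near: x; [apply: (cvgr_gt 1) => //; lra|apply: (cvgr_lt 1) => //; lra].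
move=> [X [Xr hX]]; exists (Num.max 1 X + 1), (2 * C).
have m1 : 1 <= Num.max 1 X by rewrite le_max lexx.
have mX : X <= Num.max 1 X by rewrite le_max lexx orbT.
split; [lra|lra|move=> x hx].
have [|x1 /andP[hlo hhi]] := hX x; first by lra.
have x0 : 0 < x by lra.
have e0 : 0 < x `^ (- m) * expR (x / 2) by rewrite mulr_gt0 ?powR_gt0 ?expR_gt0.
have W0p : 0 < W0 x by rewrite -(pmulr_rgt0 _ e0); lra.
rewrite W0p /=.
have ge : 1 <= C * (x `^ (- m) * expR (x / 2)).
  have xm : x `^ m <= C * expR (x / 2).
    apply: (@le_trans _ _ (x `^ (Num.bound `|m|)%:R)).
      rewrite ler_powR //; apply: le_trans (ler_norm _) _.
      by apply: ltW; apply: archi_boundP.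
    rewrite powR_mulrn ?(ltW x0) //.
    apply: (@le_trans _ _ ((1 + x) ^+ Num.bound `|m|)).
      by rewrite lerXn2r // ?nnegrE; lra.
    by have := hC x (ltW x0); rewrite [1 / 2 * x]mulrC mulrA mulr1.
  rewrite powRN mulrCA mulrC ler_pdivlMr ?powR_gt0 // mul1r //.
have : W0 x <= W0 x * (C * (x `^ (- m) * expR (x / 2))) by rewrite ler_peMr // ltW.
move/le_trans; apply.
have -> : W0 x * (C * (x `^ (- m) * expR (x / 2))) = C * (x `^ (- m) * expR (x / 2) * W0 x) by ring.
by rewrite [2 * C]mulrC ler_wpM2l ?(ltW C0) // ltW.
Unshelve. all: by end_near. Qed.

(** If the constant Wronskian were positive, the ratio of the two solutions would
    have a derivative bounded below, contrary to its tending to [0]. *)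
Lemma wronskian_le0 d d1 :
  (forall x, 0 < x -> is_derive x 1 d (d1 x)) ->
  (forall x, 0 < x -> is_derive x 1 d1 (q x * d x)) ->
  x `^ (- m) * expR (x / 2) * d x @[x --> +oo%R] --> (0 : R) ->
  forall x, 0 < x -> W0 x * d1 x - W1 x * d x <= 0.
Proof.
move=> dd dd1 lim x x0.
pose w y := W0 y * d1 y - W1 y * d y.
have dw y : 0 < y -> is_derive y 1 w 0.
  move=> y0; have e1 := W0_derive tau c0 y0; have e2 := W1_derive tau c0 y0.
  by have e3 := dd y y0; have e4 := dd1 y y0; rewrite /w; der; ring.
rewrite -/(w x) leNgt; apply/negP => wx0.
have [X [M [X0 M0 hW]]] := W0_near_infty.
have limr : d y / W0 y @[y --> +oo%R] --> (0 : R).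
  rewrite -[X in _ --> X](mul0r (1^-1)).
  have W0' : (y `^ (- m) * expR (y / 2) * W0 y)^-1 @[y --> +oo%R] --> (1^-1 : R).
    by apply: cvgV; [exact: oner_neq0|exact: W0_asymptotic].
  apply: cvg_trans (cvgM lim W0'); apply: near_eq_cvg; near=> y.
  have y0 : 0 < y by near: y; apply: nbhs_pinfty_gt; exact: num_real.
  have yX : X <= y by near: y; apply: nbhs_pinfty_ge; exact: num_real.
  have e0 : y `^ (- m) * expR (y / 2) != 0.
    by rewrite gt_eqF // mulr_gt0 ?powR_gt0 ?expR_gt0.
  have /andP[Wp _] := hW y yX.
  move=> /=; move: (_ `^ _ * _) e0 => e e0; field.
  by rewrite e0 gt_eqF.
have wc y : 0 < y -> w y = w x.
  move=> y0; have [xy|/ltW yx] := leP x y.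
    by apply/esym/(derive0_cst xy) => z hz; apply: dw; lra.
  by apply: (derive0_cst yx) => z hz; apply: dw; lra.
pose e := w x / M ^+ 2.
have e0 : 0 < e by rewrite divr_gt0 // exprn_gt0.
have grow y : X <= y -> d X / W0 X - e * X <= d y / W0 y - e * y.
  move=> Xy; apply: (@derive_ge0_le R (fun y => d y / W0 y - e * y) (fun y => w x / W0 y ^+ 2 - e)) => // z hz.
    have z0 : 0 < z by lra.
    have /andP[Wp _] : 0 < W0 z <= M by apply: hW; lra.
    have e1 := W0_derive tau c0 z0; have e3 := dd z z0.
    der; first by rewrite gt_eqF.
    rewrite -(wc z z0) /w; field; by rewrite gt_eqF.
  have /andP[Wp WM] : 0 < W0 z <= M by apply: hW; lra.
  rewrite subr_ge0 /e ler_wpM2l ?(ltW wx0) // lef_pV2 ?posrE ?exprn_gt0 //.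
  by rewrite lerXn2r // ?nnegrE ltW.
have : \forall y \near +oo%R, [/\ X <= y, `|d y / W0 y| <= 1 & (1 - (d X / W0 X - e * X)) / e < y].
  near=> y; split.
  - by near: y; apply: nbhs_pinfty_ge; exact: num_real.
  - by near: y; apply: cvgr0_norm_le limr _ _.
  - by near: y; apply: nbhs_pinfty_gt; exact: num_real.
move=> [Y [Yr hY]]; have [|Xy d1y] := hY (Y + 1); first lra.
rewrite ltr_pdivrMr // => ey; have := grow _ Xy; have := ler_norm (d (Y + 1) / W0 (Y + 1)).
lra.
Unshelve. all: by end_near. Qed.

(** A solution of smaller order than the normalised one has zero Wronskian with
    it, hence is proportional to it near infinity, hence vanishes. *)
Lemma decaying_zero d d1 :
  (forall x, 0 < x -> is_derive x 1 d (d1 x)) ->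
  (forall x, 0 < x -> is_derive x 1 d1 (q x * d x)) ->
  x `^ (- m) * expR (x / 2) * d x @[x --> +oo%R] --> (0 : R) ->
  forall x, 0 < x -> d x = 0.
Proof.
move=> dd dd1 lim x x0.
have wz y : 0 < y -> W0 y * d1 y - W1 y * d y = 0.
  move=> y0; apply: le_anti; rewrite (wronskian_le0 dd dd1 lim) //=.
  have := @wronskian_le0 (fun y => - d y) (fun y => - d1 y) _ _ _ y y0.
  have -> : W0 y * - d1 y - W1 y * - d y = - (W0 y * d1 y - W1 y * d y) by ring.
  rewrite oppr_le0; apply.
  - by move=> z z0; have := dd z z0 => ?; der.
  - by move=> z z0; have := dd1 z z0 => ?; der; ring.
  - rewrite -[X in _ --> X]oppr0; apply: cvg_trans (cvgN lim).
    by apply: near_eq_cvg; apply: nearW => z; rewrite fctE mulrN.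
have [X [M [X0 M0 hW]]] := W0_near_infty.
have ratio y : X <= y -> d y / W0 y = d X / W0 X.
  move=> Xy; apply/esym/(@derive0_cst R (fun y => d y / W0 y) X y Xy) => z hz.
  have z0 : 0 < z by lra.
  have /andP[Wp _] : 0 < W0 z <= M by apply: hW; lra.
  have e1 := W0_derive tau c0 z0; have e3 := dd z z0.
  der; first by rewrite gt_eqF.
  have -> : d z * (- W0 z ^- 2 * W1 z) + (W0 z)^-1 * d1 z = (W0 z * d1 z - W1 z * d z) / W0 z ^+ 2.
    by field; rewrite gt_eqF.
  by rewrite wz // mul0r.
have r0 : d X / W0 X = 0.
  have l1 : x `^ (- m) * expR (x / 2) * d x @[x --> +oo%R] --> d X / W0 X.
    rewrite -[X in _ --> X]mulr1.
    apply: cvg_trans (cvgMr (W0_asymptotic tau c0)).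
    apply: near_eq_cvg; near=> y; have Xy : X <= y by near: y; apply: nbhs_pinfty_ge; exact: num_real.
    have /andP[Wp _] := hW y Xy.
    by rewrite -(ratio y Xy); field; rewrite gt_eqF.
  exact: (cvg_unique _ l1 lim).
have dz y : X <= y -> d y = 0.
  move=> Xy; have := ratio y Xy; rewrite r0 => /eqP; rewrite mulf_eq0 invr_eq0.
  by have /andP[Wp _] := hW y Xy; rewrite (gt_eqF Wp) orbF => /eqP.
have d1z : d1 (X + 1) = 0.
  have X10 : 0 < X + 1 by lra.
  apply: (derive_unique (dd _ X10)).
  apply: (@derive_near R (fun=> 0) _ _ _ 1) => // t; rewrite ltr_norml => ht.
  by rewrite dz //; lra.
pose a := Num.min (x / 2) (X / 2).
have a0 : 0 < a by rewrite lt_min !divr_gt0.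
have [ax aX] : a <= x / 2 /\ a <= X / 2 by rewrite !ge_min !lexx orbT.
pose K := 1 / 4 + `|m| / a + (1 / 4 + tau ^+ 2) / a ^+ 2.
have pos y : a < y < x + X + 2 -> 0 < y by lra.
apply: (@ode2_zero R d d1 (fun y => q y * d y) a (x + X + 2) K (X + 1)) => //.
- by move=> y /pos; exact: dd.
- by move=> y /pos; exact: dd1.
- move=> y /andP[ay _]; rewrite normrM.
  have h := qW_bound a0 ay; rewrite -/K in h.
  apply: (@le_trans _ _ (K * `|d y|)); first by rewrite ler_wpM2r.
  rewrite ler_wpM2l ?lerDl //; exact: le_trans h.
- lra.
- by apply: dz; lra.
- lra.
Unshelve. all: by end_near. Qed.

End DecayingSolutions.

(** * The product formula *)

Section ProductFormula.
Context {R : realType}.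
Variables (c tau : R).
Hypothesis c0 : 0 < c.
Implicit Types (t x y : R).
Notation mu := (@lebesgue_measure R).
Notation half := (`]0, +oo[%classic : set R).
Notation k := (kappa c tau).
Notation phi := (phi c k).
Notation phi1 := (phi1 c k).
Notation phi2 := (phi2 c k).
Notation q := (qW c tau).
Notation m := ((1 - c) / 2).
Notation W0 := (W0 c tau).
Notation W1 := (W1 c tau).
Notation phi_max := (phi_max c tau).

Let k0 : 0 < k. Proof. exact: kappa_gt0. Qed.

Lemma tame_mul1 g j : tame c g -> tame c (fun t => (1 + t) ^+ j * g t).
Proof.
move=> [mg [N [C hC]]]; split.
  by apply: measurable_funM => //; apply: measurable_half => t t0; cont.
exists (N + j)%N, C => t t0; have t1 : 0 < 1 + t by lra.
rewrite normrM normrX (gtr0_norm t1).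
have -> : C * (t `^ (c - 1) * (1 + t) ^+ (N + j)) =
  (1 + t) ^+ j * (C * (t `^ (c - 1) * (1 + t) ^+ N)) by rewrite exprD; ring.
by rewrite ler_wpM2l ?hC // exprn_ge0 // ltW.
Qed.

(** The kernel of the Olevskii transform. *)
Definition psi t : R := phi (t ^+ 2 + 2 * t).
Definition psi1 t : R := phi1 (t ^+ 2 + 2 * t) * (2 * (1 + t)).
Definition psi2 t : R := phi2 (t ^+ 2 + 2 * t) * (2 * (1 + t)) ^+ 2 + 2 * phi1 (t ^+ 2 + 2 * t).

Let arg_ge0 t : 0 < t -> 0 <= t ^+ 2 + 2 * t.
Proof. by move=> t0; rewrite addr_ge0 ?sqr_ge0 // mulr_ge0 // ltW. Qed.

Let arg_derive t : is_derive t 1 (fun t => t ^+ 2 + 2 * t) (2 * (1 + t)).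
Proof. by der; rewrite /=; ring. Qed.

Lemma psi_derive t : 0 < t -> is_derive t 1 psi (psi1 t).
Proof.
move=> t0; exact: (der_comp (g := fun t => t ^+ 2 + 2 * t) (phi_derive tau c0 (arg_ge0 t0))).
Qed.

Lemma psi1_derive t : 0 < t -> is_derive t 1 psi1 (psi2 t).
Proof.
move=> t0; rewrite /psi1 /psi2.
have d := der_comp (g := fun t => t ^+ 2 + 2 * t) (phi1_derive tau c0 (arg_ge0 t0)) (arg_derive t).
by der; ring.
Qed.

Lemma psi_eq t : 0 < t -> t * (t + 2) * (1 + t) * psi2 t
  + (2 * c * (1 + t) ^+ 2 + t * (t + 2)) * psi1 t + 4 * k * (1 + t) * psi t = 0.
Proof.
move=> t0; have := phi_eq tau c0 (arg_ge0 t0); rewrite /psi2 /psi1 /psi.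
move: (phi2 _) (phi1 _) (phi _) => A B C H.
rewrite -[RHS](mulr0 (4 * (1 + t))) -[in RHS]H; ring.
Qed.

Lemma psi_le t : 0 < t -> `|psi t| <= phi_max.
Proof. by move=> /arg_ge0; exact: phi_le. Qed.

Lemma psi1_le t : 0 < t -> `|psi1 t| <= 2 * (k * phi_max / c) * (1 + t).
Proof.
move=> t0; have t1 : 0 < 2 * (1 + t) by lra.
rewrite /psi1 normrM (gtr0_norm t1).
have := ler_wpM2r (ltW t1) (phi1_le tau c0 (arg_ge0 t0)); lra.
Qed.

(** Since [expR (- x) * expR (- (x * t)) = expR (- (x * (1 + t)))], each of these
    is minus the derivative of the preceding one. *)
Definition uV j x : R := expR (- x) * laplaceR (fun t => (1 + t) ^+ j * (t `^ (c - 1) * psi t)) x.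

Lemma tame_psi : tame c (fun t => t `^ (c - 1) * psi t).
Proof.
apply: (@tame_weight _ c psi 0 phi_max) => t t0.
  exact: derive_continuous (psi_derive t0).
by rewrite expr0 mulr1 psi_le.
Qed.

Lemma uV_derive j x : 0 < x -> is_derive x 1 (uV j) (- uV j.+1 x).
Proof.
move=> x0; have tj := tame_mul1 j tame_psi; have d := laplaceR_derive c0 x0 tj.
rewrite /uV; der.
have -> : laplaceR (fun t => (1 + t) ^+ j.+1 * (t `^ (c - 1) * psi t)) x =
  laplaceR (fun t => (1 + t) ^+ j * (t `^ (c - 1) * psi t)) x +
  laplaceR (fun t => t * ((1 + t) ^+ j * (t `^ (c - 1) * psi t))) x.
  rewrite -(laplaceRD c0 x0 tj); last exact: (tame_mul 1 tj).
  by apply: laplaceR_eq => t _; rewrite exprS; ring.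
ring.
Qed.

(** The equation of [psi] has cubic coefficients, so that two integrations by
    parts against [expR (- x t)] give an equation of order three in [x]. *)
Lemma uV_ode x : 0 < x ->
  x ^+ 2 * uV 3 x - 3 * x * uV 2 x
  - (x ^+ 2 - 4 * m * x - 4 * (1 / 4 + tau ^+ 2)) * uV 1 x + (x - 2 * m) * uV 0 x = 0.
Proof.
move=> x0; have t_ j := tame_mul1 j tame_psi.
pose a1 := x ^+ 2 - 4 * m * x - 4 * (1 / 4 + tau ^+ 2).
have [tg E] := laplaceR_comb4 c0 (- (x - 2 * m)) a1 (3 * x) (- x ^+ 2) x0 (t_ 0%N) (t_ 1%N) (t_ 2%N) (t_ 3%N).
set S := laplaceR _ x in E.
have S0 : S = 0; last first.
  move: E; rewrite S0 /a1 /uV => /esym; move: (laplaceR _ x) (laplaceR _ x) (laplaceR _ x) (laplaceR _ x) => A0 A1 A2 A3 E.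
  rewrite -[RHS](mulr0 (- expR (- x))) -[in RHS]E; ring.
rewrite /S /laplaceR.
pose B1 := k * phi_max / c.
have B0 := phi_max_ge0 c tau.
have B10 : 0 <= B1 by rewrite /B1 divr_ge0 ?(ltW c0) // mulr_ge0 // ltW.
apply: (@Rintegral_derivative0 _ c x 3 (4 * B1 + (2 * x + `|c - 1|) * phi_max)
  (fun t => expR (- (x * t)) * (t `^ c * ((1 + t) * ((t + 2) * psi1 t + (x * (t + 2) + (c - 1)) * psi t))))) => //.
- move=> t t0; have d0 := psi_derive t0; have d1 := psi1_derive t0.
  have e := psi_eq t0; der.
  have t2 : psi2 t = - ((2 * c * (1 + t) ^+ 2 + t * (t + 2)) * psi1 t + 4 * k * (1 + t) * psi t)
      / (t * (t + 2) * (1 + t)).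
    have tt : 0 < t * (t + 2) * (1 + t) by rewrite !mulr_gt0 //; lra.
    apply: (mulfI (_ : t * (t + 2) * (1 + t) != 0)); first by rewrite gt_eqF.
    by rewrite mulrCA divff ?gt_eqF // mulr1; move: e; lra.
  rewrite (powR_succ c t0) t2 /a1 /kappa; field.
  by rewrite !gt_eqF //; lra.
- move=> t t0; have d0 := psi_derive t0.
  by cont.
- exact: (tame_integrable c0 x0 tg).
- move=> t t0; have t1 : 1 < 1 + t by lra.
  have t1' : 0 < 1 + t by lra.
  rewrite normrM (ger0_norm (expR_ge0 _)) [`|t `^ c * _|]normrM (ger0_norm (powR_ge0 _ _)).
  rewrite [`|(1 + t) * _|]normrM (gtr0_norm t1').
  set Z := _ + _ * psi t.
  have ZB : `|Z| <= (4 * B1 + (2 * x + `|c - 1|) * phi_max) * (1 + t) ^+ 2.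
    apply: le_trans (ler_normD _ _) _; rewrite [leRHS]mulrDl; apply: lerD.
      rewrite normrM gtr0_norm; last by lra.
      apply: (@le_trans _ _ ((2 * (1 + t)) * (2 * B1 * (1 + t)))).
        by apply: ler_pM => //; [lra|lra|exact: psi1_le].
      by rewrite le_eqVlt; apply/orP; left; apply/eqP; ring.
    rewrite [`|_ * psi t|]normrM.
    have h1 : `|x * (t + 2) + (c - 1)| <= (2 * x + `|c - 1|) * (1 + t).
      apply: le_trans (ler_normD _ _) _; rewrite [leRHS]mulrDl; apply: lerD.
        rewrite ger0_norm; first by have : 0 < x * t by [exact: mulr_gt0]; lra.
        by rewrite mulr_ge0 ?(ltW x0) //; lra.
      by rewrite ler_peMr // ltW.
    apply: (@le_trans _ _ ((2 * x + `|c - 1|) * (1 + t) * phi_max)).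
      by apply: ler_pM => //; exact: psi_le.
    have h2 : 0 <= (2 * x + `|c - 1|) * phi_max * (1 + t).
      by rewrite !mulr_ge0 ?addr_ge0 ?mulr_ge0 // ltW.
    have := ler_wpM2l h2 (ltW t1); lra.
  have -> : expR (- (x * t)) * (t `^ c * ((1 + t) * `|Z|)) =
    `|Z| * (t `^ c * (1 + t) * expR (- (x * t))) by ring.
  have w0 : 0 <= t `^ c * (1 + t) * expR (- (x * t)).
    by rewrite mulr_ge0 ?expR_ge0 // mulr_ge0 ?powR_ge0 // ltW.
  by apply: le_trans (ler_wpM2r w0 ZB) _; rewrite le_eqVlt; apply/orP; left; apply/eqP; ring.
Qed.

(** The right-hand side of the product formula and its derivatives; the third
    one is written as the equation of squares prescribes. *)
Definition V0 x : R := x * uV 0 x / Gamma c.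
Definition V1 x : R := (uV 0 x - x * uV 1 x) / Gamma c.
Definition V2 x : R := (x * uV 2 x - 2 * uV 1 x) / Gamma c.
Definition qW1 x : R := m / x ^+ 2 + 2 * (1 / 4 + tau ^+ 2) / x ^+ 3.
Definition V3 x : R := 4 * q x * V1 x + 2 * qW1 x * V0 x.

Lemma V0_derive x : 0 < x -> is_derive x 1 V0 (V1 x).
Proof. by move=> x0; have d := uV_derive 0 x0; rewrite /V0 /V1; der; ring. Qed.

Lemma V1_derive x : 0 < x -> is_derive x 1 V1 (V2 x).
Proof.
move=> x0; have d := uV_derive 0 x0; have d' := uV_derive 1 x0.
by rewrite /V1 /V2; der; ring.
Qed.

Lemma V2_derive x : 0 < x -> is_derive x 1 V2 (V3 x).
Proof.
move=> x0; have d := uV_derive 2 x0; have d' := uV_derive 1 x0.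
have xn : x != 0 by rewrite gt_eqF.
have G0 := Gamma_gt0 c0.
have e : uV 3 x = (3 * x * uV 2 x
  + (x ^+ 2 - 4 * m * x - 4 * (1 / 4 + tau ^+ 2)) * uV 1 x - (x - 2 * m) * uV 0 x) / x ^+ 2.
  by apply: (mulIf (expf_neq0 2 xn)); rewrite divfK ?expf_neq0 //; have := uV_ode x0; lra.
rewrite /V2 /V3 /V1 /V0 /qW /qW1; der; rewrite e.
move: (Gamma c) G0 => G G0; field.
by rewrite xn gt_eqF.
Qed.

(** For any [V] with [V''' = 4 q V' + 2 q' V], the combination [V' W - 2 V W']
    solves the equation of [W]. *)
Definition cross x : R := V1 x * W0 x - 2 * V0 x * W1 x.
Definition cross1 x : R := V2 x * W0 x - V1 x * W1 x - 2 * V0 x * (q x * W0 x).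

Lemma qW_derive x : 0 < x -> is_derive x 1 q (qW1 x).
Proof.
move=> x0; have xn : x != 0 by rewrite gt_eqF.
by rewrite /qW /qW1; der => //; rewrite ?expf_neq0 //=; field.
Qed.

Lemma cross_derive x : 0 < x -> is_derive x 1 cross (cross1 x).
Proof.
move=> x0; have d0 := V0_derive x0; have d1 := V1_derive x0.
have e0 := W0_derive tau c0 x0; have e1 := W1_derive tau c0 x0.
by rewrite /cross /cross1; der; ring.
Qed.

Lemma cross1_derive x : 0 < x -> is_derive x 1 cross1 (q x * cross x).
Proof.
move=> x0; have d0 := V0_derive x0; have d1 := V1_derive x0; have d2 := V2_derive x0.
have e0 := W0_derive tau c0 x0; have e1 := W1_derive tau c0 x0; have dq := qW_derive x0.
by rewrite /cross /cross1; der; rewrite /V3; ring.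
Qed.

(** The exponential decreases in [x]. *)
Lemma laplaceR_bounded g : tame c g -> exists K, forall x, 1 <= x -> `|laplaceR g x| <= K.
Proof.
move=> tg; exists (Rintegral mu half (fun t => `|expR (- (1 * t)) * g t|)) => x x1.
have x0 : 0 < x by lra.
have i1 := tame_integrable c0 ltr01 tg; have ix := tame_integrable c0 x0 tg.
have mh : measurable half by exact: measurable_itv.
apply: le_trans (le_normr_Rintegral _ ix) _ => //.
apply: le_Rintegral => //.
- exact: integrable_abse ix.
- exact: integrable_abse i1.
- move=> t; rewrite in_half => t0; rewrite !normrM ler_wpM2r //.
  by rewrite !ger0_norm ?expR_ge0 // ler_expR lerN2 ler_wpM2r // ltW.
Qed.

(** Up to powers of [x], [V0] and [V1] are at most of order [expR (- x)], and [W0]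
    and [W1] at most of order [expR (- x / 2)]: after the normalisation a factor
    [expR (- x)] is left over. *)
Lemma cross_decay : x `^ (- m) * expR (x / 2) * cross x @[x --> +oo%R] --> (0 : R).
Proof.
have G0 := Gamma_gt0 c0.
have tW j := tame_mul j (tame_phi tau c0).
have [A hA] := laplaceR_bounded (tW 0%N); have [A' hA'] := laplaceR_bounded (tW 1%N).
have [B hB] := laplaceR_bounded (tame_mul1 0 tame_psi).
have [B' hB'] := laplaceR_bounded (tame_mul1 1 tame_psi).
have pos K (f : R -> R) : (forall x, 1 <= x -> `|f x| <= K) -> 0 <= K.
  by move=> h; apply: le_trans (h 1 (lexx _)).
have [A0 A0' B0 B0'] := And4 (pos _ _ hA) (pos _ _ hA') (pos _ _ hB) (pos _ _ hB').
pose n := Num.bound c.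
pose Z := ((B + B') * A + 2 * B * ((1 / 2 + `|1 - m|) * A + A')) / (Gamma c * Gamma c).
have Z0 : 0 <= Z.
  rewrite divr_ge0 ?mulr_ge0 ?(ltW G0) // addr_ge0 // ?mulr_ge0 ?addr_ge0 ?mulr_ge0 ?addr_ge0 //; lra.
have [C hC] := @poly_le_expR R 1 (n + 2) ltr01.
have est x : 1 <= x -> `|x `^ (- m) * expR (x / 2) * cross x| <= Z * C * x^-1.
  move=> x1; have x0 : 0 < x by lra.
  have hW : x `^ (- m) * expR (x / 2) * eW c x = x `^ c / Gamma c.
    rewrite /eW mulNr expRN.
    have -> : x `^ c = x `^ (- m) * x `^ (1 - m).
      rewrite -powRD; last by rewrite (gt_eqF x0) implybT.
      by congr (_ `^ _); field.
    have E0 := expR_gt0 (x / 2); move: (Gamma c) (expR (x / 2)) G0 E0 => G E ? E0.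
    by field; rewrite !gt_eqF.
  pose a := uW c tau 0 x; pose a' := uW c tau 1 x.
  pose b := laplaceR (fun t => (1 + t) ^+ 0 * (t `^ (c - 1) * psi t)) x.
  pose b' := laplaceR (fun t => (1 + t) ^+ 1 * (t `^ (c - 1) * psi t)) x.
  have -> : x `^ (- m) * expR (x / 2) * cross x =
    (expR (- x) * x `^ c) * (((b - x * b') * a - 2 * (x * b) * ((- 1 / 2 + (1 - m) / x) * a - a')) / (Gamma c * Gamma c)).
    rewrite /cross /V1 /V0 /W0 /W1 /uV -/a -/a' -/b -/b'.
    have -> : forall e1 e2 u v w z, e1 * e2 * (u * (eW c x * v) - w * (eW c x * z)) = e1 * e2 * eW c x * (u * v - w * z) by move=> *; ring.
    rewrite hW; move: (Gamma c) G0 => G ?; field.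
    by rewrite !gt_eqF.
  have E0 : 0 <= expR (- x) * x `^ c by rewrite mulr_ge0 ?expR_ge0 ?powR_ge0.
  rewrite normrM (ger0_norm E0).
  have num : `|((b - x * b') * a - 2 * (x * b) * ((- 1 / 2 + (1 - m) / x) * a - a')) / (Gamma c * Gamma c)| <= Z * x.
    rewrite normrM normfV (gtr0_norm (mulr_gt0 G0 G0)) /Z [leRHS]mulrAC.
    rewrite ler_wpM2r ?invr_ge0 ?mulr_ge0 ?(ltW G0) //.
    have [ha ha' hb hb'] := And4 (hA x x1) (hA' x x1) (hB x x1) (hB' x x1).
    rewrite -/a in ha; rewrite -/a' in ha'; rewrite -/b in hb; rewrite -/b' in hb'.
    have s1 : `|b - x * b'| <= (B + B') * x.
      apply: le_trans (ler_normB _ _) _; rewrite normrM (gtr0_norm x0).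
      have := ler_wpM2l (ltW x0) hb'; have := ler_wpM2l B0 x1; lra.
    have s2 : `|(- 1 / 2 + (1 - m) / x) * a - a'| <= (1 / 2 + `|1 - m|) * A + A'.
      apply: le_trans (ler_normB _ _) _; apply: lerD => //; rewrite normrM; apply: ler_pM => //.
      apply: le_trans (ler_normD _ _) _; apply: lerD; first by rewrite mulN1r normrN ger0_norm //; lra.
      rewrite normrM normfV (gtr0_norm x0) ler_pdivrMr // ler_peMr //.
    apply: le_trans (ler_normB _ _) _; rewrite [leRHS]mulrDl; apply: lerD.
      by rewrite normrM mulrAC; apply: ler_pM.
    have -> : 2 * B * ((1 / 2 + `|1 - m|) * A + A') * x = (2 * (x * B)) * ((1 / 2 + `|1 - m|) * A + A') by ring.
    rewrite normrM; apply: ler_pM => //.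
    by rewrite !normrM (gtr0_norm x0) ger0_norm // ler_wpM2l // ler_wpM2l // ltW.
  apply: le_trans (ler_wpM2l E0 num) _.
  rewrite ler_pdivlMr //.
  have -> : expR (- x) * x `^ c * (Z * x) * x = Z * (x `^ c * x ^+ 2 / expR x) by rewrite expRN; ring.
  rewrite ler_wpM2l // ler_pdivrMr ?expR_gt0 //.
  have := hC x (ltW x0); rewrite mul1r; apply: le_trans.
  rewrite exprD; apply: ler_pM; rewrite ?powR_ge0 ?sqr_ge0 //; first exact: powR_le_exprn.
  by rewrite lerXn2r // ?nnegrE; lra.
apply/norm_cvg0P; apply: (@squeeze_cvgr _ _ _ _ (cst 0) (fun x => Z * C * x^-1)).
- near=> x; have x1 : 1 <= x by near: x; apply: nbhs_pinfty_ge; exact: num_real.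
  by rewrite /= normr_ge0 /=; exact: est.
- exact: cvg_cst.
- rewrite -[X in _ --> X](mulr0 (Z * C)); apply: cvgMr.
  by apply/gtr0_cvgV0; [exact: nbhs_pinfty_gt|exact: cvg_id].
Unshelve. all: by end_near. Qed.

Lemma cross_eq0 x : 0 < x -> cross x = 0.
Proof. exact: (decaying_zero c0 cross_derive cross1_derive cross_decay). Qed.

Lemma V0_asymptotic : x `^ (- m) ^+ 2 * expR (x / 2) ^+ 2 * V0 x @[x --> +oo%R] --> (1 : R).
Proof.
have kp : 0 <= k * phi_max / c.
  by rewrite divr_ge0 ?(ltW c0) // mulr_ge0 ?(ltW k0) // phi_max_ge0.
have h1 t : 0 < t -> {for t, continuous psi}.
  by move=> t0; exact: derive_continuous (psi_derive t0).
have h2 t : 0 < t -> `|psi t| <= phi_max * (1 + t) ^+ 0.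
  by move=> t0; rewrite expr0 mulr1 psi_le.
have h3 t : 0 < t -> `|psi t - 1| <= 2 * (k * phi_max / c) * (t + t ^+ 2).
  move=> t0; apply: le_trans (phi_sub1 tau c0 (arg_ge0 t0)) _.
  have := mulr_ge0 kp (sqr_ge0 t); lra.
apply: cvg_trans (laplaceR_asymptotic c0 h1 h2 h3); apply: near_eq_cvg.
near=> x; have x0 : 0 < x by near: x; apply: nbhs_pinfty_gt; exact: num_real.
rewrite /V0 /uV.
have -> : laplaceR (fun t => (1 + t) ^+ 0 * (t `^ (c - 1) * psi t)) x = laplaceR (fun t => t `^ (c - 1) * psi t) x.
  by apply: laplaceR_eq => t _; rewrite expr0 mul1r.
have -> : expR (- x) = expR (x / 2) ^- 2.
  by rewrite -expRM_natl -expRN; congr expR; field.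
have -> : x `^ c = x `^ (- m) ^+ 2 * x.
  have x1 := powRr1 (ltW x0).
  rewrite -powR_mulrn ?powR_ge0 // -powRrM -[X in _ * X]x1 -powRD; last by rewrite (gt_eqF x0) implybT.
  by congr (_ `^ _); field.
have E0 := expR_gt0 (x / 2); have G0 := Gamma_gt0 c0.
move: (Gamma c) (expR (x / 2)) G0 E0 => G E G0 E0; field.
by rewrite !gt_eqF.
Unshelve. all: by end_near. Qed.

(** The product formula: the Laplace transform of [t ^ (c - 1) psi t] is the
    square of the decaying solution. The vanishing of [cross] makes the two sides
    proportional near infinity, and both satisfy the same linear equation of
    order three. *)
Lemma V0_sqr x : 0 < x -> V0 x = W0 x ^+ 2.
Proof.
move=> x0.
have [X [M [X0 M0 hW]]] := W0_near_infty tau c0.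
have ratio y : X <= y -> V0 y / W0 y ^+ 2 = V0 X / W0 X ^+ 2.
  move=> Xy; apply/esym/(@derive0_cst R (fun y => V0 y / W0 y ^+ 2) X y Xy) => z hz.
  have z0 : 0 < z by lra.
  have /andP[Wp _] : 0 < W0 z <= M by apply: hW; lra.
  have e1 := W0_derive tau c0 z0; have e3 := V0_derive z0.
  der; first by rewrite gt_eqF // exprn_gt0.
  have := cross_eq0 z0; rewrite /cross => e; rewrite /=.
  have -> : V1 z = 2 * V0 z * W1 z / W0 z.
    by apply: (mulIf (lt0r_neq0 Wp)); rewrite divfK ?gt_eqF //; lra.
  by field; rewrite gt_eqF.
have r1 : V0 X / W0 X ^+ 2 = 1.
  have l1 : x `^ (- m) ^+ 2 * expR (x / 2) ^+ 2 * V0 x @[x --> +oo%R] --> V0 X / W0 X ^+ 2.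
    rewrite [X in _ --> X](_ : _ = V0 X / W0 X ^+ 2 * (1 * 1)); last by rewrite !mulr1.
    apply: cvg_trans (cvgMr (cvgM (W0_asymptotic tau c0) (W0_asymptotic tau c0))).
    apply: near_eq_cvg; near=> y.
    have Xy : X <= y by near: y; apply: nbhs_pinfty_ge; exact: num_real.
    have /andP[Wp _] := hW y Xy.
    by rewrite /= -(ratio y Xy); field; rewrite gt_eqF.
  exact: (cvg_unique _ l1 V0_asymptotic).
pose A y := V0 y - W0 y ^+ 2.
pose A1 y := V1 y - 2 * W0 y * W1 y.
pose A2 y := V2 y - (2 * W1 y ^+ 2 + 2 * q y * W0 y ^+ 2).
pose A3 y := 4 * q y * A1 y + 2 * qW1 y * A y.
have dA y : 0 < y -> is_derive y 1 A (A1 y).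
  by move=> y0; have e1 := W0_derive tau c0 y0; have e3 := V0_derive y0;
    rewrite /A /A1; der; rewrite /=; ring.
have dA1 y : 0 < y -> is_derive y 1 A1 (A2 y).
  move=> y0; have e1 := W0_derive tau c0 y0; have e2 := W1_derive tau c0 y0.
  by have e3 := V1_derive y0; rewrite /A1 /A2; der; rewrite /=; ring.
have dA2 y : 0 < y -> is_derive y 1 A2 (A3 y).
  move=> y0; have e1 := W0_derive tau c0 y0; have e2 := W1_derive tau c0 y0.
  have dq := qW_derive y0.
  by have e3 := V2_derive y0; rewrite /A2 /A3 /A1 /A; der; rewrite /= /V3; ring.
have A0 y : X <= y -> A y = 0.
  move=> Xy; have := ratio y Xy; rewrite r1 /A => e.
  have /andP[Wp _] := hW y Xy.
  by rewrite -[V0 y](divfK (_ : W0 y ^+ 2 != 0)) ?expf_neq0 ?gt_eqF // e mul1r subrr.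
have zero_der (f f' : R -> R) : (forall y, 0 < y -> is_derive y 1 f (f' y)) ->
    (forall y, X < y -> f y = 0) -> forall y, X < y -> f' y = 0.
  move=> df fz y Xy; have y0 : 0 < y by lra.
  apply: (derive_unique (df _ y0)).
  apply: (@derive_near R (fun=> 0) _ _ _ (y - X)); first by rewrite subr_gt0.
  by move=> t; rewrite ltr_norml => ht; rewrite fz //; lra.
have A1z := zero_der _ _ dA (fun y Xy => A0 y (ltW Xy)).
have A2z := zero_der _ _ dA1 A1z.
suff : A x = 0 by rewrite /A => /eqP; rewrite subr_eq0 => /eqP.
pose a := Num.min (x / 2) (X / 2).
have a0 : 0 < a by rewrite lt_min !divr_gt0.
have [ax aX] : a <= x / 2 /\ a <= X / 2 by rewrite !ge_min !lexx orbT.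
pose K := 1 / 4 + `|m| / a + (1 / 4 + tau ^+ 2) / a ^+ 2.
pose K1 := `|m| / a ^+ 2 + 2 * (1 / 4 + tau ^+ 2) / a ^+ 3.
have s0 : 0 <= 1 / 4 + tau ^+ 2 by rewrite addr_ge0 ?sqr_ge0.
have K0 : 0 <= K by rewrite !addr_ge0 ?divr_ge0 ?sqr_ge0 // ltW.
have K10 : 0 <= K1 by rewrite !addr_ge0 ?divr_ge0 ?mulr_ge0 ?exprn_ge0 // ltW.
have q1b y : a < y -> `|qW1 y| <= K1.
  move=> ay; have y0 : 0 < y by lra.
  have ip n : (y ^+ n)^-1 <= (a ^+ n)^-1.
    by rewrite lef_pV2 ?posrE ?exprn_gt0 // lerXn2r // ?nnegrE ltW.
  apply: le_trans (ler_normD _ _) _; apply: lerD; rewrite normrM.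
    by rewrite ler_wpM2l // ger0_norm ?invr_ge0 ?sqr_ge0.
  rewrite (ger0_norm (mulr_ge0 _ s0)) // ler_wpM2l ?mulr_ge0 //.
  by rewrite ger0_norm ?invr_ge0 // exprn_ge0 // ltW.
have pos y : a < y < x + X + 2 -> 0 < y by lra.
apply: (@ode3_zero R A A1 A2 A3 a (x + X + 2) (4 * K + 2 * K1) (X + 1)) => //.
- by move=> y /pos; exact: dA.
- by move=> y /pos; exact: dA1.
- by move=> y /pos; exact: dA2.
- move=> y /andP[ay _]; have h := qW_bound c tau a0 ay; have h' := q1b y ay.
  rewrite -/K in h.
  apply: le_trans (ler_normD _ _) _; rewrite !normrM !(ger0_norm (ler0n _ _)).
  have v0 := normr_ge0 (A y); have v1 := normr_ge0 (A1 y); have v2 := normr_ge0 (A2 y).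
  have p1 := ler_wpM2r v1 h; have p2 := ler_wpM2r v0 h'.
  have p3 := mulr_ge0 K0 v0; have p4 := mulr_ge0 K10 v1.
  have p5 := mulr_ge0 K0 v2; have p6 := mulr_ge0 K10 v2.
  lra.
- lra.
- by apply: A0; lra.
- by apply: A1z; lra.
- by apply: A2z; lra.
- lra.
Unshelve. all: by end_near. Qed.

End ProductFormula.

(** * Identification of the Whittaker function *)

Section WhittakerIdentification.
Context {R : realType}.
Variables (c tau : R).
Hypothesis c0 : 0 < c.
Notation q := (qW c tau).
Notation m := ((1 - c) / 2).
Notation W0 := (W0 c tau).
Notation W1 := (W1 c tau).
Notation nu := (0 +i* tau).

(** The square of an imaginary parameter is real, so that the real and the
    imaginary part of a solution solve the real equation separately. *)
Lemma whittaker_coef (x : R) : 0 < x ->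
  - 4^-1 + (m / x)%:C + (4^-1 - nu ^+ 2) / (x ^+ 2)%:C = (- q x)%:C :> R[i].
Proof.
move=> x0; have -> : nu ^+ 2 = (- tau ^+ 2)%:C :> R[i].
  by apply: complexP; rewrite expr2 /=; ring.
have -> : 4^-1 = (4^-1)%:C :> R[i] by rewrite CV Cnat.
rewrite -CV -[- (4^-1)%:C](rmorphN (real_complex R)) -[_ - (- tau ^+ 2)%:C](rmorphB (real_complex R)) -CM -!CD.
by congr (_%:C); rewrite /qW /=; field; rewrite gt_eqF.
Qed.

Lemma W0_is_whittakerW : is_whittakerW m nu (fun x => (W0 x)%:C).
Proof.
split.
  exists (fun x => (W1 x)%:C), (fun x => (q x * W0 x)%:C) => x x0; split.
  - by split; [exact: W0_derive|exact: der_cst].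
  - by split; [exact: W1_derive|exact: der_cst].
  - by rewrite whittaker_coef // -CM -CD mulNr subrr.
split=> /=.
  apply: cvg_trans (W0_asymptotic tau c0); apply: near_eq_cvg; apply: nearW => x.
  by rewrite /cRe Re_Cmul.
by apply: cvg_near_cst; apply: nearW => x; rewrite /cIm Im_Cmul mulr0.
Qed.

Lemma is_whittakerW_unique w x : is_whittakerW m nu w -> 0 < x -> w x = (W0 x)%:C.
Proof.
move=> [[w1 [w2 H]] [lR lI]] x0.
have w2E y : 0 < y -> w2 y = (q y)%:C * w y.
  move=> y0; have [_ _ /eqP] := H y y0; rewrite whittaker_coef // addr_eq0 => /eqP ->.
  by rewrite [(- q y)%:C](rmorphN (real_complex R)) mulNr opprK.
apply: complexP => /=.
  apply/eqP; rewrite -subr_eq0; apply/eqP.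
  apply: (@decaying_zero R c tau c0 (fun y => complex.Re (w y) - W0 y)
    (fun y => complex.Re (w1 y) - W1 y)) => //.
  - move=> y y0; have [[d _] _ _] := H y y0; have d' := W0_derive tau c0 y0.
    by rewrite /cRe in d; der.
  - move=> y y0; have [_ [d _] _] := H y y0; have d' := W1_derive tau c0 y0.
    by rewrite /cRe in d; der; rewrite w2E // Re_Cmul; ring.
  - rewrite -[X in _ --> X](subrr 1); apply: cvg_trans (cvgB lR (W0_asymptotic tau c0)).
    apply: near_eq_cvg; apply: nearW => y.
    rewrite mulrBr -Re_Cmul; reflexivity.
apply: (@decaying_zero R c tau c0 (fun y => complex.Im (w y)) (fun y => complex.Im (w1 y))) => //.
- by move=> y y0; have [[_ d] _ _] := H y y0.
- by move=> y y0; have [_ [_ d] _] := H y y0; rewrite w2E // Im_Cmul in d.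
- apply: cvg_trans lI; apply: near_eq_cvg; apply: nearW => y.
  by rewrite /= /cIm Im_Cmul.
Qed.

Lemma whittakerWE x : 0 < x -> whittakerW m nu x = (W0 x)%:C.
Proof.
move=> x0; apply: is_whittakerW_unique => //.
exact: (@xgetPex (R -> R[i]) (fun=> 0) [set w | is_whittakerW m nu w] (ex_intro _ _ W0_is_whittakerW)).
Qed.

Lemma whittakerW_sqr x : 0 < x ->
  whittakerW m nu x ^+ 2 =
  (x * expR (- x) / Gamma c * laplaceR (fun t => t `^ (c - 1) * psi c tau t) x)%:C.
Proof.
move=> x0; rewrite whittakerWE // -CX -V0_sqr // /V0 /uV; congr (_%:C).
rewrite (laplaceR_eq (g' := fun t => t `^ (c - 1) * psi c tau t)); first by ring.
by move=> t _; rewrite expr0 mul1r.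
Qed.

End WhittakerIdentification.

(** * Exchange of the integrations *)

Section JointMeasurability.
Context {R : realType}.
Variable c : R.
Hypothesis c0 : 0 < c.

(** The coefficients are polynomials in [kappa]. *)
Lemma measurable_pfaff n : measurable_fun setT (fun tau => (pfaff2 c (kappa c tau) n).1) /\
  measurable_fun setT (fun tau => (pfaff2 c (kappa c tau) n).2).
Proof.
have mk : measurable_fun setT (kappa c).
  by apply: measurable_funD => //; exact: measurable_funX.
elim: n => [|n [ih1 ih2]]; first by split; exact: measurable_cst.
have me : measurable_fun setT (fun tau => (pfaff2 c (kappa c tau) n.+1).2).
  have -> : (fun tau => (pfaff2 c (kappa c tau) n.+1).2) =
    (fun tau => ((n%:R - 1) ^+ 2 * (pfaff2 c (kappa c tau) n).2
       - (1 + c + kappa c tau) * (pfaff2 c (kappa c tau) n).1) / (n.+1%:R * (n%:R + c))).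
    by apply/funext => tau /=; case: (pfaff2 _ _ _).
  apply: measurable_funM => //; apply: measurable_funB; first exact: measurable_funM.
  by apply: measurable_funM => //; exact: measurable_funD.
split=> //.
have -> : (fun tau => (pfaff2 c (kappa c tau) n.+1).1) =
  (fun tau => (pfaff2 c (kappa c tau) n).1 + (pfaff2 c (kappa c tau) n.+1).2).
  by apply/funext => tau /=; case: (pfaff2 _ _ _).
exact: measurable_funD.
Qed.

(** [psi c tau t] with [t] replaced by its positive part: the power series
    then converges everywhere, and its sum is measurable on the whole plane. *)
Definition psi_plus (p : R * R) : R := psi c p.1 (Num.max p.2 0).

Lemma psi_plusE tau t : 0 < t -> psi_plus (tau, t) = psi c tau t.
Proof. by move=> t0; rewrite /psi_plus /= max_l // ltW. Qed.

Lemma measurable_psi_plus : measurable_fun setT psi_plus.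
Proof.
pose Z (t : R) : R := Num.max t 0 ^+ 2 + 2 * Num.max t 0.
have mmax : measurable_fun setT (fun t : R => Num.max t 0) by exact: measurable_maxr.
have mZ : measurable_fun setT Z.
  by apply: measurable_funD; [exact: measurable_funX|exact: measurable_funM].
have Z0 t : 0 <= Z t.
  have h : 0 <= Num.max t 0 by rewrite le_max lexx orbT.
  by rewrite addr_ge0 ?sqr_ge0 // mulr_ge0.
pose Y t : R := Z t / (1 + Z t).
have mY : measurable_fun setT Y.
  apply: measurable_funM => //.
  have minv : measurable_fun (`]0, +oo[%classic : set R) (fun y : R => y^-1).
    by apply: measurable_half => t t0; cont; rewrite gt_eqF.
  have mg : measurable_fun setT (fun t : R => 1 + Z t) by exact: measurable_funD.
  apply: (measurable_comp _ _ minv mg) => //.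
  by move=> _ [t _ <-]; rewrite /= in_itv /= andbT ltr_wpDr.
apply: (@measurable_fun_cvg _ _ _ setT (fun n p => \sum_(0 <= i < n) pfaff c (kappa c p.1) i * Y p.2 ^+ i)) => //.
  move=> n; apply: measurable_sum => i.
  apply: measurable_funM.
    by apply: (measurableT_comp (measurable_pfaff i).1); exact: measurable_fst.
  apply: measurable_funX; apply: (measurableT_comp mY); exact: measurable_snd.
move=> [tau t] _ /=.
have k0 := kappa_gt0 tau c0.
apply: (radius_cvg (pfaff_radius c0 k0)); apply: pfaff_var.
by apply: lt_le_trans (Z0 t); rewrite oppr_lt0 invr_gt0.
Qed.

End JointMeasurability.

Section Exchange.
Context {R : realType}.
Variable c : R.
Hypothesis c0 : 0 < c.
Notation mu := (@lebesgue_measure R).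
Notation half := (`]0, +oo[%classic : set R).

(** The factor [c ^ 2 / 4 + 1] makes [kappa] at most this factor times
    [(1 + tau) ^ 2]. *)
Definition kernel_bound : R := Num.sqrt (hyp_const c * (c ^+ 2 / 4 + 1)).

Lemma hyp_const_ge0 : 0 <= hyp_const c.
Proof. by rewrite /hyp_const !mulr_ge0 ?addr_ge0 ?mulr_ge0 ?invr_ge0 // ltW. Qed.

Lemma phi_max_le tau : 0 < tau -> phi_max c tau <= kernel_bound * (1 + tau).
Proof.
move=> tau0; rewrite /phi_max /kernel_bound.
have t1 : 0 <= 1 + tau by lra.
rewrite -[1 + tau]ger0_norm // -sqrtr_sqr -sqrtrM; last first.
  by rewrite mulr_ge0 ?hyp_const_ge0 // addr_ge0 // divr_ge0 ?sqr_ge0.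
apply: ler_wsqrtr; rewrite -[leRHS]mulrA ler_wpM2l ?hyp_const_ge0 // /kappa.
have : 0 <= c ^+ 2 by exact: sqr_ge0.
move: (c ^+ 2) => C C0.
have := mulr_ge0 C0 (ltW tau0); have := mulr_ge0 C0 (sqr_ge0 tau); have := sqr_ge0 tau.
by rewrite sqrrD; lra.
Qed.

(** The only integrability of [f] that the kernel demands: it grows at most
    linearly in the index. *)
Definition admissible (f : R -> R) :=
  measurable_fun half f /\ mu.-integrable half (EFin \o (fun tau => (1 + tau) * f tau)).

Definition index_kernel tau x : R := laplaceR (fun t => t `^ (c - 1) * psi c tau t) x.

Definition olevskii (f : R -> R) t : R := Rintegral mu half (fun tau => psi c tau t * f tau).

Let mh : measurable half. Proof. exact: measurable_itv. Qed.

Lemma measurable_psi t : 0 < t -> measurable_fun half (fun tau => psi c tau t).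
Proof.
move=> t0; have m := measurable_psi_plus c0.
have m2 : measurable_fun setT (fun tau : R => psi_plus c (tau, t)).
  by apply: (measurableT_comp m); exact: measurable_pair2.
apply: eq_measurable_fun (measurable_funTS m2) => tau _.
by rewrite psi_plusE.
Qed.

Lemma psi_bound tau t : 0 < tau -> 0 < t -> `|psi c tau t| <= kernel_bound * (1 + tau).
Proof. by move=> tau0 t0; apply: le_trans (psi_le tau c0 t0) (phi_max_le tau0). Qed.

Lemma olevskii_integrable f t : 0 < t -> admissible f ->
  mu.-integrable half (EFin \o (fun tau => psi c tau t * f tau)).
Proof.
move=> t0 [mf intf].
apply: (@le_integrable _ (measurableTypeR R) _ mu half mh _
  (EFin \o (fun tau => kernel_bound * ((1 + tau) * f tau)))).
- apply/measurable_EFinP; apply: measurable_funM => //.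
  exact: measurable_psi.
- move=> tau; rewrite in_half => tau0; rewrite /= lee_fin normrM.
  rewrite mulrA [leRHS]normrM ler_wpM2r // (le_trans (psi_bound tau0 t0)) // ler_norm //.
- have := @integrableZl _ (measurableTypeR R) _ mu half mh kernel_bound _ intf; exact.
Qed.

Lemma olevskii_bound f t : 0 < t -> admissible f ->
  `|olevskii f t| <= kernel_bound * Rintegral mu half (fun tau => (1 + tau) * `|f tau|).
Proof.
move=> t0 af; have [mf intf] := af; have io := olevskii_integrable t0 af.
apply: le_trans (le_normr_Rintegral _ io) _ => //.
have ia : mu.-integrable half (EFin \o (fun tau => (1 + tau) * `|f tau|)).
  apply: eq_integrable (integrable_abse intf) => // tau; rewrite inE in_half => tau0.
  by rewrite /= normrM ger0_norm // addr_ge0 // ltW.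
rewrite -RintegralZl //; apply: le_Rintegral => //.
- exact: integrable_abse io.
- have := @integrableZl _ (measurableTypeR R) _ mu half mh kernel_bound _ ia; exact.
- move=> tau; rewrite in_half => tau0; rewrite normrM mulrA ler_wpM2r //.
  exact: psi_bound.
Qed.

Section FixedPoint.
Variables (x : R) (f : R -> R).
Hypotheses (x0 : 0 < x) (af : admissible f).

Let h : R -> R := f \_ half.
Let g : R -> R := (fun t => expR (- (x * t)) * t `^ (c - 1)) \_ half.
Let H (p : measurableTypeR R * measurableTypeR R) : R := h p.1 * (g p.2 * psi_plus c p).

Let mhf : measurable_fun setT h.
Proof. by apply/(measurable_restrictT _ mh); case: af. Qed.

Let ig : mu.-integrable setT (EFin \o g).
Proof.
have i := tame_integrable c0 x0 (tame_powR c).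
have := (@integrable_mkcond _ (measurableTypeR R) _ mu half _ mh).1 i.
by rewrite restrict_EFin.
Qed.

Let mg : measurable_fun setT g.
Proof. by have /integrableP[/measurable_EFinP] := ig. Qed.

Let mH : measurable_fun setT H.
Proof.
apply: measurable_funM; first by apply: (measurableT_comp mhf); exact: measurable_fst.
apply: measurable_funM; first by apply: (measurableT_comp mg); exact: measurable_snd.
exact: measurable_psi_plus.
Qed.

Let g_ge0 t : 0 <= g t.
Proof. by rewrite /g patchE; case: ifP => // _; rewrite mulr_ge0 ?expR_ge0 ?powR_ge0. Qed.

Let A : R -> R := (fun tau => kernel_bound * ((1 + tau) * f tau)) \_ half.

Let iA : mu.-integrable setT (EFin \o A).
Proof.
case: af => _ intf.
have i := @integrableZl _ (measurableTypeR R) _ mu half mh kernel_bound _ intf.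
have := (@integrable_mkcond _ (measurableTypeR R) _ mu half _ mh).1 i.
have -> : (fun x : measurableTypeR R => (kernel_bound%:E * (EFin \o (fun tau : R => ((1 + tau) * f tau)%R)) x)%E)
  = EFin \o (fun tau => kernel_bound * ((1 + tau) * f tau)) by [].
by rewrite restrict_EFin.
Qed.

Let H_le tau t : `|H (tau, t)| <= `|A tau| * g t.
Proof.
rewrite /H /A /h /= !patchE; case: ifP; last by rewrite mul0r normr0 mul0r.
rewrite inE in_half => tau0; rewrite normrM mulrC [`|g t * _|]normrM (ger0_norm (g_ge0 t)).
rewrite -mulrA mulrC ler_wpM2r ?g_ge0 // mulrA [leRHS]normrM ler_wpM2r //.
apply: le_trans (ler_norm _); rewrite /psi_plus /=.
apply: le_trans (phi_max_le tau0); rewrite /psi; apply: phi_le => //.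
have : 0 <= Num.max t 0 by rewrite le_max lexx orbT.
by move=> m0; rewrite addr_ge0 ?sqr_ge0 // mulr_ge0.
Qed.

Let iH : (mu \x mu)%E.-integrable setT (EFin \o H).
Proof.
have mEH : measurable_fun setT (EFin \o H) by exact/measurable_EFinP.
apply/(integrable12ltyP mu mu mEH).
have /integrableP[/measurable_EFinP mA fA] := iA.
pose G := (\int[mu]_t (g t)%:E)%E.
have G0 : (0 <= G)%E by apply: integral_ge0 => t _; rewrite lee_fin.
have Gfin : G \is a fin_num by apply: integrable_fin_num.
have le1 tau : (\int[mu]_t `|(H (tau, t))%:E| <= `|(A tau)%:E| * G)%E.
  rewrite /G -ge0_integralZl //; last 2 first.
  - exact/measurable_EFinP.
  - by move=> t _; rewrite lee_fin.
  apply: ge0_le_integral => //.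
  - apply/measurableT_comp => //; apply/measurable_EFinP.
    by apply: (measurableT_comp mH); exact: measurable_pair1.
  - by apply/measurable_EFinP; exact: measurable_funM.
  - by move=> t _; rewrite -EFinM lee_fin H_le.
apply: le_lt_trans (_ : (\int[mu]_tau (`|(A tau)%:E| * G) < +oo)%E).
  apply: ge0_le_integral => //.
  - by move=> tau _; apply: integral_ge0.
  - apply: (@measurable_fun_fubini_tonelli_F _ _ _ _ _ mu (abse \o (EFin \o H))) => //.
      exact: measurableT_comp.
    by move=> p; exact: abse_ge0.
  - under eq_fun do rewrite muleC; apply: measurable_funeM.
    by apply: measurableT_comp => //; exact/measurable_EFinP.
  - by move=> tau _; exact: le1.
rewrite ge0_integralZr //; last by apply: measurableT_comp => //; exact/measurable_EFinP.
by rewrite muleC lte_mul_pinfty.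
Qed.

Let F_E tau : (\int[mu]_t (H (tau, t))%:E)%E = (((fun tau => index_kernel tau x * f tau) \_ half) tau)%:E.
Proof.
rewrite patchE; case: ifPn => tauh; last first.
  rewrite integral0_eq // => t _; rewrite /H /h /= patchE (negbTE tauh) mul0r //.
have tau0 : 0 < tau by move: tauh; rewrite inE in_half.
have tp := tame_psi tau c0.
have i := tame_integrable c0 x0 tp.
have i2 := @integrableZl _ (measurableTypeR R) _ mu half mh (f tau) _ i.
transitivity (\int[mu]_(t in half) (f tau * (expR (- (x * t)) * (t `^ (c - 1) * psi c tau t)))%:E)%E.
  rewrite [RHS]integral_mkcond; apply: eq_integral => t _.
  rewrite /H /h /g /= !patchE tauh; case: ifPn => th; last by rewrite mul0r mulr0.
  have t0 : 0 < t by move: th; rewrite inE in_half.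
  by rewrite psi_plusE //; congr (_%:E); ring.
rewrite /index_kernel mulrC /laplaceR -RintegralZl // /Rintegral fineK //.
by apply: integrable_fin_num => //; exact: i2.
Qed.

Let G_E t : (\int[mu]_tau (H (tau, t))%:E)%E =
  (((fun t => expR (- (x * t)) * (t `^ (c - 1) * olevskii f t)) \_ half) t)%:E.
Proof.
rewrite patchE; case: ifPn => th; last first.
  by rewrite integral0_eq // => tau _; rewrite /H /g /= [in X in _ * (X * _)]patchE (negbTE th) mul0r mulr0.
have t0 : 0 < t by move: th; rewrite inE in_half.
have i := olevskii_integrable t0 af.
have i2 := @integrableZl _ (measurableTypeR R) _ mu half mh (expR (- (x * t)) * t `^ (c - 1)) _ i.
transitivity (\int[mu]_(tau in half) (expR (- (x * t)) * t `^ (c - 1) * (psi c tau t * f tau))%:E)%E.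
  rewrite [RHS]integral_mkcond; apply: eq_integral => tau _.
  rewrite /H /h /g /= !patchE th; case: ifPn => tauh; last by rewrite mul0r.
  by rewrite psi_plusE //; congr (_%:E); ring.
rewrite mulrA /olevskii -RintegralZl // /Rintegral fineK //.
by apply: integrable_fin_num => //; exact: i2.
Qed.

Lemma index_kernel_integrable : mu.-integrable half (EFin \o (fun tau => index_kernel tau x * f tau)).
Proof.
apply/(@integrable_mkcond _ (measurableTypeR R) _ mu half _ mh).
rewrite restrict_EFin; have := integrable_fubini_F iH.
by apply: eq_integrable => // tau _; exact: F_E.
Qed.

Lemma measurable_olevskii_laplace :
  measurable_fun half (fun t => expR (- (x * t)) * (t `^ (c - 1) * olevskii f t)).
Proof.
apply/(measurable_restrictT _ mh)/measurable_EFinP.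
apply: eq_measurable_fun (measurable_fubini_G iH) => t _; exact: G_E.
Qed.

(** Fubini's theorem, for the function that vanishes off the quadrant. *)
Lemma index_laplace :
  Rintegral mu half (fun tau => index_kernel tau x * f tau) = laplaceR (fun t => t `^ (c - 1) * olevskii f t) x.
Proof.
rewrite Rintegral_mkcond /laplaceR [RHS]Rintegral_mkcond /Rintegral; congr fine.
transitivity (\int[mu]_tau \int[mu]_t (EFin \o H) (tau, t))%E.
  by apply: eq_integral => tau _; rewrite -F_E.
by rewrite (Fubini iH); apply: eq_integral => t _; rewrite -G_E.
Qed.

End FixedPoint.

Lemma tame_olevskii f : admissible f -> tame c (fun t => t `^ (c - 1) * olevskii f t).
Proof.
move=> af; split.
  have mm := measurable_olevskii_laplace ltr01 af.
  have : measurable_fun half (fun t => expR (1 * t) * (expR (- (1 * t)) * (t `^ (c - 1) * olevskii f t))).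
    by apply: measurable_funM => //; apply: measurable_half => t t0; cont.
  by apply: eq_measurable_fun => t _; rewrite expRN mulVKf // gt_eqF // expR_gt0.
exists 0%N, (kernel_bound * Rintegral mu half (fun tau => (1 + tau) * `|f tau|)) => t t0.
rewrite normrM expr0 mulr1 ger0_norm ?powR_ge0 // mulrC ler_wpM2r ?powR_ge0 //.
exact: olevskii_bound.
Qed.

Lemma index_laplace_bound f x : 0 < x -> admissible f ->
  `|laplaceR (fun t => t `^ (c - 1) * olevskii f t) x| <=
  kernel_bound * Rintegral mu half (fun tau => (1 + tau) * `|f tau|) * laplace_powR c x.
Proof.
move=> x0 af.
have tp := tameZ (kernel_bound * Rintegral mu half (fun tau => (1 + tau) * `|f tau|)) (tame_powR c).
rewrite /laplace_powR -(laplaceRZ _ c0 x0 (tame_powR c)).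
apply: (laplaceR_le c0 x0 (tame_olevskii af) tp) => t t0.
rewrite normrM ger0_norm ?powR_ge0 // mulrC ler_wpM2r ?powR_ge0 //.
exact: olevskii_bound.
Qed.

Lemma admissibleD f g : admissible f -> admissible g -> admissible (fun tau => f tau + g tau).
Proof.
move=> [mf intf] [mg' intg]; split; first exact: measurable_funD.
have := @integrableD _ (measurableTypeR R) _ mu half mh _ _ intf intg.
by apply: eq_integrable => // tau _; rewrite /= -EFinD mulrDr.
Qed.

Lemma admissibleZ f a : admissible f -> admissible (fun tau => a * f tau).
Proof.
move=> [mf intf]; split; first exact: measurable_funM.
have := @integrableZl _ (measurableTypeR R) _ mu half mh a _ intf.
by apply: eq_integrable => // tau _; rewrite /= -EFinM mulrCA.
Qed.

End Exchange.

(** * The transforms of complex-valued functions *)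

Section Assembly.
Context {R : realType}.
Variables (mu delta : R).
Hypotheses (hmu : mu < 1 / 2) (hdelta : delta < pi / 2).
Notation leb := (@lebesgue_measure R).
Notation half := (`]0, +oo[%classic : set R).
Notation c := (1 - 2 * mu).
Notation w := (index_weight mu delta).
Implicit Types (f : R -> R[i]) (u v : R -> R).

Let c0 : 0 < c. Proof. by have := hmu; lra. Qed.

Let mh : measurable half. Proof. exact: measurable_itv. Qed.

Let G0 : 0 < Gamma c. Proof. exact: Gamma_gt0. Qed.

Lemma index_weight_gt0 tau : 0 < tau -> 0 < w tau.
Proof. by move=> t0; rewrite mulr_gt0 ?expR_gt0 // powR_gt0 //; lra. Qed.

(** Since [delta < pi / 2] the weight grows exponentially, so it dominates the
    linear growth of the kernel in the index. *)
Lemma weight_dominates : exists C : R, 0 < C /\ forall tau, 0 < tau -> 1 + tau <= C * w tau.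
Proof.
have e0 : 0 < pi - 2 * delta by have := hdelta; lra.
pose n := Num.bound c.
have [C hC] := @poly_le_expR R (pi - 2 * delta) n e0.
exists C; split.
  by have := hC 0 (lexx _); rewrite mulr0 expR0 addr0 expr1n mulr1; apply: lt_le_trans.
move=> tau t0; have t1 : 0 < tau + 1 by lra.
have x1 := powRr1 (ltW t1).
have E : 1 + tau = (tau + 1) `^ c * (tau + 1) `^ (2 * mu).
  rewrite -powRD; last by rewrite (gt_eqF t1) implybT.
  by rewrite subrK x1 addrC.
rewrite E /index_weight mulrA ler_wpM2r ?powR_ge0 //.
apply: le_trans (hC tau (ltW t0)).
rewrite [1 + tau]addrC -powR_mulrn ?(ltW t1) // ler_powR; first by [].
  by rewrite lerDr ltW.
by apply: ltW; apply: archi_boundP; exact: ltW.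
Qed.

Lemma L1w_admissible u : leb.-integrable half (EFin \o (fun tau => w tau * u tau)) ->
  admissible u.
Proof.
move=> iu; have /integrableP[/measurable_EFinP mwu _] := iu.
have mu' : measurable_fun half u.
  have m1 : measurable_fun half (fun tau => (w tau)^-1 * (w tau * u tau)).
    apply: measurable_funM => //; apply: measurable_half => t t0.
    have t1 : 0 < t + 1 by lra.
    rewrite /index_weight; cont.
    by rewrite gt_eqF // mulr_gt0 ?expR_gt0 ?powR_gt0.
  apply: eq_measurable_fun m1 => t; rewrite inE in_half => t0.
  by rewrite mulKf // gt_eqF // index_weight_gt0.
split=> //; have [C [C0 hC]] := weight_dominates.
apply: (@le_integrable _ (measurableTypeR R) _ leb half mh _
  (EFin \o (fun tau => C * (w tau * u tau)))).
- apply/measurable_EFinP; apply: measurable_funM => //.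
  by apply: measurable_half => t t0; cont.
- move=> t; rewrite in_half => t0; rewrite /= lee_fin mulrA normrM [leRHS]normrM ler_wpM2r //.
  rewrite [leRHS]ger0_norm; last by rewrite mulr_ge0 // ltW // index_weight_gt0.
  by rewrite ger0_norm ?hC // addr_ge0 // ltW.
- have := @integrableZl _ (measurableTypeR R) _ leb half mh C _ iu; exact.
Qed.

Lemma L1w_parts f : in_L1w w f ->
  [/\ leb.-integrable half (EFin \o (fun tau => w tau * cRe f tau)),
      leb.-integrable half (EFin \o (fun tau => w tau * cIm f tau)),
      admissible (cRe f) & admissible (cIm f)].
Proof.
move=> [iR iI].
have jR : leb.-integrable half (EFin \o (fun tau => w tau * cRe f tau)).
  by apply: eq_integrable iR => // tau _; rewrite /= /cRe Re_Cmul.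
have jI : leb.-integrable half (EFin \o (fun tau => w tau * cIm f tau)).
  by apply: eq_integrable iI => // tau _; rewrite /= /cIm Im_Cmul.
by split=> //; exact: L1w_admissible.
Qed.

Definition index_integral u x : R := Rintegral leb half (fun tau => index_kernel c tau x * u tau).

Lemma index_integrandE f x tau : 0 < x -> 0 < tau ->
  index_integrand mu f x tau = (x * expR (- x) / Gamma c * index_kernel c tau x)%:C * f tau.
Proof.
move=> x0 t0; rewrite /index_integrand; congr (_ * _).
have mE : mu = (1 - c) / 2 by field.
by rewrite [in LHS]mE whittakerW_sqr.
Qed.

Lemma index_integrand_integrable f x : 0 < x -> admissible (cRe f) -> admissible (cIm f) ->
  integrableC half (index_integrand mu f x).
Proof.
move=> x0 aR aI; pose K := x * expR (- x) / Gamma c; split.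
  have i := index_kernel_integrable c0 x0 aR.
  have := @integrableZl _ (measurableTypeR R) _ leb half mh K _ i.
  apply: eq_integrable => // tau; rewrite inE in_half => t0.
  by rewrite /= /cRe index_integrandE // Re_Cmul -EFinM mulrA.
have i := index_kernel_integrable c0 x0 aI.
have := @integrableZl _ (measurableTypeR R) _ leb half mh K _ i.
apply: eq_integrable => // tau; rewrite inE in_half => t0.
by rewrite /= /cIm index_integrandE // Im_Cmul -EFinM mulrA.
Qed.

Lemma index_transformE f x : 0 < x -> admissible (cRe f) -> admissible (cIm f) ->
  index_transform mu f x = (index_integral (cRe f) x / Gamma c) +i* (index_integral (cIm f) x / Gamma c).
Proof.
move=> x0 aR aI; rewrite /index_transform /integralC.
have eR : Rintegral leb half (cRe (index_integrand mu f x)) = x * expR (- x) / Gamma c * index_integral (cRe f) x.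
  rewrite /index_integral -RintegralZl //; last exact: (index_kernel_integrable c0 x0 aR).
  apply: eq_Rintegral => tau; rewrite inE in_half => t0.
  by rewrite /cRe index_integrandE // Re_Cmul mulrA.
have eI : Rintegral leb half (cIm (index_integrand mu f x)) = x * expR (- x) / Gamma c * index_integral (cIm f) x.
  rewrite /index_integral -RintegralZl //; last exact: (index_kernel_integrable c0 x0 aI).
  apply: eq_Rintegral => tau; rewrite inE in_half => t0.
  by rewrite /cIm index_integrandE // Im_Cmul mulrA.
rewrite eR eI expRN; have ex := expR_gt0 x.
by apply: complexP; rewrite ?Re_Cmul ?Im_Cmul /=; field; rewrite !gt_eqF.
Qed.

Lemma index_integralD u v x : 0 < x -> admissible u -> admissible v ->
  index_integral (fun tau => u tau + v tau) x = index_integral u x + index_integral v x.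
Proof.
move=> x0 au av; rewrite /index_integral -RintegralD //; last 2 first.
- exact: (index_kernel_integrable c0 x0 au).
- exact: (index_kernel_integrable c0 x0 av).
by apply: eq_Rintegral => tau _; rewrite mulrDr.
Qed.

Lemma index_integralZ a u x : 0 < x -> admissible u -> index_integral (fun tau => a * u tau) x = a * index_integral u x.
Proof.
move=> x0 au; rewrite /index_integral -RintegralZl //; last exact: (index_kernel_integrable c0 x0 au).
by apply: eq_Rintegral => tau _; rewrite mulrCA.
Qed.

Lemma index_integral_continuous u x : 0 < x -> admissible u -> {for x, continuous (index_integral u)}.
Proof.
move=> x0 au; have d := laplaceR_derive c0 x0 (tame_olevskii c0 au).
apply: (@derive_continuous _ _ _ (- laplaceR (fun t => t * (t `^ (c - 1) * olevskii c u t)) x)).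
apply: (@derive_near R (laplaceR (fun t => t `^ (c - 1) * olevskii c u t)) _ _ _ x) => // t.
by rewrite ltr_norml => ht; rewrite /index_integral index_laplace //; lra.
Qed.

(** The norm is only compared with the two parts, at the price of a factor [2] in
    the operator bound. *)
Lemma normc_le z : ComplexField.Normc.normc z <= `|complex.Re z| + `|complex.Im z| :> R.
Proof.
case: z => a b /=; have h : 0 <= `|a| + `|b| by rewrite addr_ge0.
rewrite -[leRHS]ger0_norm // -sqrtr_sqr ler_wsqrtr // sqrrD !real_normK ?num_real //.
by rewrite lerD2r lerDl mulrn_wge0 // mulr_ge0.
Qed.

Lemma Re_le_normc z : `|complex.Re z| <= ComplexField.Normc.normc z :> R.
Proof. by case: z => a b /=; rewrite -sqrtr_sqr ler_wsqrtr // lerDl sqr_ge0. Qed.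

Lemma Im_le_normc z : `|complex.Im z| <= ComplexField.Normc.normc z :> R.
Proof. by case: z => a b /=; rewrite -sqrtr_sqr ler_wsqrtr // lerDr sqr_ge0. Qed.

Lemma normcE z : ComplexField.Normc.normc z = Num.sqrt (complex.Re z ^+ 2 + complex.Im z ^+ 2) :> R.
Proof. by case: z. Qed.

Lemma L1w_norm_integrable f : in_L1w w f ->
  leb.-integrable half (EFin \o (fun tau => ComplexField.Normc.normc (f tau) * w tau)).
Proof.
move=> /L1w_parts[iR iI [mR _] [mI _]].
have i := @integrableD _ (measurableTypeR R) _ leb half mh _ _ (integrable_abse iR) (integrable_abse iI).
apply: le_integrable i => //.
  apply/measurable_EFinP; apply: measurable_funM; last first.
    apply: measurable_half => t t0; have t1 : 0 < t + 1 by lra.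
    by rewrite /index_weight; cont.
  have ms : measurable_fun half (fun tau => cRe f tau ^+ 2 + cIm f tau ^+ 2).
    by apply: measurable_funD; exact: measurable_funX.
  have := measurableT_comp (continuous_measurable_fun (@sqrt_continuous R)) ms.
  by apply: eq_measurable_fun => tau _; rewrite normcE.
move=> tau; rewrite in_half => t0; have w0 := index_weight_gt0 t0.
rewrite /= lee_fin; apply: le_trans (ler_norm _).
rewrite [`|w tau * cRe f tau|]normrM [`|w tau * cIm f tau|]normrM.
rewrite [`|_ * w tau|]normrM (gtr0_norm w0) -mulrDr mulrC ler_wpM2l ?(ltW w0) //.
rewrite ger0_norm; first exact: normc_le.
by rewrite normcE sqrtr_ge0.
Qed.

Lemma index_transform_bound x0 : 0 < x0 -> exists C : R, forall f, in_L1w w f ->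
  forall x, x0 <= x -> ComplexField.Normc.normc (index_transform mu f x) <= C * L1w_norm w f.
Proof.
move=> x00; have [C [C0 hC]] := weight_dominates.
pose K := kernel_bound c * C / x0 `^ c.
have kb0 : 0 <= kernel_bound c := sqrtr_ge0 _.
have xc0 : 0 < x0 `^ c by rewrite powR_gt0.
exists (2 * K) => f Lf x x0x; have x1 : 0 < x by lra.
have [iR iI aR aI] := L1w_parts Lf; have iN := L1w_norm_integrable Lf.
have part u : admissible u -> (forall tau, `|u tau| <= ComplexField.Normc.normc (f tau)) ->
    `|index_integral u x / Gamma c| <= K * L1w_norm w f.
  move=> au uf; rewrite /index_integral index_laplace // normrM normfV (gtr0_norm G0) ler_pdivrMr //.
  apply: le_trans (index_laplace_bound c0 x1 au) _.
  have I0 : 0 <= Rintegral leb half (fun tau => (1 + tau) * `|u tau|).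
    by apply: Rintegral_ge0 => tau; rewrite in_half => t0; rewrite mulr_ge0 // addr_ge0 // ltW.
  have I1 : Rintegral leb half (fun tau => (1 + tau) * `|u tau|) <= C * L1w_norm w f.
    rewrite /L1w_norm -RintegralZl //; apply: le_Rintegral => //.
    - case: au => _ iu; apply: eq_integrable (integrable_abse iu) => // tau; rewrite inE in_half => t0.
      by rewrite /= normrM ger0_norm // addr_ge0 // ltW.
    - have := @integrableZl _ (measurableTypeR R) _ leb half mh C _ iN; exact.
    - move=> tau; rewrite in_half => t0; rewrite [ComplexField.Normc.normc _ * _]mulrC mulrA.
      by apply: ler_pM => //; [rewrite addr_ge0 // ltW|exact: hC].
  have g1 : laplace_powR c x <= Gamma c / x0 `^ c.
    have xc : 0 < x `^ c by rewrite powR_gt0.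
    have -> : laplace_powR c x = Gamma c / x `^ c.
      by rewrite -(laplace_powRE c0 x1) mulrAC divff ?mul1r // gt_eqF.
    rewrite ler_wpM2l ?(ltW G0) // lef_pV2 ?posrE //.
    by rewrite ge0_ler_powR // ?nnegrE ltW.
  have g0 : 0 <= laplace_powR c x.
    by apply: Rintegral_ge0 => t _; rewrite mulr_ge0 ?expR_ge0 ?powR_ge0.
  have -> : K * L1w_norm w f * Gamma c =
      kernel_bound c * (C * L1w_norm w f) * (Gamma c / x0 `^ c).
    by rewrite /K; field; rewrite gt_eqF.
  by apply: ler_pM => //; [rewrite mulr_ge0|rewrite ler_wpM2l].
rewrite index_transformE //; apply: le_trans (normc_le _) _ => /=.
have := part _ aR (fun tau => Re_le_normc (f tau)).
have := part _ aI (fun tau => Im_le_normc (f tau)).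
lra.
Qed.

Lemma olevskii_integrandE f t tau : 0 < t -> 0 < tau ->
  olevskii_integrand mu f t tau = (psi c tau t)%:C * f tau.
Proof.
move=> t0 tau0; rewrite /olevskii_integrand; congr (_ * _).
have -> : 2^-1 - mu = c / 2 by field.
have -> : - t ^+ 2 - 2 * t = - (t ^+ 2 + 2 * t) by ring.
rewrite hyp2F1_neg //; rewrite addr_gt0 ?mulr_gt0 ?exprn_gt0 //.
Qed.

Lemma olevskii_integrand_integrable f t : 0 < t -> admissible (cRe f) -> admissible (cIm f) ->
  integrableC half (olevskii_integrand mu f t).
Proof.
move=> t0 aR aI; split.
  apply: eq_integrable (olevskii_integrable c0 t0 aR) => // tau; rewrite inE in_half => tau0.
  by rewrite /= /cRe olevskii_integrandE // Re_Cmul.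
apply: eq_integrable (olevskii_integrable c0 t0 aI) => // tau; rewrite inE in_half => tau0.
by rewrite /= /cIm olevskii_integrandE // Im_Cmul.
Qed.

Lemma olevskii_transformE f t : 0 < t ->
  olevskii_transform mu f t =
  ((Gamma c)^-1 * olevskii c (cRe f) t) +i* ((Gamma c)^-1 * olevskii c (cIm f) t).
Proof.
move=> t0; rewrite /olevskii_transform /integralC.
have -> : Rintegral leb half (cRe (olevskii_integrand mu f t)) = olevskii c (cRe f) t.
  apply: eq_Rintegral => tau; rewrite inE in_half => tau0.
  by rewrite /cRe olevskii_integrandE // Re_Cmul.
have -> : Rintegral leb half (cIm (olevskii_integrand mu f t)) = olevskii c (cIm f) t.
  apply: eq_Rintegral => tau; rewrite inE in_half => tau0.
  by rewrite /cIm olevskii_integrandE // Im_Cmul.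
by apply: complexP; rewrite ?Re_Cmul ?Im_Cmul.
Qed.

Lemma laplace_olevskii f x : 0 < x -> admissible (cRe f) -> admissible (cIm f) ->
  let h := fun t : R => (t `^ (- (2 * mu)))%:C * olevskii_transform mu f t in
  integrableC half (laplace_integrand h x) /\
  index_transform mu f x = laplace_transform h x.
Proof.
move=> x0 aR aI h.
have pE (t : R) : t `^ (- (2 * mu)) = t `^ (c - 1) by congr (_ `^ _); ring.
have hR t : 0 < t -> cRe (laplace_integrand h x) t =
    (Gamma c)^-1 * (expR (- (x * t)) * (t `^ (c - 1) * olevskii c (cRe f) t)).
  move=> t0; rewrite /cRe /laplace_integrand /h Re_Cmul Re_Cmul olevskii_transformE //= pE.
  by ring.
have hI t : 0 < t -> cIm (laplace_integrand h x) t =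
    (Gamma c)^-1 * (expR (- (x * t)) * (t `^ (c - 1) * olevskii c (cIm f) t)).
  move=> t0; rewrite /cIm /laplace_integrand /h Im_Cmul Im_Cmul olevskii_transformE //= pE.
  by ring.
have iR := tame_integrable c0 x0 (tame_olevskii c0 aR).
have iI := tame_integrable c0 x0 (tame_olevskii c0 aI).
split.
  split.
    have := @integrableZl _ (measurableTypeR R) _ leb half mh (Gamma c)^-1 _ iR.
    by apply: eq_integrable => // t; rewrite inE in_half => t0; rewrite /= hR.
  have := @integrableZl _ (measurableTypeR R) _ leb half mh (Gamma c)^-1 _ iI.
  by apply: eq_integrable => // t; rewrite inE in_half => t0; rewrite /= hI.
rewrite index_transformE // /laplace_transform /integralC /index_integral !index_laplace //.
apply: complexP => /=.
  rewrite mulrC /laplaceR -RintegralZl //; apply: eq_Rintegral => t.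
  by rewrite inE in_half => t0; apply/esym; exact: hR.
rewrite mulrC /laplaceR -RintegralZl //; apply: eq_Rintegral => t.
by rewrite inE in_half => t0; apply/esym; exact: hI.
Qed.

Lemma index_transform_linear (a : R[i]) f g x : 0 < x -> in_L1w w f -> in_L1w w g ->
  index_transform mu (fun tau => a * f tau + g tau) x =
  a * index_transform mu f x + index_transform mu g x.
Proof.
move=> x0 /L1w_parts[_ _ fR fI] /L1w_parts[_ _ gR gI].
case: a => p q.
have eR : cRe (fun tau => (p +i* q) * f tau + g tau) =
    (fun tau => (p * cRe f tau + - q * cIm f tau) + cRe g tau).
  by apply/funext => tau; rewrite /cRe /cIm ReD; case: (f tau) => r s /=; ring.
have eI : cIm (fun tau => (p +i* q) * f tau + g tau) =
    (fun tau => (p * cIm f tau + q * cRe f tau) + cIm g tau).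
  by apply/funext => tau; rewrite /cRe /cIm ImD; case: (f tau) => r s /=; ring.
have [a1 a2 a3 a4] := And4 (admissibleZ p fR) (admissibleZ (- q) fI) (admissibleZ p fI) (admissibleZ q fR).
have a12 := admissibleD a1 a2; have a34 := admissibleD a3 a4.
rewrite !index_transformE // ?eR ?eI; last 2 first.
- exact: admissibleD.
- exact: admissibleD.
rewrite !index_integralD // !index_integralZ //.
by apply: complexP => /=; ring.
Qed.

Lemma index_transform_continuous x0 f : 0 < x0 -> in_L1w w f ->
  continuousC_on `[x0, +oo[%classic (index_transform mu f).
Proof.
move=> x00 /L1w_parts[_ _ aR aI].
have part (F : R[i] -> R) (u : R -> R) : admissible u ->
    (forall x, 0 < x -> F (index_transform mu f x) = index_integral u x / Gamma c) ->
    {within `[x0, +oo[%classic, continuous (fun x => F (index_transform mu f x))}.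
  move=> au Fu; apply: continuous_in_subspaceT => x.
  rewrite inE /= in_itv /= andbT => x0x; have x1 : 0 < x by lra.
  have cJ : {for x, continuous (fun x => index_integral u x / Gamma c)}.
    by apply: (@cvgMl _ _ _ _ _ _ _); exact: index_integral_continuous.
  rewrite /continuous_at Fu //.
  apply: cvg_trans cJ; apply: near_eq_cvg.
  near=> y; rewrite Fu //; near: y; exact: lt_nbhsr.
split.
  by apply: (part (@complex.Re R) (cRe f) aR) => x x1; rewrite index_transformE.
by apply: (part (@complex.Im R) (cIm f) aI) => x x1; rewrite index_transformE.
Unshelve. all: by end_near. Qed.

End Assembly.

Theorem theorem1 (R : realType) (mu delta x0 : R)
    (hmu : mu < 1 / 2) (hdelta0 : 0 <= delta) (hdelta : delta < pi / 2)
    (hx0 : 0 < x0) :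
  bounded_L1w_to_C (index_weight mu delta) x0 (index_transform mu) /\
  forall f : R -> R[i], in_L1w (index_weight mu delta) f ->
    [/\ forall x : R, 0 < x -> integrableC `]0, +oo[ (index_integrand mu f x),
        forall t : R, 0 < t -> integrableC `]0, +oo[ (olevskii_integrand mu f t) &
        forall x : R, 0 < x ->
          let h := fun t : R => (t `^ (- (2 * mu)))%:C * olevskii_transform mu f t in
          integrableC `]0, +oo[ (laplace_integrand h x) /\
          index_transform mu f x = laplace_transform h x].
Proof.
split.
  split.
  - move=> a f g Lf Lg x x0x.
    by apply: (index_transform_linear hmu hdelta a _ Lf Lg); exact: lt_le_trans x0x.
  - by move=> f Lf; exact: (index_transform_continuous hmu hdelta hx0 Lf).
  - exact: (index_transform_bound hmu hdelta hx0).
move=> f /(L1w_parts hmu hdelta)[_ _ aR aI]; split.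
- by move=> x x1; exact: index_integrand_integrable.
- by move=> t t0; exact: olevskii_integrand_integrable.
- by move=> x x1; exact: laplace_olevskii.
Qed.
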